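(* Assume that the discrete inf-sup conditions $$\sup_{0\neq\boldsymbol{v}_h\in V_{b,h}}\frac{\langle Bq_h,\boldsymbol{v}_h\rangle_V}{\|\boldsymbol{v}_h\|_V}\ge c\,\|q_h\|_Q\ \ \forall q_h\in Q_h,\qquad \sup_{0\neq\boldsymbol{v}_h\in V_h}\frac{\langle\mu_h,\gamma_n\boldsymbol{v}_h\rangle_\Sigma}{\|\boldsymbol{v}_h\|_V}\ge c\,\|\mu_h\|_{\Sigma'}\ \ \forall\mu_h\in\Sigma_h$$ hold with a constant $c>0$ independent of $h$. Let $(\boldsymbol{u},p,\lambda)\in V\times Q\times\Lambda$ be the solution of the continuous mixed problem (M) and $(\boldsymbol{u}_h,p_h,\lambda_h)\in V_h\times Q_h\times\Lambda_h$ the solution of the discrete mixed problem (M$_h$). Then there is a constant $C>0$, independent of $h$ and of the continuous and discrete solutions, such that $$\|p-p_h\|_Q\le C\left(\mathrm{E}(\boldsymbol{u},\boldsymbol{u}_h)^{1/r'}+\|p-q_h\|_Q\right),$$ $$\|\lambda-\lambda_h\|_{\Sigma'}\le C\left(\mathrm{E}(\boldsymbol{u},\boldsymbol{u}_h)^{1/r'}+\|p-q_h\|_Q+\|\lambda-\mu_h\|_{\Sigma'}\right)$$ for all $q_h\in Q_h$ and $\mu_h\in\Sigma_h$.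
   Context: $\Omega\subset\mathbb{R}^2$ is a connected (bounded) polygonal domain whose boundary is partitioned into three disjoint relatively open sets $\Gamma_s,\Gamma_b,\Gamma_d$ of positive measure; $\Gamma_d$ lies on a vertical line. $\boldsymbol{n}$ is the unit outward normal on $\partial\Omega$, $\boldsymbol{\mathrm{T}}=\boldsymbol{\mathrm{I}}-\boldsymbol{n}\boldsymbol{n}^\top$. $r\in(1,2]$ and $r'=r/(r-1)$. $\boldsymbol{\mathrm{D}}\boldsymbol{v}=\frac12(\nabla\boldsymbol{v}+\nabla\boldsymbol{v}^\top)$ and $|\cdot|$ is the Euclidean/Frobenius norm. $\alpha\in L^\infty(\Omega)$ with $\alpha\ge\alpha_0$ a.e. for some $\alpha_0>0$; $\tau>0$ is a constant. Data: $\boldsymbol{f}\in L^{r'}(\Omega)^2$, $p_s\in L^{r'}(\Gamma_s)$, $p_w\in L^{r'}(\Gamma_b)$. For a normed space $X$, $X'$ is its dual and $\langle\cdot,\cdot\rangle_X$ the duality pairing. $V=\{\boldsymbol{v}\in W^{1,r}(\Omega)^2: \boldsymbol{v}\cdot\boldsymbol{n}=0\text{ on }\Gamma_d\}$ with the $W^{1,r}$ norm, $Q=L^{r'}(\Omega)$. $\gamma_n:V\to L^r(\Gamma_b)$ is the normal trace $\boldsymbol{v}\mapsto\boldsymbol{v}\cdot\boldsymbol{n}|_{\Gamma_b}$. $V_b=\{\boldsymbol{v}\in V:\gamma_n\boldsymbol{v}=0\text{ a.e. on }\Gamma_b\}$. $\Sigma$ is the range of $\gamma_n$ with the $W^{1-1/r,r}(\Gamma_b)$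 norm, assumed to be a Banach space. $\Lambda=\{\mu\in\Sigma':\langle\mu,\zeta\rangle_\Sigma\ge0\ \ \forall\zeta\in\Sigma\text{ with }\zeta\le0\}$. Operators: $\langle A\boldsymbol{u},\boldsymbol{v}\rangle_V=\int_\Omega\alpha|\boldsymbol{\mathrm{D}}\boldsymbol{u}|^{r-2}(\boldsymbol{\mathrm{D}}\boldsymbol{u}:\boldsymbol{\mathrm{D}}\boldsymbol{v})\,dx$, $\langle G\boldsymbol{u},\boldsymbol{v}\rangle_V=\int_{\Gamma_b}\tau|\boldsymbol{\mathrm{T}}\boldsymbol{u}|^{r-2}(\boldsymbol{\mathrm{T}}\boldsymbol{u}\cdot\boldsymbol{\mathrm{T}}\boldsymbol{v})\,ds$, $\langle Bq,\boldsymbol{v}\rangle_V=\int_\Omega(\nabla\cdot\boldsymbol{v})q\,dx$, $\langle F,\boldsymbol{v}\rangle_V=\int_\Omega\boldsymbol{f}\cdot\boldsymbol{v}\,dx+\int_{\Gamma_s}p_s(\boldsymbol{v}\cdot\boldsymbol{n})\,ds-\int_{\Gamma_b}p_w(\boldsymbol{v}\cdot\boldsymbol{n})\,ds$. Continuous mixed problem (M): find $(\boldsymbol{u},p,\lambda)\in V\times Q\times\Lambda$ with $\langle A\boldsymbol{u}+G\boldsymbol{u}-Bp-F,\boldsymbol{v}\rangle_V-\langle\lambda,\gamma_n\boldsymbol{v}\rangle_\Sigma=0$ for all $\boldsymbol{v}\in V$; $\langle Bq,\boldsymbol{u}\rangle_V=0$ for all $q\in Q$; $\langle\mu-\lambda,\gamma_n\boldsymbol{u}\rangle_\Sigma\ge0$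 for all $\mu\in\Lambda$. $R_V=\{\boldsymbol{r}\in V: \int_\Omega|\boldsymbol{\mathrm{D}}\boldsymbol{r}|^r\,dx+\int_{\Gamma_b}|\boldsymbol{\mathrm{T}}\boldsymbol{r}|^r\,ds=0\}$ (rigid modes in $V$ with vanishing tangential component on $\Gamma_b$; $\dim R_V\le 1$). Discretisation: for each $h>0$, $V_h\subset V$, $Q_h\subset Q$, $\Sigma_h\subset L^2(\Gamma_b)$ are finite dimensional subspaces with $R_V\subset V_h$; elements of $\Sigma_h$ are regarded as elements of $\Sigma'$ via $\langle\mu_h,\zeta\rangle_\Sigma=\int_{\Gamma_b}\mu_h\zeta\,ds$. $V_{b,h}=V_h\cap V_b$. $\Lambda_h=\{\mu_h\in\Sigma_h:\mu_h\le0\text{ on }\Gamma_b\}$. Discrete mixed problem (M$_h$): find $(\boldsymbol{u}_h,p_h,\lambda_h)\in V_h\times Q_h\times\Lambda_h$ with $\langle A\boldsymbol{u}_h+G\boldsymbol{u}_h-Bp_h-F,\boldsymbol{v}_h\rangle_V-\langle\lambda_h,\gamma_n\boldsymbol{v}_h\rangle_\Sigma=0$ for all $\boldsymbol{v}_h\in V_h$; $\langle Bq_h,\boldsymbol{u}_h\rangle_V=0$ for all $q_h\in Q_h$; $\langle\mu_h-\lambda_h,\gamma_n\boldsymbol{u}_h\rangle_\Sigma\ge0$ for all $\mu_h\in\Lambda_h$. $\boldsymbol{\mathrm{F}}(\mathrm{A})=|\mathrm{A}|^{\frac{r-2}{2}}\mathrm{A}$ for $\mathrm{A}\in\mathbb{R}^{2\times2}$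 or $\mathrm{A}\in\mathbb{R}^2$ and $\mathrm{E}(\boldsymbol{u},\boldsymbol{v})=\|\boldsymbol{\mathrm{F}}(\boldsymbol{\mathrm{D}}\boldsymbol{u})-\boldsymbol{\mathrm{F}}(\boldsymbol{\mathrm{D}}\boldsymbol{v})\|^2_{L^2(\Omega)}+\|\boldsymbol{\mathrm{F}}(\boldsymbol{\mathrm{T}}\boldsymbol{u})-\boldsymbol{\mathrm{F}}(\boldsymbol{\mathrm{T}}\boldsymbol{v})\|^2_{L^2(\Gamma_b)}$. *)

(* Defs.v *)
From HB Require Import structures.
From mathcomp Require Import all_boot all_order all_algebra.
From mathcomp Require Import all_classical all_reals all_analysis.
From mathcomp Require Import measurable_realfun.

Set Implicit Arguments.
Unset Strict Implicit.
Unset Printing Implicit Defensive.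
Import Order.TTheory GRing.Theory Num.Theory.
Import numFieldNormedType.Exports.
Local Open Scope classical_set_scope.
Local Open Scope ring_scope.

(* Points of the plane are pairs, so that the product topology, the product
   sigma-algebra and the product measure of the library apply. Values of
   vector fields are column vectors. *)
Notation plane R := (R * R)%type.

(* The same type, seen as a product of measurable types: [lebesgue_measure] lives
   on [measurableTypeR R], whose display differs from the one inferred for R. *)
Notation mplane R := (measurableTypeR R * measurableTypeR R)%type.

(* An element of W^{1,r}(Omega)^2 is given by a representative u.1 together with
   a representative u.2 of its weak gradient; see [sobolev] below. *)
Notation vfield R := ((plane R -> 'cV[R]_2) * (plane R -> 'M[R]_2))%type.

Section Euclidean.
Context {R : realType}.

Definition mxdot {m n} (A B : 'M[R]_(m, n)) : R := \sum_i \sum_j A i j * B i j.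

Definition mxnorm {m n} (A : 'M[R]_(m, n)) : R := Num.sqrt (mxdot A A).

Definition vec (x : plane R) : 'cV[R]_2 :=
  \col_i (if i == ord0 then x.1 else x.2).

Definition dist (x y : plane R) : R := mxnorm (vec x - vec y).

End Euclidean.

Section Geometry.
Context {R : realType}.

Definition seg_point (e : plane R * plane R) (t : R) : plane R :=
  (e.1.1 + t * (e.2.1 - e.1.1), e.1.2 + t * (e.2.2 - e.1.2)).

Definition segment (e : plane R * plane R) : set (plane R) :=
  [set seg_point e t | t in [set t : R | 0 <= t <= 1]].

Lemma measurable_seg_point e :
  @measurable_fun _ _ (measurableTypeR R) (mplane R) setT (seg_point e).
Proof.
by apply: measurable_fun_pair; apply: measurable_funD => //;
  exact: measurable_funM.
Qed.

(* Length measure carried by the segment e. *)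
Definition edge_measure (e : plane R * plane R)
    (A : set (mplane R)) : \bar R :=
  ((dist e.1 e.2)%:E *
   lebesgue_measure ([set t : R | (0 <= t <= 1)%R] `&` seg_point e @^-1` A))%E.

Section EdgeMeasure.
Variable e : plane R * plane R.
Local Open Scope ereal_scope.

Let edge_measure0 : edge_measure e set0 = 0.
Proof. by rewrite /edge_measure preimage_set0 setI0 measure0 mule0. Qed.

Let edge_measure_ge0 A : 0 <= edge_measure e A.
Proof. by rewrite /edge_measure mule_ge0// lee_fin sqrtr_ge0. Qed.

Let edge_measure_sigma_additive : semi_sigma_additive (edge_measure e).
Proof.
move=> F mF tF mUF.
pose P (A : set (mplane R)) : set (measurableTypeR R) :=
  [set t : R | (0 <= t <= 1)%R] `&` seg_point e @^-1` A.
have mP A : measurable A -> measurable (P A).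
  move=> mA; apply: measurableI; first last.
    by rewrite -[X in measurable X]setTI; exact: measurable_seg_point.
  rewrite (_ : mkset _ = `[0%R, 1%R]%classic); first exact: measurable_itv.
  by apply/seteqP; split => t; rewrite /= in_itv.
have d0 : (0 <= dist e.1 e.2)%R by exact: sqrtr_ge0.
rewrite [X in X @ \oo --> _](_ : _ = (fun n => (dist e.1 e.2)%:E *
    \sum_(0 <= i < n) lebesgue_measure (P (F i)))); last first.
  by apply/funext => n; rewrite ge0_sume_distrr.
rewrite /edge_measure -/(P _).
have PU : P (\bigcup_n F n) = \bigcup_n P (F n).
  by rewrite /P preimage_bigcup setI_bigcupr.
have [->|dn0] := eqVneq (dist e.1 e.2) 0%R.
  rewrite mul0e [X in X @ \oo --> _](_ : _ = cst 0); first exact: cvg_cst.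
  by under eq_fun do rewrite mul0e.
apply: cvgeZl => //; rewrite PU.
apply: measure_semi_sigma_additive.
- by move=> n; exact: mP.
- apply/trivIsetP => i j _ _ ij; rewrite -subset0 => t [[_ Fit] [_ Fjt]].
  have/trivIsetP/(_ i j Logic.I Logic.I ij) := tF.
  by rewrite -subset0 => /(_ (seg_point e t)); exact.
- by rewrite -PU; exact: mP.
Qed.

HB.instance Definition _ := isMeasure.Build _ _ _ (edge_measure e)
  edge_measure0 edge_measure_ge0 edge_measure_sigma_additive.

End EdgeMeasure.

(* Length measure ds on a union of non-overlapping segments. *)
Definition arclength (es : seq (plane R * plane R))
    : {measure set (mplane R) -> \bar R} :=
  msum (fun k => edge_measure (nth (0, 0) es k)) (size es).

Definition area : {measure set (mplane R) -> \bar R} :=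
  (lebesgue_measure \x lebesgue_measure)%E.

End Geometry.

Section LebesgueSpaces.
Context {R : realType} (mu : {measure set (mplane R) -> \bar R}).
Context (D : set (plane R)).

Definition Lpnorm (p : \bar R) (f : plane R -> R) : \bar R :=
  ('N[mu]_p[EFin \o (f \_ D)])%E.

Definition Lp (p : \bar R) : set (plane R -> R) :=
  [set f | @measurable_fun _ _ (mplane R) R D f /\ (Lpnorm p f < +oo)%E].

Definition Lpnorm_mx {m n} (p : \bar R) (A : plane R -> 'M[R]_(m, n)) : \bar R :=
  Lpnorm p (fun x => mxnorm (A x)).

Definition Lp_mx {m n} (p : \bar R) : set (plane R -> 'M[R]_(m, n)) :=
  [set A : plane R -> 'M[R]_(m, n) |
     (forall i j, @measurable_fun _ _ (mplane R) R D (fun x => A x i j)) /\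
     (Lpnorm_mx p A < +oo)%E].

End LebesgueSpaces.

Section Duality.
Context {R : realType} {X : lmodType R}.
(* S is a subspace of X and N a seminorm on it; elements of S at distance zero
   are identified. *)
Context (S : set X) (N : X -> \bar R).

Definition banach : Prop :=
  (forall x, S x -> (N x < +oo)%E) /\
  (forall z : nat -> X, (forall k, S (z k)) ->
     (forall e : R, 0 < e -> exists K : nat, forall k l : nat,
        (K <= k)%N -> (K <= l)%N -> (N (z k - z l)%R < e%:E)%E) ->
     exists2 x, S x & (fun k => N (z k - x)) @ \oo --> 0%E).

(* Functionals are only considered on S; their values outside S are irrelevant. *)
Definition dual : set (X -> R) :=
  [set mu | (forall a x y, S x -> S y -> mu (a *: x + y) = a * mu x + mu y) /\
            exists C : R, forall x, S x -> (`|mu x|%:E <= C%:E * N x)%E].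

Definition dualnorm (mu : X -> R) : \bar R :=
  ereal_sup [set `|mu x|%:E | x in [set x | S x /\ (N x <= 1)%E]].

Definition findim_subspace (Y : set X) : Prop :=
  exists (n : nat) (b : 'I_n -> X), (forall i, S (b i)) /\
    Y = [set x | S x /\ exists c : 'I_n -> R, N (x - \sum_i c i *: b i) = 0%E].

End Duality.

Section Sobolev.
Context {R : realType}.

Definition basis_vec (j : 'I_2) : plane R := if j == ord0 then (1, 0) else (0, 1).

Definition partial (j : 'I_2) (phi : plane R -> R) : plane R -> R :=
  fun x => 'D_(basis_vec j) phi x.

Definition smooth (phi : plane R -> R) : Prop :=
  forall s : seq 'I_2,
    continuous (foldr partial phi s) /\
    forall j x, derivable (foldr partial phi s) x (basis_vec j).

Definition test_function (Omega : set (plane R)) (phi : plane R -> R) : Prop :=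
  [/\ smooth phi, compact (closure [set x | phi x != 0]) &
      closure [set x | phi x != 0] `<=` Omega].

Definition weak_gradient (Omega : set (plane R))
    (u : plane R -> 'cV[R]_2) (g : plane R -> 'M[R]_2) : Prop :=
  forall i j phi, test_function Omega phi ->
    \int[area]_(x in Omega) (u x i ord0 * partial j phi x) =
    - \int[area]_(x in Omega) (g x i j * phi x).

Definition sobolev (Omega : set (plane R)) (r : R) : set (vfield R) :=
  [set u | [/\ Lp_mx area Omega r%:E u.1, Lp_mx area Omega r%:E u.2 &
               weak_gradient Omega u.1 u.2]].

Definition sobolev_norm (Omega : set (plane R)) (r : R) (u : vfield R) : \bar R :=
  ((Lpnorm_mx area Omega r%:E u.1 `^ r + Lpnorm_mx area Omega r%:E u.2 `^ r)
     `^ r^-1)%E.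

Definition symgrad (u : vfield R) (x : plane R) : 'M[R]_2 :=
  2^-1 *: (u.2 x + (u.2 x)^T).

Definition div (u : vfield R) (x : plane R) : R := \tr (u.2 x).

End Sobolev.

Record geometry (R : realType) := Geometry {
  dom : set (plane R);
  edges : seq (plane R * plane R);
  Gamma_s : set (plane R);
  Gamma_b : set (plane R);
  Gamma_d : set (plane R) }.

Section Domain.
Context {R : realType}.

Definition boundary (Omega : set (plane R)) : set (plane R) :=
  closure Omega `\` interior Omega.

(* Near x, Omega is the half-plane lying behind x in direction nu. *)
Definition outward_normal_at (Omega : set (plane R)) (x : plane R)
    (nu : 'cV[R]_2) : Prop :=
  mxnorm nu = 1 /\
  exists2 e : R, 0 < e & forall y, dist x y < e ->
    (Omega y <-> mxdot (vec y - vec x) nu < 0).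

(* Equal to 0 at the boundary points near which Omega is not a half-plane, i.e.
   at the corners. *)
Definition normal (Omega : set (plane R)) (x : plane R) : 'cV[R]_2 :=
  xget 0 [set nu | outward_normal_at Omega x nu].

Context (G : geometry R).

Definition ds : {measure set (mplane R) -> \bar R} := arclength (edges G).

Definition polygonal_domain : Prop :=
  [/\ open (dom G), connected (dom G) & bounded_set (dom G)] /\
  [/\ boundary (dom G) = \bigcup_(e in [set e | e \in edges G]) segment e,
      (forall e, e \in edges G -> e.1 != e.2),
      (forall i j : nat, (i < size (edges G))%N -> (j < size (edges G))%N ->
         i <> j ->
         let ei := nth (0, 0) (edges G) i in
         let ej := nth (0, 0) (edges G) j in
         segment ei `&` segment ej `<=`
           [set x | (x = ei.1 \/ x = ei.2) /\ (x = ej.1 \/ x = ej.2)]) &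
      forall e, e \in edges G -> exists nu, forall t, 0 < t < 1 ->
        outward_normal_at (dom G) (seg_point e t) nu].

Definition boundary_part (Gamma : set (plane R)) : Prop :=
  (exists2 O, open O & Gamma = boundary (dom G) `&` O) /\ (0 < ds Gamma)%E.

(* As usual, the three open parts cover the boundary up to a null set. *)
Definition boundary_partition : Prop :=
  [/\ boundary_part (Gamma_s G), boundary_part (Gamma_b G) &
      boundary_part (Gamma_d G)] /\
  [/\ Gamma_s G `&` Gamma_b G = set0, Gamma_s G `&` Gamma_d G = set0,
      Gamma_b G `&` Gamma_d G = set0,
      ds (boundary (dom G) `\` (Gamma_s G `|` Gamma_b G `|` Gamma_d G)) = 0%E &
      exists x1, forall x, Gamma_d G x -> x.1 = x1].

(* The trace operator: the bounded linear operator from W^{1,r}(Omega)^2 to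
   L^r(boundary)^2 extending the restriction to the boundary of the fields that
   are continuous up to the boundary. *)
Definition trace_operator (r : R)
    (tr : (plane R -> 'cV[R]_2) -> plane R -> 'cV[R]_2) : Prop :=
  [/\ (forall u, sobolev (dom G) r u ->
         Lp_mx ds (boundary (dom G)) r%:E (tr u.1)),
      (forall a u v, sobolev (dom G) r u -> sobolev (dom G) r v ->
         tr (a *: u.1 + v.1) = a *: tr u.1 + tr v.1
           %[ae ds in boundary (dom G)]),
      (exists C : R, forall u, sobolev (dom G) r u ->
         (Lpnorm_mx ds (boundary (dom G)) r%:E (tr u.1) <=
            C%:E * sobolev_norm (dom G) r u)%E) &
      forall u, sobolev (dom G) r u ->
        {within closure (dom G), continuous u.1} ->
        tr u.1 = u.1 %[ae ds in boundary (dom G)]].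

End Domain.

Section Problem.
Context {R : realType} (G : geometry R) (r : R).
Context (tr : (plane R -> 'cV[R]_2) -> plane R -> 'cV[R]_2).
Context (alpha : plane R -> R) (tau : R).

Local Notation Omega := (dom G).
Local Notation Gs := (Gamma_s G).
Local Notation Gb := (Gamma_b G).
Local Notation Gd := (Gamma_d G).
Local Notation ds := (ds G).
Local Notation n := (normal Omega).

Definition conj_exp : R := r / (r - 1).
Local Notation r' := conj_exp.

Definition normal_trace (v : vfield R) (x : plane R) : R :=
  mxdot (tr v.1 x) (n x).

Definition tangential (v : vfield R) (x : plane R) : 'cV[R]_2 :=
  (1%:M - n x *m (n x)^T) *m tr v.1 x.

Definition V : set (vfield R) :=
  [set v | sobolev Omega r v /\ normal_trace v = cst 0 %[ae ds in Gd]].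

Definition normV : vfield R -> \bar R := sobolev_norm Omega r.

Definition Q : set (plane R -> R) := Lp area Omega r'%:E.

Definition normQ : (plane R -> R) -> \bar R := Lpnorm area Omega r'%:E.

Definition Vb : set (vfield R) :=
  [set v | V v /\ normal_trace v = cst 0 %[ae ds in Gb]].

Definition Sigma : set (plane R -> R) :=
  [set zeta | Lp ds Gb r%:E zeta /\
              exists2 v, V v & zeta = normal_trace v %[ae ds in Gb]].

(* Sobolev-Slobodeckij norm of W^{s,r}(Gamma_b), s = 1 - 1/r, Gamma_b being
   one-dimensional. *)
Definition normSigma (zeta : plane R -> R) : \bar R :=
  let s := 1 - r^-1 in
  ((Lpnorm ds Gb r%:E zeta `^ r +
    \int[ds]_(x in Gb) \int[ds]_(y in Gb)
      (`|zeta x - zeta y| `^ r / dist x y `^ (1 + s * r))%:E) `^ r^-1)%E.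

Definition dualSigma : set ((plane R -> R) -> R) := dual Sigma normSigma.

Definition normSigma' : ((plane R -> R) -> R) -> \bar R :=
  dualnorm Sigma normSigma.

Definition Lambda : set ((plane R -> R) -> R) :=
  [set mu | dualSigma mu /\
     forall zeta, Sigma zeta -> (\forall x \ae ds, Gb x -> zeta x <= 0) ->
       0 <= mu zeta].

(* The functional on Sigma defined by a function on Gamma_b. *)
Definition pairing (mu zeta : plane R -> R) : R :=
  \int[ds]_(x in Gb) (mu x * zeta x).

Definition opA (u v : vfield R) : R :=
  \int[area]_(x in Omega)
    (alpha x * mxnorm (symgrad u x) `^ (r - 2) *
     mxdot (symgrad u x) (symgrad v x)).

Definition opG (u v : vfield R) : R :=
  \int[ds]_(x in Gb)
    (tau * mxnorm (tangential u x) `^ (r - 2) *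
     mxdot (tangential u x) (tangential v x)).

Definition opB (q : plane R -> R) (v : vfield R) : R :=
  \int[area]_(x in Omega) (div v x * q x).

Definition opF (f : plane R -> 'cV[R]_2) (ps pw : plane R -> R)
    (v : vfield R) : R :=
  \int[area]_(x in Omega) mxdot (f x) (v.1 x) +
  \int[ds]_(x in Gs) (ps x * normal_trace v x) -
  \int[ds]_(x in Gb) (pw x * normal_trace v x).

Definition mixed_solution (f : plane R -> 'cV[R]_2) (ps pw : plane R -> R)
    (u : vfield R) (p : plane R -> R) (lam : (plane R -> R) -> R) : Prop :=
  [/\ V u, Q p & Lambda lam] /\
  [/\ (forall v, V v ->
         opA u v + opG u v - opB p v - opF f ps pw v - lam (normal_trace v) = 0),
      (forall q, Q q -> opB q u = 0) &
      forall mu, Lambda mu ->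
        0 <= mu (normal_trace u) - lam (normal_trace u)].

Definition rigid : set (vfield R) :=
  [set v | V v /\
     (\int[area]_(x in Omega) (mxnorm (symgrad v x) `^ r)%:E +
      \int[ds]_(x in Gb) (mxnorm (tangential v x) `^ r)%:E = 0)%E].

Definition Lambda_h (Sh : set (plane R -> R)) : set (plane R -> R) :=
  [set mu | Sh mu /\ \forall x \ae ds, Gb x -> mu x <= 0].

(* For r < 4/3 the inclusion of L^2(Gamma_b) in the dual of Sigma is not
   automatic: the last clause is the standing identification of the elements of
   Sh with elements of that dual. *)
Definition discrete_spaces (Vh : set (vfield R)) (Qh Sh : set (plane R -> R))
    : Prop :=
  [/\ findim_subspace V normV Vh, rigid `<=` Vh,
      findim_subspace Q normQ Qh,
      findim_subspace (Lp ds Gb 2%:E) (Lpnorm ds Gb 2%:E) Sh &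
      forall mu, Sh mu -> dualSigma (pairing mu) /\
        forall zeta, Sigma zeta -> ds.-integrable Gb (EFin \o (mu \* zeta))].

Definition discrete_solution (Vh : set (vfield R)) (Qh Sh : set (plane R -> R))
    (f : plane R -> 'cV[R]_2) (ps pw : plane R -> R)
    (uh : vfield R) (ph lamh : plane R -> R) : Prop :=
  [/\ Vh uh, Qh ph & Lambda_h Sh lamh] /\
  [/\ (forall v, Vh v ->
         opA uh v + opG uh v - opB ph v - opF f ps pw v
           - pairing lamh (normal_trace v) = 0),
      (forall q, Qh q -> opB q uh = 0) &
      forall mu, Lambda_h Sh mu ->
        0 <= pairing mu (normal_trace uh) - pairing lamh (normal_trace uh)].

Definition infsup_B (Vh : set (vfield R)) (Qh : set (plane R -> R)) (c : R)
    : Prop :=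
  forall q, Qh q ->
    (c%:E * normQ q <=
     ereal_sup [set (opB q v / fine (normV v))%:E |
                 v in [set v | [/\ Vh v, Vb v & normV v != 0%E]]])%E.

Definition infsup_Sigma (Vh : set (vfield R)) (Sh : set (plane R -> R)) (c : R)
    : Prop :=
  forall mu, Sh mu ->
    (c%:E * normSigma' (pairing mu) <=
     ereal_sup [set (pairing mu (normal_trace v) / fine (normV v))%:E |
                 v in [set v | Vh v /\ normV v != 0%E]])%E.

Definition Fr {m k} (A : 'M[R]_(m, k)) : 'M[R]_(m, k) :=
  mxnorm A `^ ((r - 2) / 2) *: A.

Definition E (u v : vfield R) : \bar R :=
  (Lpnorm_mx area Omega 2%:E (fun x => Fr (symgrad u x) - Fr (symgrad v x))%R
     ^+ 2 +
   Lpnorm_mx ds Gb 2%:E (fun x => Fr (tangential u x) - Fr (tangential v x))%R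
     ^+ 2)%E.

End Problem.

(* Main.v *)
(** Testing both momentum equations with a discrete field v and subtracting gives
      lambda(v.n) - lambda_h(v.n) = <A u + G u - A u_h - G u_h, v> - <B(p - p_h), v>.
    The map A |-> |A|^(r-2) A satisfies
      | |A|^(r-2) A - |B|^(r-2) B |^r' <= C |F(A) - F(B)|^2,
    so by Hoelder's inequality the bracket with A and G is at most
    C E(u, u_h)^(1/r') |v|. If v is in V_(b,h), both multiplier terms vanish (apply the
    sign condition on lambda to v.n and -v.n), and the first inf-sup condition bounds
    q_h - p_h; for general v in V_h, the second one bounds mu_h - lambda_h.

    This last step needs |v.n|_Sigma <= C |v|. The trace operator is only known to be
    bounded into L^r, and the Slobodeckij norm is only known to be finite on Sigma, so
    the estimate comes from the uniform boundedness principle on the complete space V,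
    applied to the Slobodeckij seminorms with truncated kernels. *)
Require Import Defs.
From HB Require Import structures.
From mathcomp Require Import all_boot all_order all_algebra.
From mathcomp Require Import all_classical all_reals all_analysis.
From mathcomp Require Import measurable_realfun ess_sup_inf.
From mathcomp Require Import ring lra.
Set Implicit Arguments.
Unset Strict Implicit.
Unset Printing Implicit Defensive.
Import Order.TTheory GRing.Theory Num.Theory.
Import numFieldNormedType.Exports.
Local Open Scope classical_set_scope.
Local Open Scope ring_scope.

(** * Lebesgue norms on a set *)

(** The constant is independent of the solutions because the stress inequality is global: for r <= 2
    the stress is Hoelder continuous of exponent 2/r' as a function of F(A), so no bound on D u or D
    u_h enters, and the exponent 1/r' appears on integrating in L^r'. Fields and traces are
    representatives, so V is only a seminormed space and the trace is additive only almost
    everywhere. Completeness of V combines Riesz-Fischer for the field and its gradient with the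
    closedness of two constraints, integration by parts and v.n = 0 on Gamma_d, each being the
    vanishing of a bounded linear quantity. Truncating 1/|x - y| at height j bounds the j-th
    seminorm by the L^r norm of the trace, with a constant that grows with j. Finiteness of the full
    norm on Sigma gives pointwise boundedness, and Fatou's lemma removes the truncation afterwards.
    Norms may take the value +oo while the estimates run on real numbers, so an infinite E or an
    infinite distance from lambda to mu_h is set aside first: the right-hand side is then +oo. *)

Section LnormOn.
Context d (T : measurableType d) (R : realType).
Variables (mu : {measure set T -> \bar R}) (D : set T).
Hypothesis mD : measurable D.
Implicit Types (f g : T -> R) (p q : R).

Local Notation "''L_' p [ f ]" := ('N[mu]_(p%:E)[EFin \o (f%R \_ D)])%E
  (at level 5, p at level 2, format "''L_' p [ f ]").

Lemma restrictT_measurable f : measurable_fun D f -> measurable_fun setT (f \_ D).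
Proof. by move=> mf; apply/(measurable_restrictT f mD). Qed.

Lemma poweR_LnormE f p : p != 0 ->
  ('L_p[f] `^ p = \int[mu]_(x in D) (`|f x| `^ p)%:E)%E.
Proof.
move=> p0; rewrite (poweR_Lnorm _ _ p0) [RHS]integral_mkcond.
apply: eq_integral => x _ /=; rewrite !patchE; case: ifPn => _ //=.
by rewrite normr0 powR0.
Qed.

Lemma LnormE f p : p != 0 ->
  ('L_p[f] = (\int[mu]_(x in D) (`|f x| `^ p)%:E) `^ p^-1)%E.
Proof.
by move=> p0; rewrite -poweR_LnormE// -poweRrM mulfV// poweRe1// Lnorm_ge0.
Qed.

Lemma measurable_powR_norm f p : measurable_fun D f ->
  measurable_fun D (fun x => (`|f x| `^ p)%:E).
Proof.
move=> mf; apply/measurable_EFinP.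
by apply: (measurableT_comp (measurable_powR p)); exact: measurableT_comp.
Qed.

Lemma le_Lnorm f g p : 0 < p -> measurable_fun D f -> measurable_fun D g ->
  (\forall x \ae mu, D x -> `|f x| <= `|g x|) -> ('L_p[f] <= 'L_p[g])%E.
Proof.
move=> p0 mf mg fg; have pn0 : p != 0 by rewrite gt_eqF.
rewrite !(LnormE _ pn0); apply: gt0_ler_poweR; first by rewrite invr_ge0 ltW.
- by rewrite in_itv/= leey andbT integral_ge0// => x _; rewrite lee_fin powR_ge0.
- by rewrite in_itv/= leey andbT integral_ge0// => x _; rewrite lee_fin powR_ge0.
apply: ae_ge0_le_integral => //; try exact: measurable_powR_norm.
apply: filterS fg => x fg Dx; rewrite lee_fin ge0_ler_powR ?nnegrE ?(ltW p0)//.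
exact: fg.
Qed.

Lemma eq_Lnorm_ae f g p : 0 < p -> measurable_fun D f -> measurable_fun D g ->
  (\forall x \ae mu, D x -> f x = g x) -> ('L_p[f] = 'L_p[g])%E.
Proof.
move=> p0 mf mg fg; apply/eqP; rewrite eq_le !le_Lnorm//;
  by apply: filterS fg => x + Dx => /(_ Dx) ->.
Qed.

Lemma eq_LnormD f g p : (forall x, D x -> `|f x| = `|g x|) -> ('L_p[f] = 'L_p[g])%E.
Proof.
move=> fg; rewrite -Lnorm_abse -[RHS]Lnorm_abse; congr Lnorm.
apply/funext => x /=; rewrite !patchE; case: ifPn => //.
by rewrite inE => /fg ->.
Qed.

Lemma Lnorm_scale f a p : 0 < p -> measurable_fun D f ->
  ('L_p[(fun x => a * f x)%R] = `|a|%:E * 'L_p[f])%E.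
Proof.
move=> p0 mf; have pn0 : p != 0 by rewrite gt_eqF.
rewrite !(LnormE _ pn0).
under eq_integral do rewrite normrM powRM ?normr_ge0// EFinM.
rewrite ge0_integralZl_EFin ?powR_ge0//; last exact: measurable_powR_norm.
rewrite poweRM ?lee_fin ?powR_ge0//; last first.
  by apply: integral_ge0 => x _; rewrite lee_fin powR_ge0.
by rewrite poweR_EFin -powRrM mulfV// powRr1.
Qed.

Lemma Lnorm_add_le f g p : 1 <= p -> measurable_fun D f -> measurable_fun D g ->
  ('L_p[f \+ g] <= 'L_p[f] + 'L_p[g])%E.
Proof.
move=> p1 mf mg; rewrite (_ : (f \+ g) \_ D = (f \_ D) \+ (g \_ D)).
  by apply: minkowski_EFin => //; exact: restrictT_measurable.
by apply/funext => x /=; rewrite !patchE; case: ifPn => //; rewrite addr0.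
Qed.

Lemma Lnorm_eq0_ae f p : 0 < p -> measurable_fun D f -> 'L_p[f] = 0%E ->
  \forall x \ae mu, D x -> f x = 0.
Proof.
move=> p0 mf f0.
have : EFin \o (f \_ D) = \0%E %[ae mu].
  apply: (@Lnorm_eq0_eq0 _ _ _ _ _ p%:E) => //.
  exact/measurable_EFinP/restrictT_measurable.
apply: filterS => x /= /(_ Logic.I) + Dx; rewrite patchE mem_set//.
by case.
Qed.

Lemma ae_Lnorm_eq0 f p : 0 < p ->
  (\forall x \ae mu, D x -> f x = 0) -> measurable_fun D f -> 'L_p[f] = 0%E.
Proof.
move=> p0 f0 mf; rewrite (@eq_Lnorm_ae f (cst 0))//.
rewrite (_ : EFin \o _ = cst 0%E) ?Lnorm0 ?eqe ?gt_eqF//.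
by apply/funext => x /=; rewrite patchE; case: ifP.
Qed.

Lemma Lnorm_fin f p : ('L_p[f] < +oo)%E -> 'L_p[f] \is a fin_num.
Proof. by move=> foo; rewrite ge0_fin_numE// Lnorm_ge0. Qed.

(** Additivity of [Rintegral] requires integrability, so the bound alone would not allow differences
    of the forms A, G and B to be merged into a single integral. *)
Lemma hoelder_integrable f g p q : 0 < p -> 0 < q -> p^-1 + q^-1 = 1 ->
  measurable_fun D f -> measurable_fun D g ->
  ('L_p[f] < +oo)%E -> ('L_q[g] < +oo)%E ->
  mu.-integrable D (fun x => (f x * g x)%:E) /\
  `|\int[mu]_(x in D) (f x * g x)| <= fine 'L_p[f] * fine 'L_q[g].
Proof.
move=> p0 q0 pq mf mg foo goo.
have H : (\int[mu]_(x in D) `|(f x * g x)%:E| <= 'L_p[f] * 'L_q[g])%E.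
  have := hoelder mu (restrictT_measurable mf) (restrictT_measurable mg) p0 q0 pq.
  apply: le_trans; rewrite Lnorm1 integral_mkcond le_eqVlt; apply/orP; left.
  apply/eqP; apply: eq_integral => x _ /=; rewrite !patchE.
  by case: ifPn => //=; rewrite mulr0 normr0.
have I : mu.-integrable D (fun x => (f x * g x)%:E).
  apply/integrableP; split; first exact/measurable_EFinP/measurable_funM.
  by apply: (le_lt_trans H); rewrite lte_mul_pinfty ?Lnorm_ge0 ?Lnorm_fin.
split=> //.
rewrite -lee_fin EFin_normr_Rintegral// EFinM !fineK ?Lnorm_fin//.
apply: le_trans H; apply: le_abse_integral => //.
exact/measurable_EFinP/measurable_funM.
Qed.

End LnormOn.

Lemma limn_einf_ge (R : realType) (u : (\bar R)^nat) (l : \bar R) :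
  (\forall n \near \oo, (l <= u n)%E) -> (l <= limn_einf u)%E.
Proof.
move=> [N _ lu]; rewrite limn_einf_lim; apply: lime_ge; first exact: is_cvg_einfs.
exists N => // n /= Nn; apply: le_ereal_inf_tmp => _ [m /= nm <-].
by apply: lu; rewrite /= (leq_trans Nn).
Qed.

Lemma limn_einf_le (R : realType) (u : (\bar R)^nat) (l : \bar R) :
  (forall n, (u n <= l)%E) -> (limn_einf u <= l)%E.
Proof.
move=> lu; rewrite limn_einf_lim; apply: lime_le; first exact: is_cvg_einfs.
exists 0%N => // n _ /=; apply: le_trans (lu n); apply: ereal_inf_lbound.
by exists n => /=.
Qed.

Lemma measurable_fun_limn_einf d (T : measurableType d) (R : realType) (D : set T)
    (f : (T -> \bar R)^nat) : (forall n, measurable_fun D (f n)) ->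
  measurable_fun D (fun x => limn_einf (f ^~ x)).
Proof.
move=> mf; apply: measurableT_comp => //.
by apply: measurable_fun_limn_esup => n; exact: measurableT_comp.
Qed.

(** * Fatou's lemma and completeness for Lebesgue norms *)

Section LnormComplete.
Context d (T : measurableType d) (R : realType).
Variables (mu : {measure set T -> \bar R}) (D : set T).
Hypothesis mD : measurable D.

Local Notation "''L_' p [ f ]" := ('N[mu]_(p%:E)[EFin \o (f%R \_ D)])%E
  (at level 5, p at level 2, format "''L_' p [ f ]").

(** Fatou's lemma for |u_n|^p. It serves twice: to bound the limit in the completeness proof, and to
    remove the truncation of the Slobodeckij kernel. *)
Lemma Lnorm_fatou (u : nat -> T -> R) (v : T -> R) (p M : R) : 0 < p -> 0 <= M ->
  (forall n, measurable_fun D (u n)) -> measurable_fun D v ->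
  (\forall x \ae mu, D x -> u ^~ x @ \oo --> v x) ->
  (forall n, ('L_p[u n] <= M%:E)%E) -> ('L_p[v] <= M%:E)%E.
Proof.
move=> p0 M0 mu_ mv uv uM; have pn0 : p != 0 by rewrite gt_eqF.
have uMp n : (\int[mu]_(x in D) (`|u n x| `^ p)%:E <= (M `^ p)%:E)%E.
  rewrite -(poweR_LnormE _ _ _ pn0) -poweR_EFin; apply: gt0_ler_poweR (uM n).
  - exact: ltW.
  - by rewrite in_itv/= leey Lnorm_ge0.
  - by rewrite in_itv/= leey lee_fin M0.
(* Shrinking v by c < 1 makes |c v| < |u_n| hold for all large n wherever v is nonzero, so |c v|^p
   lies below the lower limit of |u_n|^p. Then c = 1/2 shows that the norm of v is finite, and c = 1
   - e / |v| gives |v| - e <= M. *)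
suff H (c : R) : 0 < c -> c < 1 -> (c%:E * 'L_p[v] <= M%:E)%E.
  have fv : 'L_p[v] \is a fin_num.
    rewrite ge0_fin_numE ?Lnorm_ge0//.
    have h := H 2^-1 ltac:(lra) ltac:(lra).
    rewrite ltNge leye_eq; apply/negP => /eqP voo.
    by move: h; rewrite voo gt0_muley ?lte_fin ?invr_gt0// leye_eq.
  rewrite -(fineK fv) lee_fin; apply/ler_addgt0Pr => e e0.
  have [v0|v0] := leP (fine 'L_p[v]) e.
    by apply: le_trans v0 _; rewrite lerDr.
  have vp : 0 < fine 'L_p[v] by exact: lt_trans v0.
  have := H (1 - e / fine 'L_p[v]).
  rewrite subr_gt0 ltr_pdivrMr// mul1r v0 ltrBlDr ltrDl divr_gt0// => /(_ isT isT).
  rewrite -(fineK fv) -EFinM lee_fin /= mulrBl divfK ?gt_eqF// mul1r.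
  by rewrite lerBlDr.
move=> c0 c1; rewrite -{1}(ger0_norm (ltW c0)) -Lnorm_scale// LnormE//.
have -> : M%:E = ((M `^ p)%:E `^ p^-1)%E.
  by rewrite poweR_EFin -powRrM mulfV// powRr1.
apply: gt0_ler_poweR; first by rewrite invr_ge0 ltW.
- by rewrite in_itv/= leey andbT integral_ge0// => x _; rewrite lee_fin powR_ge0.
- by rewrite in_itv/= leey lee_fin powR_ge0.
apply: (@le_trans _ _
    (\int[mu]_(x in D) limn_einf (fun n => (`|u n x| `^ p)%:E))%E); last first.
  apply: le_trans (limn_einf_le uMp); apply: fatou => //.
    by move=> n; exact: measurable_powR_norm.
apply: ae_ge0_le_integral => //.
- apply: measurable_powR_norm; exact: measurable_funM.
- move=> x _; apply: limn_einf_ge; apply: nearW => n.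
  by rewrite lee_fin powR_ge0.
- by apply: measurable_fun_limn_einf => n; exact: measurable_powR_norm.
apply: filterS uv => x uv Dx; apply: limn_einf_ge.
have [v0|vn0] := eqVneq (v x) 0.
  by apply: nearW => n; rewrite v0 mulr0 normr0 powR0// lee_fin powR_ge0.
have cv : `|c * v x| < `|v x|.
  by rewrite normrM gtr_pMl ?normr_gt0// gtr0_norm.
have : \forall n \near \oo, `|c * v x| < `|u n x|.
  exact: (cvgr_gt _ (cvg_norm (uv Dx))).
apply: filterS => n h.
by rewrite lee_fin ge0_ler_powR ?nnegrE// ?(ltW p0)// ltW.
Qed.

Lemma Lnorm_sum_le (I : Type) (s : seq I) (u : I -> T -> R) (p : R) (a : I -> R) :
  1 <= p -> (forall k, measurable_fun D (u k)) ->
  (forall k, ('L_p[u k] <= (a k)%:E)%E) ->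
  ('L_p[fun x => (\sum_(k <- s) u k x)%R] <= (\sum_(k <- s) a k)%:E)%E.
Proof.
move=> p1 mu_ ua.
have ms t : measurable_fun D (fun x => \sum_(k <- t) u k x) by exact: measurable_sum.
elim: s => [|i s IHs].
  rewrite big_nil ae_Lnorm_eq0// ?(lt_le_trans ltr01)//.
  by apply: nearW => x _; rewrite big_nil.
rewrite [in leRHS]big_cons EFinD.
rewrite (_ : (fun x => \sum_(k <- i :: s) u k x) =
    u i \+ (fun x => \sum_(k <- s) u k x)); last first.
  by apply/funext => x; rewrite big_cons.
apply: le_trans (Lnorm_add_le mu mD p1 (mu_ i) (ms s)) _.
exact: leeD.
Qed.

Lemma sum_half_le k n : \sum_(i < n) (2^-1 : R) ^+ (k + i) <= 2 * 2^-1 ^+ k.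
Proof.
suff -> : \sum_(i < n) (2^-1 : R) ^+ (k + i) = 2 * 2^-1 ^+ k - 2 * 2^-1 ^+ (k + n).
  by rewrite gerBl mulr_ge0// exprn_ge0// invr_ge0.
elim: n => [|n IHn]; first by rewrite big_ord0 addn0 subrr.
by rewrite big_ord_recr/= IHn addnS exprS; field.
Qed.

(** Riesz-Fischer along a sequence with geometric increments: the partial sums [h] of the absolute
    increments have norm at most 2, so by Fatou's lemma the lower limit of |h|^p is integrable,
    hence finite almost everywhere, and there the sequence converges absolutely. *)
Lemma Lnorm_complete (f : nat -> T -> R) (p : R) : 1 <= p ->
  (forall k, measurable_fun D (f k)) -> ('L_p[f 0%N] < +oo)%E ->
  (forall k, ('L_p[f k.+1 \- f k] <= (2^-1 ^+ k)%:E)%E) ->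
  exists g, [/\ measurable_fun D g, ('L_p[g] < +oo)%E &
    forall k, ('L_p[g \- f k] <= (2 * 2^-1 ^+ k)%:E)%E].
Proof.
move=> p1 mf f0 df; have p0 : 0 < p by exact: lt_le_trans ltr01 p1.
have pn0 : p != 0 by rewrite gt_eqF.
pose h n x : R := \sum_(i < n) `|f i.+1 x - f i x|.
have mdf i : measurable_fun D (fun x => `|f i.+1 x - f i x|).
  by apply: measurableT_comp => //; exact: measurable_funB.
have mh n : measurable_fun D (h n) by exact: measurable_sum.
have h0 n x : 0 <= h n x by exact: sumr_ge0.
have hM n : ('L_p[h n] <= 2%:E)%E.
  apply: (@le_trans _ _ (\sum_(i < n) 2^-1 ^+ i)%:E).
    apply: (@Lnorm_sum_le 'I_n _ (fun (i : 'I_n) x => `|f i.+1 x - f i x|)) => // k.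
    apply: le_trans (df k); apply: le_Lnorm => //; first exact: measurable_funB.
    by apply: nearW => x _; rewrite normr_id.
  by rewrite lee_fin; have := sum_half_le 0 n; rewrite expr0 mulr1.
have hM' n : (\int[mu]_(x in D) (`|h n x| `^ p)%:E <= (2 `^ p)%:E)%E.
  rewrite -(poweR_LnormE _ _ _ pn0) -poweR_EFin; apply: gt0_ler_poweR (hM n).
  - exact: ltW.
  - by rewrite in_itv/= leey Lnorm_ge0.
  - by rewrite in_itv/= leey andbT (lee_fin 0 2).
pose Phi x := limn_einf (fun n => (`|h n x| `^ p)%:E).
have mPhi : measurable_fun D Phi.
  by apply: measurable_fun_limn_einf => n; exact: measurable_powR_norm.
have Phi0 x : (0 <= Phi x)%E.
  by apply: limn_einf_ge; apply: nearW => n; rewrite lee_fin powR_ge0.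
have iPhi : mu.-integrable D Phi.
  apply/integrableP; split => //.
  under eq_integral do rewrite gee0_abs//.
  apply: (@le_lt_trans _ _ (2 `^ p)%:E); last by rewrite ltry.
  apply: le_trans (limn_einf_le hM'); apply: fatou => //.
    by move=> n; exact: measurable_powR_norm.
have cvf : \forall x \ae mu, D x -> cvgn (f ^~ x).
  have := integrable_ae mD iPhi; apply: filterS => x + Dx => /(_ Dx) Px.
  have ndh : nondecreasing_seq (h ^~ x).
    by apply/nondecreasing_seqP => n; rewrite /h big_ord_recr lerDl.
  suff : cvgn (series (fun i => f i.+1 x - f i x)).
    move=> cs; rewrite (_ : f ^~ x = (fun n => f 0%N x + series (fun i => f i.+1 x - f i x) n)).
      by apply: is_cvgD => //; exact: is_cvg_cst.
    by apply/funext => n; rewrite /series/= telescope_sumr// addrC subrK.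
  apply: normed_cvg; apply: nondecreasing_is_cvgn.
    by apply/nondecreasing_seqP => n; rewrite /= [leRHS]big_nat_recr//= lerDl.
  (* As h is nondecreasing in n, one value above l^(1/p) would keep |h|^p above l = [Phi x] + 1 from
     there on, and the lower limit could not be [Phi x]. *)
  pose l := fine (Phi x) + 1; exists (l `^ p^-1) => _ [n _ <-] /=.
  have -> : series (fun i => `|f i.+1 x - f i x|) n = h n x.
    by rewrite /series/= big_mkord.
  rewrite leNgt; apply/negP => ln.
  have l0 : 0 <= l by rewrite addr_ge0// fine_ge0.
  have : (l%:E <= Phi x)%E.
    apply: limn_einf_ge; exists n => // m /= nm; rewrite lee_fin ger0_norm//.
    rewrite -[l](powRr1 l0) -(mulVf pn0) powRrM ge0_ler_powR ?nnegrE ?powR_ge0//.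
      exact: ltW.
    by apply/ltW/(lt_le_trans ln)/ndh.
  by rewrite -(fineK Px) lee_fin /l gerDl ler10.
(* The upper limit is measurable on all of D, whether or not the sequence converges at a given
   point, and it agrees with the limit almost everywhere. *)
pose g x := fine (limn_esup (fun n => (f n x)%:E)).
have mg : measurable_fun D g.
  apply: (measurableT_comp (f := fine)) => //.
  by apply: measurable_fun_limn_esup => n; exact/measurable_EFinP.
have fg : \forall x \ae mu, D x -> f ^~ x @ \oo --> g x.
  apply: filterS cvf => x + Dx => /(_ Dx) cx; rewrite /g.
  rewrite (_ : limn_esup _ = (limn (f ^~ x))%:E)//.
  have : (fun n => (f n x)%:E) @ \oo --> (limn (f ^~ x))%:E by apply: cvg_EFin => //; exact: nearW.
  by move/cvg_limn_einf_sup => [].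
have gk k : ('L_p[g \- f k] <= (2 * 2^-1 ^+ k)%:E)%E.
  apply: (@Lnorm_fatou (fun n x => f (k + n)%N x - f k x)) => //.
  - by move=> n; exact: measurable_funB.
  - exact: measurable_funB.
  - apply: filterS fg => x + Dx => /(_ Dx) cx; apply: cvgB; last exact: cvg_cst.
    by apply: cvg_comp cx; exact: cvg_addnl.
  move=> n; rewrite (_ : (fun x => f (k + n)%N x - f k x) =
      (fun x => \sum_(i < n) (f (k + i).+1 x - f (k + i)%N x))); last first.
    apply/funext => x; rewrite -(big_mkord xpredT (fun i => f (k + i).+1 x - f (k + i)%N x)).
    under eq_bigr do rewrite -addnS.
    by rewrite (telescope_sumr (fun i => f (k + i)%N x))// addn0.
  apply: (@le_trans _ _ (\sum_(i < n) 2^-1 ^+ (k + i))%:E).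
    apply: (@Lnorm_sum_le 'I_n _ (fun (i : 'I_n) x => f (k + i).+1 x - f (k + i)%N x) p
      (fun i => 2^-1 ^+ (k + i))) => // i.
      exact: measurable_funB.
    exact: df.
  by rewrite lee_fin sum_half_le.
exists g; split => //.
rewrite (_ : g = (g \- f 0%N) \+ f 0%N); last by apply/funext => x /=; rewrite subrK.
apply: le_lt_trans (Lnorm_add_le mu mD p1 _ _) _ => //; first exact: measurable_funB.
by rewrite lte_add_pinfty// (le_lt_trans (gk 0%N))// ltry.
Qed.

End LnormComplete.

(** * The nonlinear stress *)

Section MatrixNorm.
Context {R : realType}.
Context {m n : nat}.
Implicit Types (A B C : 'M[R]_(m, n)) (a : R).

Lemma mxdotC A B : mxdot A B = mxdot B A.
Proof. by apply: eq_bigr => i _; apply: eq_bigr => j _; rewrite mulrC. Qed.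

Lemma mxdotDl A B C : mxdot (A + B) C = mxdot A C + mxdot B C.
Proof.
rewrite /mxdot -big_split; apply: eq_bigr => i _.
by rewrite -big_split; apply: eq_bigr => j _; rewrite mxE mulrDl.
Qed.

Lemma mxdotZl a A B : mxdot (a *: A) B = a * mxdot A B.
Proof.
rewrite /mxdot mulr_sumr; apply: eq_bigr => i _.
by rewrite mulr_sumr; apply: eq_bigr => j _; rewrite mxE mulrA.
Qed.

Lemma mxdotNl A B : mxdot (- A) B = - mxdot A B.
Proof. by rewrite -scaleN1r mxdotZl mulN1r. Qed.

Lemma mxdotBl A B C : mxdot (A - B) C = mxdot A C - mxdot B C.
Proof. by rewrite mxdotDl mxdotNl. Qed.

Lemma mxdotDr A B C : mxdot C (A + B) = mxdot C A + mxdot C B.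
Proof. by rewrite mxdotC mxdotDl !(mxdotC C). Qed.

Lemma mxdotZr a A B : mxdot A (a *: B) = a * mxdot A B.
Proof. by rewrite mxdotC mxdotZl mxdotC. Qed.

Lemma mxdotBr A B C : mxdot C (A - B) = mxdot C A - mxdot C B.
Proof. by rewrite mxdotC mxdotBl !(mxdotC C). Qed.

Lemma mxdot_ge0 A : 0 <= mxdot A A.
Proof. by apply: sumr_ge0 => i _; apply: sumr_ge0 => j _; rewrite -expr2 sqr_ge0. Qed.

Lemma mxnorm_ge0 A : 0 <= mxnorm A.
Proof. exact: sqrtr_ge0. Qed.

Lemma sqr_mxnorm A : mxnorm A ^+ 2 = mxdot A A.
Proof. by rewrite sqr_sqrtr// mxdot_ge0. Qed.

Lemma mxnorm0 : mxnorm (0 : 'M[R]_(m, n)) = 0.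
Proof.
rewrite /mxnorm /mxdot big1 ?sqrtr0// => i _.
by rewrite big1// => j _; rewrite mxE mul0r.
Qed.

Lemma mxnormZ a A : mxnorm (a *: A) = `|a| * mxnorm A.
Proof.
rewrite /mxnorm mxdotZl mxdotC mxdotZl mulrA -expr2 sqrtrM ?sqr_ge0//.
by rewrite sqrtr_sqr.
Qed.

Lemma mxnormN A : mxnorm (- A) = mxnorm A.
Proof. by rewrite -scaleN1r mxnormZ normrN normr1 mul1r. Qed.

Lemma mxnormB_sym A B : mxnorm (A - B) = mxnorm (B - A).
Proof. by rewrite -mxnormN opprB. Qed.

Lemma normr_entry_le A i j : `|A i j| <= mxnorm A.
Proof.
rewrite -sqrtr_sqr ler_wsqrtr// /mxdot (bigD1 i)//= (bigD1 j)//= -expr2 -addrA.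
rewrite lerDl addr_ge0//.
  by apply: sumr_ge0 => k _; rewrite -expr2 sqr_ge0.
by apply: sumr_ge0 => k _; apply: sumr_ge0 => l _; rewrite -expr2 sqr_ge0.
Qed.

Lemma mxnorm_eq0 A : mxnorm A = 0 -> A = 0.
Proof.
move=> A0; apply/matrixP => i j; rewrite mxE; apply/eqP.
by rewrite -normr_le0 -A0 normr_entry_le.
Qed.

Lemma cauchy_schwarz A B : `|mxdot A B| <= mxnorm A * mxnorm B.
Proof.
have [A0|A0] := eqVneq (mxnorm A) 0.
  by rewrite A0 mul0r (mxnorm_eq0 A0) -(scale0r 0) mxdotZl mul0r normr0.
have [B0|B0] := eqVneq (mxnorm B) 0.
  by rewrite B0 mulr0 (mxnorm_eq0 B0) mxdotC -(scale0r 0) mxdotZl mul0r normr0.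
have AB : 0 < mxnorm A * mxnorm B.
  by rewrite mulr_gt0// lt_neqAle eq_sym ?A0 ?B0 mxnorm_ge0.
(* The sign s replaces the absolute value; the bound follows on expanding the squared norm of |B| A
   - s |A| B and comparing with |A| |B|. *)
suff H (s : R) : `|s| = 1 -> s * mxdot A B <= mxnorm A * mxnorm B.
  have := H 1 (normr1 _); have := H (-1) (normrN1 _).
  by rewrite mul1r mulN1r ler_norml; lra.
move=> s1; have := mxdot_ge0 (mxnorm B *: A - (s * mxnorm A) *: B).
rewrite mxdotBl !mxdotBr !mxdotZl !mxdotZr (mxdotC B A) -!sqr_mxnorm => H.
have s2 : s ^+ 2 = 1 by rewrite -real_normK ?num_real// s1 expr1n.
rewrite -(ler_pM2l AB) -subr_ge0; move: H.
set a := mxnorm A; set b := mxnorm B; set c := mxdot A B.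
rewrite (_ : b * (b * a ^+ 2) - b * (s * a * c) -
    (s * a * (b * c) - s * a * (s * a * b ^+ 2)) =
  (1 + s ^+ 2) * (a * b) ^+ 2 - 2 * (a * b * (s * c))); last by ring.
rewrite s2; nra.
Qed.

Lemma mxnormD A B : mxnorm (A + B) <= mxnorm A + mxnorm B.
Proof.
rewrite -(@ler_pXn2r _ 2)// ?nnegrE ?addr_ge0 ?mxnorm_ge0//.
rewrite sqrrD !sqr_mxnorm mxdotDl !mxdotDr (mxdotC B A).
have := le_trans (ler_norm _) (cauchy_schwarz A B); lra.
Qed.

Lemma mxnormB A B : mxnorm (A - B) <= mxnorm A + mxnorm B.
Proof. by rewrite -(mxnormN B) mxnormD. Qed.

Lemma ler_dist_mxnorm A B : `|mxnorm A - mxnorm B| <= mxnorm (A - B).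
Proof.
rewrite ler_norml; have := mxnormD (A - B) B; have := mxnormD (B - A) A.
rewrite !subrK (mxnormB_sym B A); lra.
Qed.

Lemma mxnorm_le_sum A : mxnorm A <= \sum_i \sum_j `|A i j|.
Proof.
have s0 : 0 <= \sum_i \sum_j `|A i j|.
  by apply: sumr_ge0 => i _; apply: sumr_ge0.
rewrite -(@ler_pXn2r _ 2)// ?nnegrE ?mxnorm_ge0// sqr_mxnorm /mxdot.
rewrite !pair_big/= expr2 mulr_suml; apply: ler_sum => -[i j] _ /=.
rewrite -expr2 -real_normK ?num_real// expr2 ler_wpM2l//.
by rewrite (bigD1 (i, j))//= lerDl sumr_ge0.
Qed.

End MatrixNorm.

Section PowerMap.
Context {R : realType} {m n : nat}.
Implicit Types (A B : 'M[R]_(m, n)).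

(* For |B| <= |A|, split |A|^(t-1) A - |B|^(t-1) B as
   |A|^(t-1) (A - B) + (|A|^(t-1) - |B|^(t-1)) B; both terms are at most
   |A|^(t-1) |A - B|, and |A - B| <= 2 |A|. *)
Lemma powR_map_hoelder (t : R) A B : 0 < t -> t <= 1 ->
  mxnorm (mxnorm A `^ (t - 1) *: A - mxnorm B `^ (t - 1) *: B) <=
  4 * mxnorm (A - B) `^ t.
Proof.
move=> t0 t1; wlog BA : A B / mxnorm B <= mxnorm A.
  move=> H; have [BA|/ltW AB] := leP (mxnorm B) (mxnorm A); first exact: H.
  by rewrite (mxnormB_sym A B) [leLHS]mxnormB_sym; exact: H.
have [A0|An0] := eqVneq (mxnorm A) 0.
  have B0 : B = 0 by apply: mxnorm_eq0; apply/eqP; rewrite eq_le mxnorm_ge0 -A0 BA.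
  by rewrite B0 (mxnorm_eq0 A0) !scaler0 subr0 mxnorm0 mulr_ge0// powR_ge0.
have Ap : 0 < mxnorm A by rewrite lt_neqAle eq_sym An0 mxnorm_ge0.
have powS x : 0 < x -> x `^ (t - 1) * x = x `^ t.
  move=> x0; rewrite -{2}[x]powRr1 ?ltW// -powRD ?subrK//.
  by rewrite gt_eqF ?implybT.
have P0 : 0 <= mxnorm A `^ (t - 1) by exact: powR_ge0.
have main : mxnorm A `^ (t - 1) * mxnorm (A - B) <= 2 * mxnorm (A - B) `^ t.
  have [d0|dn0] := eqVneq (mxnorm (A - B)) 0.
    by rewrite d0 mulr0 mulr_ge0// powR_ge0.
  have dp : 0 < mxnorm (A - B) by rewrite lt_neqAle eq_sym dn0 mxnorm_ge0.
  rewrite -(powS _ dp) mulrA ler_wpM2r ?mxnorm_ge0//.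
  have d2 : mxnorm (A - B) <= 2 * mxnorm A by have := mxnormB A B; lra.
  have : mxnorm (A - B) `^ (1 - t) <= (2 * mxnorm A) `^ (1 - t).
    by rewrite ge0_ler_powR ?nnegrE ?subr_ge0// ?mulr_ge0 ?mxnorm_ge0.
  rewrite powRM ?mxnorm_ge0// => H.
  have two : (2:R) `^ (1 - t) <= 2.
    rewrite -[leRHS](@powRr1 R) ?ler0n//; apply: ler_powR; first lra.
    by rewrite gerBl ltW.
  have e x : 0 < x -> x `^ (t - 1) = (x `^ (1 - t))^-1.
    by move=> x0; rewrite -powRN opprB.
  rewrite (e _ Ap) (e _ dp).
  have qp : 0 < mxnorm (A - B) `^ (1 - t) by rewrite powR_gt0.
  have rp : 0 < mxnorm A `^ (1 - t) by rewrite powR_gt0.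
  rewrite ler_pdivlMr// mulrC ler_pdivrMr// (le_trans H)// ler_wpM2r//.
  exact: ltW.
rewrite (_ : _ - _ = mxnorm A `^ (t - 1) *: (A - B) -
    (mxnorm B `^ (t - 1) - mxnorm A `^ (t - 1)) *: B); last first.
  by rewrite scalerBr scalerBl opprB addrA subrK.
apply: le_trans (mxnormB _ _) _; rewrite !mxnormZ (ger0_norm P0).
(* As t - 1 <= 0, |B|^(t-1) >= |A|^(t-1), so the left side is |B|^t - |A|^(t-1) |B|, which is at
   most |A|^t - |A|^(t-1) |B| = |A|^(t-1) (|A| - |B|). *)
suff : `|mxnorm B `^ (t - 1) - mxnorm A `^ (t - 1)| * mxnorm B <=
    mxnorm A `^ (t - 1) * mxnorm (A - B).
  by move: main; set x := _ * mxnorm (A - B); set y := _ * mxnorm B; lra.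
have [B0|Bn0] := eqVneq (mxnorm B) 0.
  by rewrite B0 mulr0 mulr_ge0// mxnorm_ge0.
have Bp : 0 < mxnorm B by rewrite lt_neqAle eq_sym Bn0 mxnorm_ge0.
have BAt : mxnorm B `^ t <= mxnorm A `^ t.
  by rewrite ge0_ler_powR ?nnegrE ?mxnorm_ge0// ltW.
have AB1 : mxnorm A `^ (t - 1) <= mxnorm B `^ (t - 1).
  rewrite -[t - 1]opprB !powRN lef_pV2 ?posrE ?powR_gt0//.
  by rewrite ge0_ler_powR ?nnegrE ?mxnorm_ge0// subr_ge0.
rewrite ger0_norm ?subr_ge0// mulrBl powS//.
apply: (@le_trans _ _ (mxnorm A `^ t - mxnorm A `^ (t - 1) * mxnorm B)).
  by rewrite lerB.
rewrite -(powS _ Ap) -mulrBr ler_wpM2l//.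
by apply: le_trans (ler_norm _) (ler_dist_mxnorm _ _).
Qed.

End PowerMap.

(** * Differences of stresses, pointwise and integrated *)

Section FluxDifference.
Context {R : realType}.

Lemma sqrt_measurable : measurable_fun setT (@Num.sqrt R).
Proof. exact: continuous_measurable_fun (@sqrt_continuous R). Qed.

Lemma poweR2_sqr (x : \bar R) : (0 <= x -> x `^ 2 = x ^+ 2)%E.
Proof.
case: x => [x|_|//]; last by rewrite poweRyr// expe2.
by rewrite lee_fin => x0; rewrite poweR_EFin powR_mulrn.
Qed.

Section StressMaps.
Context {m n : nat}.
Variable r : R.
Hypotheses (r1 : 1 < r) (r2 : r <= 2).
Implicit Types (A B : 'M[R]_(m, n)).

Lemma conj_exp_gt0 : 0 < conj_exp r.
Proof. by rewrite divr_gt0 ?subr_gt0// (lt_trans ltr01). Qed.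

Lemma conj_exp_sum : r^-1 + (conj_exp r)^-1 = 1.
Proof.
rewrite /conj_exp invf_div; have : r != 0 by rewrite gt_eqF// (lt_trans ltr01).
by move=> rn0; field.
Qed.

Lemma conj_exp_ge1 : 1 <= conj_exp r.
Proof. by rewrite ler_pdivlMr ?subr_gt0// mul1r gerBl. Qed.

(* With a = F(A), |A|^(r-2) A = |a|^(t-1) a for t = 2/r'. *)
Lemma stress_hoelder A B :
  mxnorm (mxnorm A `^ (r - 2) *: A - mxnorm B `^ (r - 2) *: B) <=
  4 * mxnorm (Fr r A - Fr r B) `^ (2 / conj_exp r).
Proof.
have rp : 0 < r by exact: lt_trans ltr01 r1.
(* Exponents: |F(C)| = |C|^(r/2), and (r/2) (2/r' - 1) + (r - 2)/2 = r - 2. *)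
have key (C : 'M[R]_(m, n)) : mxnorm C `^ (r - 2) *: C =
    mxnorm (Fr r C) `^ (2 / conj_exp r - 1) *: Fr r C.
  have [C0|Cn0] := eqVneq (mxnorm C) 0.
    by rewrite /Fr (mxnorm_eq0 C0) !scaler0.
  rewrite /Fr scalerA mxnormZ (ger0_norm (powR_ge0 _ _)); congr (_ *: _).
  have Cp : 0 < mxnorm C by rewrite lt_neqAle eq_sym Cn0 mxnorm_ge0.
  have D x y : mxnorm C `^ (x + y) = mxnorm C `^ x * mxnorm C `^ y.
    by rewrite powRD// Cn0 implybT.
  have D1 x : mxnorm C `^ x * mxnorm C = mxnorm C `^ (x + 1).
    by rewrite D powRr1// ltW.
  rewrite D1 -powRrM -D; congr (_ `^ _).
  by rewrite /conj_exp invf_div; field; rewrite gt_eqF.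
rewrite !key; apply: powR_map_hoelder.
  by rewrite divr_gt0// conj_exp_gt0.
(* The exponent 2/r' is at most 1 exactly when r <= 2. *)
rewrite ler_pdivrMr ?conj_exp_gt0// mul1r /conj_exp ler_pdivlMr ?subr_gt0//.
by have := r2; lra.
Qed.

Lemma mxnorm_stress A : mxnorm (mxnorm A `^ (r - 2) *: A) = mxnorm A `^ (r - 1).
Proof.
rewrite mxnormZ (ger0_norm (powR_ge0 _ _)).
have [->|An0] := eqVneq (mxnorm A) 0.
  by rewrite mulr0 powR0// subr_eq0 gt_eqF.
have -> : r - 1 = r - 2 + 1 by ring.
rewrite [RHS]powRD; last by rewrite An0 implybT.
by rewrite powRr1// mxnorm_ge0.
Qed.

End StressMaps.

Section Integrals.
Context d (T : measurableType d).
Variables (mu : {measure set T -> \bar R}) (D : set T).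
Hypothesis mD : measurable D.

Local Notation "''L_' p [ f ]" := ('N[mu]_(p%:E)[EFin \o (f%R \_ D)])%E
  (at level 5, p at level 2, format "''L_' p [ f ]").

Definition measurable_mx {m n} (A : T -> 'M[R]_(m, n)) : Prop :=
  forall i j, measurable_fun D (fun x => A x i j).

Lemma measurable_mxdot {m n} (A B : T -> 'M[R]_(m, n)) :
  measurable_mx A -> measurable_mx B -> measurable_fun D (fun x => mxdot (A x) (B x)).
Proof.
move=> mA mB; apply: measurable_sum => i; apply: measurable_sum => j.
exact: measurable_funM.
Qed.

Lemma measurable_mxnorm {m n} (A : T -> 'M[R]_(m, n)) :
  measurable_mx A -> measurable_fun D (fun x => mxnorm (A x)).
Proof. by move=> mA; apply: (measurableT_comp sqrt_measurable); exact: measurable_mxdot. Qed.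

Lemma measurable_mxD {m n} (A B : T -> 'M[R]_(m, n)) :
  measurable_mx A -> measurable_mx B -> measurable_mx (fun x => A x + B x).
Proof.
by move=> mA mB i j; under eq_fun do rewrite mxE; exact: measurable_funD.
Qed.

Lemma measurable_mxN {m n} (A : T -> 'M[R]_(m, n)) :
  measurable_mx A -> measurable_mx (fun x => - A x).
Proof.
by move=> mA i j; under eq_fun do rewrite mxE; exact: measurableT_comp.
Qed.

Lemma measurable_mxZ {m n} (f : T -> R) (A : T -> 'M[R]_(m, n)) :
  measurable_fun D f -> measurable_mx A -> measurable_mx (fun x => f x *: A x).
Proof.
by move=> mf mA i j; under eq_fun do rewrite mxE; exact: measurable_funM.
Qed.

Lemma measurable_powR_fun (f : T -> R) (p : R) : measurable_fun D f ->
  measurable_fun D (fun x => f x `^ p).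
Proof. by move=> mf; apply: (measurableT_comp (measurable_powR p)). Qed.

Lemma measurable_mx_stress {m n} (s : R) (A : T -> 'M[R]_(m, n)) :
  measurable_mx A -> measurable_mx (fun x => mxnorm (A x) `^ s *: A x).
Proof.
move=> mA; apply: measurable_mxZ => //.
exact/measurable_powR_fun/measurable_mxnorm.
Qed.

(** Applied with q = r' throughout: s = r - 1 and p = r put the stress in L^r', while s = 2/r' and p
    = 2 turn the pointwise Hoelder estimate into the power 1/r' of a squared L^2 norm. *)
Lemma Lnorm_powR (f : T -> R) (p q s : R) : 0 < p -> 0 < q -> s * q = p ->
  (forall x, 0 <= f x) ->
  'L_q[fun x => (f x `^ s)%R] = ('L_p[f] `^ (p / q))%E.
Proof.
move=> p0 q0 sqp f0; have pn0 : p != 0 by rewrite gt_eqF.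
have qn0 : q != 0 by rewrite gt_eqF.
rewrite [LHS](LnormE _ _ _ qn0) poweRrM (poweR_LnormE _ _ _ pn0).
apply: (congr1 (poweR ^~ q^-1)); apply: eq_integral => x _.
by rewrite ger0_norm ?powR_ge0// -powRrM sqp ger0_norm.
Qed.

Variables (r M : R) (w : T -> R).
Hypotheses (r1 : 1 < r) (r2 : r <= 2) (M0 : 0 <= M).
Hypotheses (mw : measurable_fun D w) (wM : \forall x \ae mu, D x -> `|w x| <= M).

(** Since (r - 1) r' = r, a stress of size |A|^(r-1) lies in L^r' when A lies in L^r, and it pairs
    with Y by Hoelder's inequality. *)
Lemma stress_integrable {m n} (A Y : T -> 'M[R]_(m, n)) :
  measurable_mx A -> measurable_mx Y ->
  ('L_r[fun x => mxnorm (A x)] < +oo)%E -> ('L_r[fun x => mxnorm (Y x)] < +oo)%E ->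
  mu.-integrable D
    (fun x => (w x * mxnorm (A x) `^ (r - 2) * mxdot (A x) (Y x))%:E).
Proof.
move=> mA mY Ar Yr; have r0 : 0 < r by exact: lt_trans ltr01 r1.
have q0 := conj_exp_gt0 r1; have mNA := measurable_mxnorm mA.
have mf : measurable_fun D (fun x => w x * mxnorm (A x) `^ (r - 1)).
  by apply: measurable_funM => //; exact: measurable_powR_fun.
have [] := @hoelder_integrable _ _ _ mu D mD
  (fun x => w x * mxnorm (A x) `^ (r - 1)) (fun x => mxnorm (Y x)) (conj_exp r) r => //.
- by rewrite addrC conj_exp_sum.
- exact: measurable_mxnorm.
- apply: (@le_lt_trans _ _ 'L_(conj_exp r)[fun x => (M * mxnorm (A x) `^ (r - 1))%R]).
    apply: le_Lnorm => //.
      by apply: measurable_funM => //; exact: measurable_powR_fun.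
    apply: filterS wM => x wMx Dx; rewrite !normrM ler_wpM2r// (ger0_norm M0).
    exact: wMx.
  rewrite (Lnorm_scale mu mD _ q0); last exact: measurable_powR_fun.
  rewrite lte_mul_pinfty//.
  rewrite (@Lnorm_powR _ r)// ?poweR_lty//.
    by rewrite /conj_exp mulrC divfK// gt_eqF// subr_gt0.
  by move=> x; exact: mxnorm_ge0.
move=> I _; apply: le_integrable I => //.
  apply/measurable_EFinP; apply: measurable_funM; last exact: measurable_mxdot.
  by apply: measurable_funM => //; exact: measurable_powR_fun.
move=> x _ /=; rewrite lee_fin !normrM -!mulrA ler_wpM2l//.
rewrite (ger0_norm (mxnorm_ge0 _)) -(mxnorm_stress r1) mxnormZ.
rewrite (ger0_norm (mulr_ge0 _ (mxnorm_ge0 _)))// -mulrA ler_wpM2l//.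
exact: cauchy_schwarz.
Qed.

(** The weight w stands for alpha on Omega and for the constant tau on Gamma_b, and e for the whole
    of E, of which the squared L^2 norm is one summand; both parts of the flux are thereby bounded
    through the same e. The 4 is that of [stress_hoelder]. *)
Lemma stress_difference_le {m n} (A B Y : T -> 'M[R]_(m, n)) (e : \bar R) :
  measurable_mx A -> measurable_mx B -> measurable_mx Y ->
  ('L_r[fun x => mxnorm (A x)] < +oo)%E ->
  ('L_r[fun x => mxnorm (B x)] < +oo)%E ->
  ('L_r[fun x => mxnorm (Y x)] < +oo)%E ->
  (e < +oo)%E ->
  ('L_2[fun x => mxnorm (Fr r (A x) - Fr r (B x))] ^+ 2 <= e)%E ->
  `|\int[mu]_(x in D) (w x * mxnorm (A x) `^ (r - 2) * mxdot (A x) (Y x)) -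
    \int[mu]_(x in D) (w x * mxnorm (B x) `^ (r - 2) * mxdot (B x) (Y x))| <=
  4 * M * fine (e `^ (conj_exp r)^-1) * fine 'L_r[fun x => mxnorm (Y x)].
Proof.
move=> mA mB mY Ar Br Yr eoo Fe; have r0 : 0 < r by exact: lt_trans ltr01 r1.
have q0 := conj_exp_gt0 r1.
have e0 : (0 <= e)%E by apply: le_trans Fe; rewrite expe_ge0// Lnorm_ge0.
pose S x := mxnorm (A x) `^ (r - 2) *: A x - mxnorm (B x) `^ (r - 2) *: B x.
have mS : measurable_mx S.
  by apply: measurable_mxD; [|apply: measurable_mxN]; exact: measurable_mx_stress.
have mNS := measurable_mxnorm mS; have mNY := measurable_mxnorm mY.
rewrite -RintegralB//; [|exact: stress_integrable|exact: stress_integrable].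
have -> : \int[mu]_(x in D) (w x * mxnorm (A x) `^ (r - 2) * mxdot (A x) (Y x) -
    w x * mxnorm (B x) `^ (r - 2) * mxdot (B x) (Y x)) =
    \int[mu]_(x in D) (w x * mxdot (S x) (Y x)).
  apply: eq_Rintegral => x _.
  by rewrite mxdotBl !mxdotZl mulrBr !mulrA.
have mF : measurable_fun D (fun x => mxnorm (Fr r (A x) - Fr r (B x))).
  apply: measurable_mxnorm; apply: measurable_mxD; [|apply: measurable_mxN];
    exact: measurable_mx_stress.
have FL : ('L_2[fun x => mxnorm (Fr r (A x) - Fr r (B x))] `^ 2 <= e)%E.
  apply: le_trans Fe; by rewrite poweR2_sqr// Lnorm_ge0.
have Lf : ('L_(conj_exp r)[fun x => (w x * mxnorm (S x))%R] <=
    (4 * M)%:E * e `^ (conj_exp r)^-1)%E.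
  apply: (@le_trans _ _ 'L_(conj_exp r)[fun x =>
     (4 * M * mxnorm (Fr r (A x) - Fr r (B x)) `^ (2 / conj_exp r))%R]).
    apply: le_Lnorm => //.
    - exact: (measurable_funM mw mNS).
    - by apply: measurable_funM => //; exact: measurable_powR_fun.
    apply: filterS wM => x wMx Dx; rewrite normrM (ger0_norm (mxnorm_ge0 _)).
    rewrite [leRHS]ger0_norm; last by rewrite !mulr_ge0// powR_ge0.
    rewrite mulrAC mulrC; apply: ler_pM => //; first exact: mxnorm_ge0.
      exact: stress_hoelder.
    exact: wMx.
  rewrite (Lnorm_scale mu mD _ q0); last exact: measurable_powR_fun.
  rewrite ger0_norm ?mulr_ge0//; apply: lee_pmul => //.
  - by rewrite lee_fin mulr_ge0.
  - exact: Lnorm_ge0.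
  rewrite (@Lnorm_powR _ 2)//; last 2 first.
  - by rewrite divfK// gt_eqF.
  - by move=> x; exact: mxnorm_ge0.
  rewrite poweRrM; apply: gt0_ler_poweR FL; first by rewrite invr_ge0 ltW.
  - by rewrite in_itv/= leey poweR_ge0.
  - by rewrite in_itv/= leey e0.
have foo : ('L_(conj_exp r)[fun x => (w x * mxnorm (S x))%R] < +oo)%E.
  by apply: le_lt_trans Lf _; rewrite lte_mul_pinfty ?lee_fin ?mulr_ge0// poweR_lty.
have [I1 I2] := @hoelder_integrable _ _ _ mu D mD (fun x => w x * mxnorm (S x))
  (fun x => mxnorm (Y x)) _ _ q0 r0 (etrans (addrC _ _) (conj_exp_sum r1))
  (measurable_funM mw mNS) mNY foo Yr.
have mh : measurable_fun D (fun x => w x * mxdot (S x) (Y x)).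
  by apply: measurable_funM => //; exact: measurable_mxdot.
have ae : forall x, D x -> `|w x * mxdot (S x) (Y x)| <= `|w x * mxnorm (S x) * mxnorm (Y x)|.
  move=> x _; rewrite !normrM -mulrA ler_wpM2l//.
  by rewrite !(ger0_norm (mxnorm_ge0 _)) cauchy_schwarz.
have Ih : mu.-integrable D (EFin \o (fun x => w x * mxdot (S x) (Y x))).
  apply: le_integrable I1 => //; first exact/measurable_EFinP.
apply: le_trans (le_normr_Rintegral mD Ih) _.
have aI : (\int[mu]_(x in D) (`|w x * mxdot (S x) (Y x)|)%:E <=
    'L_(conj_exp r)[fun x => (w x * mxnorm (S x))%R] * 'L_r[fun x => mxnorm (Y x)])%E.
  have := hoelder mu (restrictT_measurable mD (measurable_funM mw mNS))
    (restrictT_measurable mD mNY) q0 r0 (etrans (addrC _ _) (conj_exp_sum r1)).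
  apply: le_trans; rewrite Lnorm1 integral_mkcond.
  apply: ge0_le_integral => //.
  - by move=> x _; rewrite patchE; case: ifP.
  - apply/(measurable_restrictT _ mD)/measurable_EFinP; exact: measurableT_comp.
  - apply: measurableT_comp => //; apply/measurable_EFinP; apply: measurable_funM;
      apply: restrictT_measurable => //; exact: measurable_funM.
  move=> x _ /=; rewrite !patchE; case: ifPn; last by rewrite mulr0 normr0.
  by rewrite inE lee_fin => /ae.
rewrite -lee_fin /Rintegral fineK; last first.
  rewrite ge0_fin_numE ?integral_ge0//; apply: le_lt_trans aI _.
  by rewrite lte_mul_pinfty ?Lnorm_ge0// Lnorm_fin.
apply: le_trans aI _.
have ef : (e `^ (conj_exp r)^-1)%E \is a fin_num.
  by rewrite ge0_fin_numE ?poweR_ge0// poweR_lty.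
rewrite [leRHS]EFinM (EFinM (4 * M)) (fineK ef) (fineK (Lnorm_fin Yr)).
by rewrite lee_wpmul2r// Lnorm_ge0.
Qed.

End Integrals.
End FluxDifference.

(** * Uniform boundedness *)

Section UniformBoundedness.
Context {R : realType} {X : lmodType R}.
Variables (S : set X) (N : X -> R) (p : nat -> X -> R) (C : nat -> R).

(* Gliding hump: inside any ball some p j exceeds any given bound, and still does
   so on a smaller ball. *)
Lemma uniform_boundedness :
  S 0 -> (forall a x y, S x -> S y -> S (a *: x + y)) ->
  (forall a x, S x -> N (a *: x) = `|a| * N x) ->
  (forall x y, S x -> S y -> N (x + y) <= N x + N y) ->
  (forall j a x, S x -> p j (a *: x) = `|a| * p j x) ->
  (forall j x y, S x -> S y -> p j (x + y) <= p j x + p j y) ->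
  (forall j x, S x -> p j x <= C j * N x) ->
  (forall x : nat -> X, (forall k, S (x k)) ->
     (forall k, N (x k.+1 - x k) <= 2^-1 ^+ k) ->
     exists2 y, S y & forall e : R, 0 < e -> exists K, forall k, (K <= k)%N ->
       N (y - x k) <= e) ->
  (forall x, S x -> exists M, forall j, p j x <= M) ->
  exists2 K : R, 0 <= K & forall j x, S x -> p j x <= K * N x.
Proof.
move=> S0 Slin NZ ND pZ pD pN compl ptw; apply: contrapT => unb.
have SD x y : S x -> S y -> S (x + y) by move=> Sx Sy; rewrite -[x]scale1r; exact: Slin.
have SZ a x : S x -> S (a *: x) by move=> Sx; rewrite -[_ *: _]addr0; exact: Slin.
have SN x : S x -> S (- x) by move=> Sx; rewrite -scaleN1r; exact: SZ.
have SB x y : S x -> S y -> S (x - y) by move=> Sx Sy; apply: SD => //; exact: SN.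
have N_ge0 x : S x -> 0 <= N x.
  move=> Sx; have := ND x (- x) Sx (SN _ Sx).
  by rewrite subrr -scaleN1r NZ// -(scale0r 0) NZ// normr0 mul0r normrN1 mul1r; lra.
have NB x y : S x -> S y -> N (x - y) = N (y - x).
  by move=> Sx Sy; rewrite -(opprB x y) -(scaleN1r (x - y)) NZ ?normrN1 ?mul1r//;
    exact: SB.
have big K : 0 <= K -> exists j x, S x /\ K * N x < p j x.
  move=> K0; apply: contrapT => H; apply: unb; exists K => // j x Sx.
  by rewrite leNgt; apply/negP => Kx; apply: H; exists j, x.
have hump x (dl k : R) : S x -> 0 < dl -> 0 <= k ->
    exists y j, [/\ S y, N (y - x) <= dl & k <= p j y].
  move=> Sx dl0 k0; have [j [z [Sz zb]]] := big (k / dl) (divr_ge0 k0 (ltW dl0)).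
  have Nz : 0 < N z.
    rewrite lt_neqAle eq_sym N_ge0// andbT; apply/eqP => Nz0.
    have := pN j z Sz; rewrite Nz0 mulr0 => pz; move: zb.
    by rewrite Nz0 mulr0 ltNge pz.
  pose z' := (dl / N z) *: z; have Sz' : S z' by exact: SZ.
  have a0 : 0 <= dl / N z by rewrite divr_ge0// ltW.
  have Nz' : N z' = dl by rewrite NZ// ger0_norm// divfK// gt_eqF.
  have pz' : k <= p j z'.
    rewrite pZ// ger0_norm// -mulrA mulrC -ler_pdivrMr//.
    by rewrite [leRHS]mulrC ler_pdivlMr// ltW.
  (* The points x + z' and x - z' differ by 2 z', so [p j] is at least [p j z'] at one of them: the
     hump is reached without knowing the size of [p j x]. *)
  have : 2 * p j z' <= p j (x + z') + p j (x - z').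
    have -> : 2 * p j z' = p j ((x + z') - (x - z')).
      rewrite (_ : (x + z') - (x - z') = 2%:R *: z'); last first.
        by rewrite scaler_nat mulr2n opprB addrC addrA subrK.
      by rewrite (pZ _ _ _ Sz') ger0_norm.
    apply: le_trans (pD _ _ _ _ _) _; [exact: SD|by apply: SN; exact: SB|].
    by rewrite lerD2l -scaleN1r pZ ?normrN1 ?mul1r//; exact: SB.
  have [pp|pp] := leP k (p j (x + z')).
    by exists (x + z'), j; split => //; [exact: SD|rewrite addrC addKr Nz'].
  exists (x - z'), j; split; [exact: SB| |lra].
  by rewrite addrC addKr -scaleN1r NZ// normrN1 mul1r Nz'.
(* From stage k with centre and radius s.2, the next ball t has at most half the radius, its centre
   moves by at most half the radius, and some [p j] is at least k on all of it. The premises inside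
   [good] let the choice function be total. *)
pose good (s : nat * (X * R)) (t : X * R) := S s.2.1 -> 0 < s.2.2 ->
  [/\ S t.1, 0 < t.2, t.2 <= s.2.2 / 2, N (t.1 - s.2.1) <= s.2.2 / 2 &
   exists j, forall z, S z -> N (z - t.1) <= t.2 -> s.1%:R <= p j z].
have [next nextP] : {f & forall s, good s (f s)}.
  apply: choice => -[k [x dl]]; rewrite /good/=.
  have [[Sx dl0]|nS] := pselect (S x /\ 0 < dl); last first.
    by exists (x, dl) => Sx dl0; exfalso; apply: nS.
  have dl2 : 0 < dl / 2 by rewrite divr_gt0.
  have k1 : 0 <= k%:R + 1 :> R by rewrite addr_ge0.
  have [y [j [Sy yx py]]] := hump _ _ _ Sx dl2 k1.
  have C1 : 0 < `|C j| + 1 by rewrite ltr_wpDl.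
  (* A radius of at most 1 / (|C j| + 1) makes [p j] vary by at most 1 on the new ball, which is why
     the hump was asked to reach k + 1. *)
  exists (y, Num.min (dl / 2) (`|C j| + 1)^-1) => _ _ /=; split => //.
  - by rewrite lt_min divr_gt0// invr_gt0.
  - by rewrite ge_min lexx.
  exists j => z Sz; rewrite le_min => /andP[_ zy].
  have : p j (y - z) <= 1.
    apply: le_trans (pN _ _ (SB _ _ Sy Sz)) _; rewrite NB//.
    have : N (z - y) * (`|C j| + 1) <= 1.
      by rewrite -[leRHS](mulVf (lt0r_neq0 C1)) ler_wpM2r// ltW.
    have := N_ge0 _ (SB _ _ Sz Sy); have := ler_norm (C j); nra.
  have := pD j (y - z) z (SB _ _ Sy Sz) Sz; rewrite subrK; lra.
pose st := fix st n : X * R := if n is n'.+1 then next (n', st n') else (0, 1).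
have stP n : S (st n).1 /\ 0 < (st n).2.
  by elim: n => [|n [Sn dn]] //=; have [] := nextP (n, st n) Sn dn.
have stn n := nextP (n, st n) (stP n).1 (stP n).2.
have d2 n : (st n).2 <= 2^-1 ^+ n.
  elim: n => [|n IHn]; first by rewrite expr0.
  by have [_ _ + _ _] := stn n; rewrite exprS /=; lra.
(* Each move is at most half the current radius, hence at most the loss of radius; the bounds
   telescope and keep all later centres, and so their limit, inside the n-th ball. *)
have far n m : N ((st (n + m)%N).1 - (st n).1) <= (st n).2 - (st (n + m)%N).2.
  elim: m => [|m IHm]; first by rewrite addn0 !subrr -(scale0r 0) NZ// normr0 mul0r.
  have [S1 _ h1 h2 _] := stn (n + m)%N; rewrite addnS /=.
  have -> : (next ((n + m)%N, st (n + m)%N)).1 - (st n).1 =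
    ((next ((n + m)%N, st (n + m)%N)).1 - (st (n + m)%N).1) +
    ((st (n + m)%N).1 - (st n).1) by rewrite addrA subrK.
  apply: le_trans (ND _ _ _ _) _; [by apply: SB => //; exact: (stP _).1|
    by apply: SB; exact: (stP _).1|].
  by move: h1 h2 => /=; lra.
have [|y Sy yl] := compl (fun n => (st n).1) (fun n => (stP n).1).
  move=> k; have [_ _ _ h _] := stn k; apply: le_trans h _.
  have := d2 k; have := (stP k).2; lra.
have near_y n : N (y - (st n).1) <= (st n).2.
  apply/ler_addgt0Pr => e e0; have [K Ke] := yl e e0.
  have -> : y - (st n).1 = (y - (st (n + K)%N).1) + ((st (n + K)%N).1 - (st n).1).
    by rewrite addrA subrK.
  apply: le_trans (ND _ _ _ _) _; [by apply: SB => //; exact: (stP _).1|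
    by apply: SB; exact: (stP _).1|].
  have := Ke (n + K)%N (leq_addl _ _); have := far n K; have := (stP (n + K)%N).2; lra.
have [M pM] := ptw y Sy.
(* Stage n produces the ball with index n + 1, on which some [p j] is at least n; the limit y lies
   in it, and n = [Num.bound M] exceeds the pointwise bound M at y. *)
have [_ _ _ _ [j pj]] := stn (Num.bound M).
have := pj y Sy (near_y (Num.bound M).+1); have := pM j.
move=> h1 h2; have := le_trans h2 h1; rewrite leNgt => /negP; apply => /=.
have [M0|M0] := leP 0 M; first exact: archi_boundP.
exact: lt_le_trans M0 (ler0n _ _).
Qed.

End UniformBoundedness.

(** * Geometry of the boundary *)

Section PlaneMeasurability.
Context {R : realType}.
Implicit Types (A : set (plane R)).

Lemma measurable_box (a b e : R) :
  @measurable _ (mplane R) (ball a e `*` ball b e).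
Proof. by apply: measurableX; exact: measurable_ball. Qed.

(** The sigma-algebra is the product one, so openness is reduced to countably many boxes with
    rational centre and radius 1/(k+1), of which those contained in A already cover A. *)
Lemma open_measurable_plane A : open A -> @measurable _ (mplane R) A.
Proof.
move=> oA.
pose box (i : rat * rat * nat) : set (plane R) :=
  ball (ratr i.1.1 : R) (i.2.+1%:R^-1) `*` ball (ratr i.1.2 : R) (i.2.+1%:R^-1).
pose F i : set (mplane R) := if `[< box i `<=` A >] then box i else set0.
have -> : A = \bigcup_i F i.
  apply/seteqP; split=> [x Ax|x [i _]]; last first.
    by rewrite /F; case: asboolP => // h; exact: h.
  have : nbhs x A by exact: open_nbhs_nbhs.
  rewrite -nbhs_ballE => -[e /= e0 eA].
  (* With 2/(k+1) <= e, every box of radius 1/(k+1) that contains x lies in the ball of radius e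
     about x, by the triangle inequality. *)
  pose k := Num.bound (2 / e); pose dl : R := k.+1%:R^-1.
  have dl0 : 0 < dl by rewrite invr_gt0.
  have dle : dl + dl <= e.
    have : 2 / e < k%:R by apply: archi_boundP; rewrite divr_ge0// ltW.
    rewrite ltr_pdivrMr// => h.
    have : 2 <= e * k.+1%:R.
      by rewrite mulrC; apply: le_trans (ltW h) _; rewrite ler_wpM2r ?ler_nat// ltW.
    by rewrite -ler_pdivrMr// => h2; rewrite -mulr2n -mulr_natl.
  have rq (y : R) : exists q : rat, ball (ratr q : R) dl y.
    have /rat_in_itvoo[q] : y - dl < y + dl by rewrite ltrD2l; lra.
    rewrite in_itv/= => /andP[q1 q2]; exists q; rewrite /ball/= ltr_norml.
    by apply/andP; split; lra.
  have [q1 hq1] := rq x.1; have [q2 hq2] := rq x.2.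
  exists (q1, q2, k) => //; rewrite /F; case: asboolP => [_|nb]; first by split.
  exfalso; apply: nb => y [y1 y2]; apply: eA; split => /=.
    by apply: le_ball dle _ _; apply: (@ball_triangle _ _ (ratr q1 : R)) => //; exact: ball_sym.
  by apply: le_ball dle _ _; apply: (@ball_triangle _ _ (ratr q2 : R)) => //; exact: ball_sym.
apply: countable_bigcupT_measurable => // i; rewrite /F; case: ifP => // _.
exact: measurable_box.
Qed.

Lemma closed_measurable_plane A : closed A -> @measurable _ (mplane R) A.
Proof.
by move=> /closed_openC/open_measurable_plane/measurableC; rewrite setCK.
Qed.

Lemma continuous_measurable_plane (f : plane R -> R) : continuous f ->
  @measurable_fun _ _ (mplane R) R setT f.
Proof.
move=> /continuousP cf; apply: (measurability _ (RGenOpens.measurableE R)).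
move=> _ [_ [a [b ->] <-]]; apply: measurableI => //.
by apply: open_measurable_plane; apply: cf; exact: interval_open.
Qed.

Lemma measurable_set1_plane (x : plane R) : @measurable _ (mplane R) [set x].
Proof.
rewrite (_ : [set x] = [set x.1] `*` [set x.2]); first exact: measurableX.
by apply/seteqP; split=> [y ->|[y1 y2] [/= -> ->]] //; case: x.
Qed.

Lemma bounded_subset_box A : bounded_set A -> exists M : R, 0 < M /\
  A `<=` [set x | `|x.1| <= M] `&` [set x | `|x.2| <= M].
Proof.
move=> [M0 [_ AM]]; pose M := `|M0| + 1; exists M.
have M1 : M0 < M by rewrite /M; have := ler_norm M0; lra.
split; first by rewrite ltr_wpDl.
by move=> x /(AM _ M1); rewrite /= prod_normE ge_max => /andP[].
Qed.

Lemma compact_box (M : R) :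
  compact ([set x : plane R | `|x.1| <= M] `&` [set x | `|x.2| <= M]).
Proof.
rewrite (_ : _ `&` _ = `[- M, M] `*` `[- M, M]).
  by apply: compact_setX; exact: segment_compact.
by apply/seteqP; split => -[x y] []; rewrite /= !in_itv/= -!ler_norml.
Qed.

Lemma bounded_compact_closure A : bounded_set A -> compact (closure A).
Proof.
move=> /bounded_subset_box[M [M0 AM]].
have cB := @compact_box M.
apply: (@subclosed_compact _ (closure A) _ _ cB); first exact: closed_closure.
have /closure_id -> := compact_closed (@norm_hausdorff _ (R * R)%type) cB.
exact: closureS.
Qed.

Lemma continuous_bounded_on A (f : plane R -> R) : bounded_set A -> continuous f ->
  exists2 M : R, 0 <= M & forall x, A x -> `|f x| <= M.
Proof.
move=> bA cf; have cA := bounded_compact_closure bA.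
have /compact_bounded[M [_ fM]] : compact (f @` closure A).
  by apply: continuous_compact => //; exact: continuous_subspaceT.
exists (`|M| + 1) => // x Ax; apply: (fM (`|M| + 1)).
  by have := ler_norm M; lra.
by exists x => //; exact: subset_closure.
Qed.

Lemma area_bounded_lty A : bounded_set A -> @measurable _ (mplane R) A ->
  (@area R A < +oo)%E.
Proof.
move=> /bounded_subset_box[M [M0 AM]] mA.
have -> : @area R A = ((lebesgue_measure \x lebesgue_measure) A)%E by [].
pose B : set (mplane R) := `[- M, M]%classic `*` `[- M, M]%classic.
have mB : measurable B by apply: measurableX; exact: measurable_itv.
apply: (@le_lt_trans _ _ ((lebesgue_measure \x lebesgue_measure)%E B)).
  apply: le_measure; rewrite ?inE//.
  by move=> x /AM[]; rewrite /B /= !in_itv/= -!ler_norml.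
rewrite product_measure1E//.
have E : (@lebesgue_measure R `[(- M)%R, M]%classic = (M - - M)%:E)%E.
  by rewrite lebesgue_measure_itv/= lte_fin gtrN.
have fin (x y : \bar R) : x = (M - - M)%:E -> y = (M - - M)%:E -> (x * y < +oo)%E.
  by move=> -> ->; rewrite -EFinM ltry.
by apply: fin; exact: E.
Qed.

End PlaneMeasurability.

Section ArclengthFinite.
Context {R : realType}.

Lemma edge_measure_lty (e : plane R * plane R) : (edge_measure e setT < +oo)%E.
Proof.
rewrite /edge_measure preimage_setT setIT.
rewrite (_ : mkset _ = `[0%R, 1%R]%classic); last first.
  by apply/seteqP; split => t; rewrite /= in_itv.
by rewrite lebesgue_measure_itv/= lte01 -EFinB -EFinM ltry.
Qed.

Lemma arclength_lty (es : seq (plane R * plane R)) : (arclength es setT < +oo)%E.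
Proof.
rewrite /arclength /= /msum; elim: (size es) => [|n IHn]; first by rewrite big_ord0.
by rewrite big_ord_recr/= lte_add_pinfty// edge_measure_lty.
Qed.

Lemma arclength_fin_num_fun (es : seq (plane R * plane R)) :
  fin_num_fun (arclength es).
Proof.
move=> A mA; rewrite ge0_fin_numE//; apply: le_lt_trans (arclength_lty es).
by apply: le_measure; rewrite ?inE.
Qed.

End ArclengthFinite.

(** * Uniqueness and measurability of the outward normal *)

Section BoundaryNormal.
Context {R : realType}.

Lemma vecE (x : plane R) i : vec x i ord0 = if i == ord0 then x.1 else x.2.
Proof. by rewrite mxE. Qed.

(** For distinct unit vectors the difference w = nu' - nu satisfies w.nu < 0 < w.nu', so a short
    step from x along w would land inside Omega according to nu and outside according to nu'. *)
Lemma outward_normal_unique (Om : set (plane R)) x nu nu' :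
  outward_normal_at Om x nu -> outward_normal_at Om x nu' -> nu = nu'.
Proof.
move=> [n1 [e e0 He]] [n1' [e' e0' He']]; apply/eqP; rewrite -subr_eq0; apply/eqP.
apply: mxnorm_eq0; apply/eqP; apply: contraT => dn0.
pose w : 'cV[R]_2 := nu' - nu.
have nn : mxdot nu nu = 1 by rewrite -sqr_mxnorm n1 expr1n.
have nn' : mxdot nu' nu' = 1 by rewrite -sqr_mxnorm n1' expr1n.
have dd : 0 < 2 - 2 * mxdot nu nu'.
  have -> : 2 - 2 * mxdot nu nu' = mxnorm (nu - nu') ^+ 2.
    by rewrite sqr_mxnorm mxdotBl !mxdotBr nn nn' (mxdotC nu' nu); ring.
  by rewrite exprn_gt0// lt_neqAle eq_sym dn0 mxnorm_ge0.
have w1 : mxdot w nu < 0 by rewrite mxdotBl nn mxdotC; lra.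
have w2 : 0 < mxdot w nu' by rewrite mxdotBl nn'; lra.
pose s := Num.min e e' / (2 * (mxnorm w + 1)).
have m0 : 0 < Num.min e e' by rewrite lt_min e0.
have w0 : 0 < mxnorm w + 1 by rewrite ltr_wpDl ?mxnorm_ge0.
have s0 : 0 < s by rewrite divr_gt0// mulr_gt0.
pose y : plane R := (x.1 + s * w ord0 ord0, x.2 + s * w (lift ord0 ord0) ord0).
have yx : vec y - vec x = s *: w.
  apply/matrixP => i j; rewrite (ord1 j) !mxE.
  have [->|] := eqVneq i ord0; first by rewrite /y/= addrC addKr !mxE.
  move=> i0; rewrite /y/= addrC addKr.
  rewrite (_ : i = lift ord0 ord0) ?mxE//.
  by apply/val_inj; case: i i0 => -[|[|]].
have dxy : dist x y < Num.min e e'.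
  rewrite /dist mxnormB_sym yx mxnormZ gtr0_norm// /s mulrAC ltr_pdivrMr ?mulr_gt0//.
  rewrite ltr_pM2l//; have := mxnorm_ge0 w; lra.
move: dxy; rewrite lt_min => /andP[d1 d2].
have := (He y d1).2; rewrite yx mxdotZl pmulr_rlt0// => /(_ w1) Oy.
have := (He' y d2).1 Oy; rewrite yx mxdotZl pmulr_rlt0//.
by rewrite ltNge (ltW w2).
Qed.

Lemma normalE (Om : set (plane R)) x nu : outward_normal_at Om x nu -> normal Om x = nu.
Proof.
move=> xnu; rewrite /normal; case: xgetP => [nu' _ h|/(_ nu)//].
exact: outward_normal_unique h xnu.
Qed.

(** An inequality only, since [normal] takes the default value 0 at corners. *)
Lemma mxnorm_normal_le1 (Om : set (plane R)) x : mxnorm (normal Om x) <= 1.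
Proof.
rewrite /normal; case: xgetP => [nu _ [-> _]|_]; first exact: lexx.
by rewrite mxnorm0.
Qed.

Lemma seg_point_continuous (e : plane R * plane R) : continuous (seg_point e).
Proof.
move=> t.
have lin (a b : R) : (fun x => a + x * b) @ t --> a + t * b.
  by apply: cvgD; [exact: cvg_cst|apply: cvgM; [exact: cvg_id|exact: cvg_cst]].
exact: cvg_pair (lin e.1.1 _) (lin e.1.2 _).
Qed.

Lemma measurable_segment (e : plane R * plane R) : @measurable _ (mplane R) (segment e).
Proof.
apply: closed_measurable_plane; apply: compact_closed.
  exact: norm_hausdorff.
rewrite /segment (_ : [set t | _] = `[0, 1]%classic); last first.
  by apply/seteqP; split => t; rewrite /= in_itv.
apply: continuous_compact; last exact: segment_compact.
by apply: continuous_subspaceT; exact: seg_point_continuous.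
Qed.

Variable G : geometry R.

Lemma measurable_boundary : @measurable _ (mplane R) (boundary (dom G)).
Proof.
apply: measurableD.
  by apply: closed_measurable_plane; exact: closed_closure.
by apply: open_measurable_plane; exact: open_interior.
Qed.

Lemma measurable_boundary_part Gam : boundary_part G Gam -> @measurable _ (mplane R) Gam.
Proof.
move=> [] [U oU ->] _; apply: measurableI; first exact: measurable_boundary.
exact: open_measurable_plane.
Qed.

Lemma boundary_part_sub Gam : boundary_part G Gam -> Gam `<=` boundary (dom G).
Proof. by move=> [] [U oU ->] _ x []. Qed.

Hypothesis HG : polygonal_domain G.

Lemma measurable_dom : @measurable _ (mplane R) (dom G).
Proof. by case: HG => -[+ _ _] _; exact: open_measurable_plane. Qed.

(** On the open segment the normal is a constant vector, by uniqueness; the two endpoints are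
    singletons, on which every function is measurable. *)
Lemma measurable_normal_segment e i : e \in edges G ->
  @measurable_fun _ _ (mplane R) R (segment e) (fun x => normal (dom G) x i ord0).
Proof.
move=> eG; have [_ [_ _ _ /(_ e eG)[nu Hnu]]] := HG.
pose I : set (mplane R) := segment e `\` ([set e.1] `|` [set e.2]).
have mI : measurable I.
  apply: measurableD; first exact: measurable_segment.
  by apply: measurableU; exact: measurable_set1_plane.
have mE : @measurable _ (mplane R) (([set e.1] `|` [set e.2]) `&` segment e).
  apply: measurableI; last exact: measurable_segment.
  by apply: measurableU; exact: measurable_set1_plane.
have -> : segment e = I `|` (([set e.1] `|` [set e.2]) `&` segment e).
  by rewrite /I (setIC _ (segment e)) setUC setUIDK.
apply/measurable_funU => //; split.
  apply: (@eq_measurable_fun _ _ _ _ _ (cst (nu i ord0))); last exact: measurable_cst.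
  move=> x; rewrite inE => -[] [t /= /andP[t0 t1] <-] nx; rewrite (normalE (Hnu t _))//.
  rewrite !lt_neqAle t0 t1 !andbT eq_sym; apply/andP; split; apply/negP => /eqP t01.
    apply: nx; left; rewrite /seg_point t01 !mul0r !addr0.
    by case: (e.1).
  apply: nx; right; rewrite /seg_point t01 !mul1r !(addrC _ (_ - _)) !subrK.
  by case: (e.2).
apply: measurable_funS (measurableU _ _ (measurable_set1_plane e.1)
  (measurable_set1_plane e.2)) (@subIsetl _ _ _) _.
apply/measurable_funU; [exact: measurable_set1_plane|exact: measurable_set1_plane|].
by split; exact: measurable_fun_set1.
Qed.

Lemma measurable_normal i :
  @measurable_fun _ _ (mplane R) R (boundary (dom G)) (fun x => normal (dom G) x i ord0).
Proof.
have [_ [-> _ _ _]] := HG.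
(* Stated for any list of edges so that the induction adds one segment at a time; measurability of
   the union is carried along for the gluing. *)
have H : forall s : seq (plane R * plane R), {subset s <= edges G} ->
    @measurable_fun _ _ (mplane R) R (\bigcup_(e in [set e | e \in s]) segment e)
      (fun x => normal (dom G) x i ord0) /\
    @measurable _ (mplane R) (\bigcup_(e in [set e | e \in s]) segment e).
  elim=> [_|e s IHs es].
    rewrite (_ : \bigcup_(e in _) _ = set0); first by split => //; exact: measurable_fun_set0.
    by apply/seteqP; split => // x [e].
  have [|m1 m2] := IHs; first by move=> z zs; apply: es; rewrite inE zs orbT.
  rewrite (_ : \bigcup_(e0 in _) _ =
      segment e `|` \bigcup_(e in [set e | e \in s]) segment e).
    split; last by apply: measurableU => //; exact: measurable_segment.
    apply/measurable_funU => //; first exact: measurable_segment.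
    by split => //; apply: measurable_normal_segment; apply: es; rewrite inE eqxx.
  apply/seteqP; split=> [x [z /=]|x [ex|[z zs zx]]].
  - by rewrite inE => /orP[/eqP -> ?|zs zx]; [left|right; exists z].
  - by exists e => //=; rewrite inE eqxx.
  - by exists z => //=; rewrite inE zs orbT.
by have [] := H (edges G).
Qed.

End BoundaryNormal.

(** * Matrix fields, the Slobodeckij seminorm, and completeness of the Sobolev space *)

Section MatrixLnorm.
Context {R : realType} d (T : measurableType d) (mu : {measure set T -> \bar R}).
Variable D : set T.
Hypothesis mD : measurable D.
Context {m n : nat}.
Implicit Types (A B : T -> 'M[R]_(m, n)) (p : R).

Local Notation "''L_' p [ f ]" := ('N[mu]_(p%:E)[EFin \o (f%R \_ D)])%E
  (at level 5, p at level 2, format "''L_' p [ f ]").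
Local Notation "''NL_' p [ A ]" := ('N[mu]_(p%:E)[EFin \o ((fun x => mxnorm (A x)) \_ D)])%E
  (at level 5, p at level 2, format "''NL_' p [ A ]").

Lemma mxLnorm_add_le A B p : 1 <= p -> measurable_mx D A -> measurable_mx D B ->
  ('NL_p[fun x => (A x + B x)%R] <= 'NL_p[A] + 'NL_p[B])%E.
Proof.
move=> p1 mA mB; have mNA := measurable_mxnorm mA; have mNB := measurable_mxnorm mB.
apply: le_trans (Lnorm_add_le mu mD p1 mNA mNB).
apply: le_Lnorm => //; first exact: lt_le_trans ltr01 p1.
- exact/measurable_mxnorm/measurable_mxD.
- exact: measurable_funD.
by apply: nearW => x _; rewrite !ger0_norm ?addr_ge0 ?mxnorm_ge0// mxnormD.
Qed.

Lemma mxLnorm_scale a A p : 0 < p -> measurable_mx D A ->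
  ('NL_p[fun x => (a *: A x)%R] = `|a|%:E * 'NL_p[A])%E.
Proof.
move=> p0 mA; rewrite -[X in (X%:E * _)%E]normr_id -(Lnorm_scale mu mD _ p0 (measurable_mxnorm mA)).
by apply: eq_LnormD => x _; rewrite mxnormZ.
Qed.

Lemma mxLnorm_entry_le A p i j : 0 < p -> measurable_mx D A ->
  ('L_p[fun x => A x i j] <= 'NL_p[A])%E.
Proof.
move=> p0 mA; apply: le_Lnorm => //; first exact: measurable_mxnorm.
by apply: nearW => x _; rewrite [leRHS]ger0_norm ?mxnorm_ge0 ?normr_entry_le.
Qed.

(** Completeness entry by entry; the factor m n comes from bounding the Frobenius norm by the sum of
    the absolute entries. *)
Lemma mxLnorm_complete (A : nat -> T -> 'M[R]_(m, n)) p : 1 <= p ->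
  (forall k, measurable_mx D (A k)) -> ('NL_p[A 0%N] < +oo)%E ->
  (forall k, ('NL_p[fun x => (A k.+1 x - A k x)%R] <= (2^-1 ^+ k)%:E)%E) ->
  exists B, [/\ measurable_mx D B, ('NL_p[B] < +oo)%E &
    forall k, ('NL_p[fun x => (B x - A k x)%R] <= ((m * n)%:R * (2 * 2^-1 ^+ k))%:E)%E].
Proof.
move=> p1 mA A0 dA; have p0 : 0 < p by exact: lt_le_trans ltr01 p1.
have mdA k : measurable_mx D (fun x => A k.+1 x - A k x).
  by apply: measurable_mxD => //; exact: measurable_mxN.
have /choice[g gP] (ij : 'I_m * 'I_n) : exists g : T -> R, [/\ measurable_fun D g,
    ('L_p[g] < +oo)%E &
    forall k, ('L_p[g \- (fun x => A k x ij.1 ij.2)] <= (2 * 2^-1 ^+ k)%:E)%E].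
  case: ij => i j; apply: (@Lnorm_complete _ _ _ mu D mD (fun k x => A k x i j)) => //.
  - by move=> k; exact: mA.
  - exact: le_lt_trans (mxLnorm_entry_le _ _ p0 (mA _)) A0.
  move=> k; apply: le_trans (dA k); apply: le_trans (mxLnorm_entry_le i j p0 (mdA k)).
  rewrite le_eqVlt; apply/orP; left; apply/eqP; apply: eq_LnormD => x _.
  by rewrite !mxE.
pose B x : 'M[R]_(m, n) := \matrix_(i, j) g (i, j) x.
have mB : measurable_mx D B.
  by move=> i j; under eq_fun do rewrite mxE; have [] := gP (i, j).
have BA k : ('NL_p[fun x => (B x - A k x)%R] <= ((m * n)%:R * (2 * 2^-1 ^+ k))%:E)%E.
  pose u (ij : 'I_m * 'I_n) x : R := `|g ij x - A k x ij.1 ij.2|.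
  have mg ij : measurable_fun D (fun x => g ij x - A k x ij.1 ij.2).
    by have [? _ _] := gP ij; apply: measurable_funB => //; exact: mA.
  have mu_ ij : measurable_fun D (u ij) by apply: measurableT_comp => //; exact: mg.
  have uL ij : ('L_p[u ij] <= (2 * 2^-1 ^+ k)%:E)%E.
    have [_ _ /(_ k)] := gP ij; apply: le_trans; rewrite le_eqVlt; apply/orP; left.
    by apply/eqP; apply: eq_LnormD => x _; rewrite normr_id.
  have := Lnorm_sum_le mD (index_enum _) p1 mu_ uL.
  rewrite sumr_const card_prod !card_ord -[(2 * _) *+ _]mulr_natl.
  apply: le_trans; apply: le_Lnorm => //.
  - by apply: measurable_mxnorm; apply: measurable_mxD => //; exact: measurable_mxN.
  - exact: measurable_sum.
  apply: nearW => x _; rewrite ger0_norm ?mxnorm_ge0// ger0_norm ?sumr_ge0//.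
  apply: le_trans (mxnorm_le_sum _) _; rewrite pair_big/= le_eqVlt; apply/orP; left.
    by apply/eqP; apply: eq_bigr => -[i j] _; rewrite /u !mxE.
  by move=> ij _; exact: normr_ge0.
exists B; split => //.
rewrite (_ : 'NL_p[B] = 'NL_p[fun x => ((B x - A 0%N x) + A 0%N x)%R]); last first.
  by apply: eq_LnormD => x _; rewrite subrK.
apply: le_lt_trans (mxLnorm_add_le p1 _ (mA 0%N)) _.
  by apply: measurable_mxD => //; exact: measurable_mxN.
by rewrite lte_add_pinfty// (le_lt_trans (BA 0%N))// ltry.
Qed.

Lemma bounded_Lnorm_lty (f : T -> R) (M q : R) : 0 < q -> (mu D < +oo)%E ->
  measurable_fun D f -> (forall x, D x -> `|f x| <= M) -> ('L_q[f] < +oo)%E.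
Proof.
move=> q0 Doo mf fM; have qn0 : q != 0 by rewrite gt_eqF.
apply: (@le_lt_trans _ _ 'L_q[cst M]).
  apply: le_Lnorm => //; apply: nearW => x Dx.
  by apply: le_trans (fM x Dx) (ler_norm _).
rewrite (LnormE _ _ _ qn0) poweR_lty//.
have -> : (\int[mu]_(x in D) (`|cst M x| `^ q)%:E = (`|M| `^ q)%:E * mu D)%E.
  exact: (integral_cst mu mD (`|M| `^ q)%:E).
by apply: lte_mul_pinfty => //; rewrite lee_fin powR_ge0.
Qed.

End MatrixLnorm.

Section LnormPairing.
Context {R : realType} d (T : measurableType d) (mu : {measure set T -> \bar R}).
Implicit Types (f g : T -> R) (D : set T) (p q : R).

Local Notation "''N_' p [ f | D ]" := ('N[mu]_(p%:E)[EFin \o (f%R \_ D)])%E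
  (at level 5, p at level 2, format "''N_' p [ f  |  D ]").

Lemma Lnorm_subset D D' f p : 0 < p -> measurable D -> measurable D' -> D `<=` D' ->
  measurable_fun D' f -> ('N_p[f | D] <= 'N_p[f | D'])%E.
Proof.
move=> p0 mD mD' DD' mf; have pn0 : p != 0 by rewrite gt_eqF.
rewrite !(LnormE _ _ _ pn0); apply: gt0_ler_poweR; first by rewrite invr_ge0 ltW.
- by rewrite in_itv/= leey andbT integral_ge0// => x _; rewrite lee_fin powR_ge0.
- by rewrite in_itv/= leey andbT integral_ge0// => x _; rewrite lee_fin powR_ge0.
apply: ge0_subset_integral => //; exact: measurable_powR_norm.
Qed.

Lemma Rintegral_pairing_lin D (a : R) f1 f2 g p q : measurable D ->
  0 < p -> 0 < q -> p^-1 + q^-1 = 1 ->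
  measurable_fun D f1 -> measurable_fun D f2 -> measurable_fun D g ->
  ('N_p[f1 | D] < +oo)%E -> ('N_p[f2 | D] < +oo)%E -> ('N_q[g | D] < +oo)%E ->
  \int[mu]_(x in D) ((a * f1 x + f2 x) * g x) =
  a * \int[mu]_(x in D) (f1 x * g x) + \int[mu]_(x in D) (f2 x * g x).
Proof.
move=> mD p0 q0 pq m1 m2 mg f1oo f2oo goo.
have [I1 _] := hoelder_integrable mD p0 q0 pq m1 mg f1oo goo.
have [I2 _] := hoelder_integrable mD p0 q0 pq m2 mg f2oo goo.
rewrite -RintegralZl// -RintegralD//.
  by apply: eq_Rintegral => x _; rewrite mulrDl mulrA.
by have := integrableZl mD a I1; apply: eq_integrable.
Qed.

End LnormPairing.

(** * The Slobodeckij seminorm as an L^r norm on the product space *)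

Section Slobodeckij.
Context {R : realType} d (T : measurableType d).
Variable mu : {finite_measure set T -> \bar R}.
Variable D : set T.
Hypothesis mD : measurable D.
Variable delta : T * T -> R.
Hypotheses (mdelta : measurable_fun setT delta) (delta_ge0 : forall z, 0 <= delta z).
Variable r : R.
Hypothesis r1 : 1 <= r.
Implicit Types zeta eta : T -> R.

Local Notation "''L_' p [ f ]" := ('N[mu]_(p%:E)[EFin \o (f%R \_ D)])%E
  (at level 5, p at level 2, format "''L_' p [ f ]").
Local Notation DD := (D `*` D).
Local Notation "''LL' [ f ]" := ('N[mu \x mu]_(r%:E)[EFin \o (f%R \_ DD)])%E
  (at level 5, format "''LL' [ f ]").

Let r0 : 0 < r. Proof. exact: lt_le_trans ltr01 r1. Qed.
Let rn0 : r != 0. Proof. by rewrite gt_eqF. Qed.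
Let mDD : measurable DD. Proof. exact: measurableX. Qed.

Lemma integral_setX (F : T * T -> \bar R) :
  measurable_fun DD F -> (forall z, DD z -> (0 <= F z)%E) ->
  (\int[mu \x mu]_(z in DD) F z = \int[mu]_(x in D) \int[mu]_(y in D) F (x, y))%E.
Proof.
move=> mF F0; rewrite integral_mkcond fubini_tonelli1.
- rewrite [RHS]integral_mkcond; apply: eq_integral => x _; rewrite /fubini_F [RHS]patchE.
  case: ifPn => xD.
    rewrite [RHS]integral_mkcond; apply: eq_integral => y _; rewrite !patchE.
    by rewrite in_setX/= xD.
  apply: integral0_eq => y _; rewrite patchE in_setX/=.
  by rewrite (negbTE xD).
- exact/(measurable_restrictT _ mDD).
by move=> z; rewrite patchE; case: ifPn => //; rewrite inE => /F0.
Qed.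

Lemma measurable_fun_fst zeta : measurable_fun D zeta ->
  measurable_fun DD (fun z => zeta z.1).
Proof.
move=> mz; apply: (@eq_measurable_fun _ _ _ _ _ ((zeta \_ D) \o fst)).
  by move=> z; rewrite in_setX => /andP[z1 _]; rewrite /= patchE z1.
apply: (measurable_funS measurableT) => //.
by apply: measurableT_comp => //; exact: restrictT_measurable.
Qed.

Lemma measurable_fun_snd zeta : measurable_fun D zeta ->
  measurable_fun DD (fun z => zeta z.2).
Proof.
move=> mz; apply: (@eq_measurable_fun _ _ _ _ _ ((zeta \_ D) \o snd)).
  by move=> z; rewrite in_setX => /andP[_ z2]; rewrite /= patchE z2.
apply: (measurable_funS measurableT) => //.
by apply: measurableT_comp => //; exact: restrictT_measurable.
Qed.

(** The weight w = 1/delta gives the Slobodeckij quotient, w = [trunc_inv j] its truncation. *)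
Definition difference_quotient (w : T * T -> R) zeta (z : T * T) : R :=
  w z * (zeta z.1 - zeta z.2).

Lemma measurable_difference_quotient w zeta : measurable_fun setT w ->
  measurable_fun D zeta -> measurable_fun DD (difference_quotient w zeta).
Proof.
move=> mw mz; apply: measurable_funM.
  exact: (measurable_funS measurableT).
by apply: measurable_funB; [exact: measurable_fun_fst|exact: measurable_fun_snd].
Qed.

(* With 1/delta truncated, the Slobodeckij seminorm becomes bounded for the L^r norm;
   the truncated seminorms are the family fed to [uniform_boundedness]. *)
Definition trunc_inv (j : nat) (z : T * T) : R := Num.min j%:R (delta z)^-1.

Lemma measurable_delta_inv : measurable_fun setT (fun z => (delta z)^-1).
Proof.
have -> : (fun z => (delta z)^-1) = (fun z => delta z `^ (-1)).
  by apply/funext => z; rewrite powR_inv1.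
by apply: (measurableT_comp (measurable_powR _)).
Qed.

Lemma measurable_trunc_inv j : measurable_fun setT (trunc_inv j).
Proof. by apply: measurable_minr => //; exact: measurable_delta_inv. Qed.

Lemma trunc_inv_ge0 j z : 0 <= trunc_inv j z.
Proof. by rewrite /trunc_inv le_min ler0n invr_ge0 delta_ge0. Qed.

Definition slob (j : nat) zeta := 'LL[difference_quotient (trunc_inv j) zeta]%E.

Let mslob j zeta (mz : measurable_fun D zeta) :
  measurable_fun DD (difference_quotient (trunc_inv j) zeta) :=
  measurable_difference_quotient (measurable_trunc_inv j) mz.

Lemma slobZ j a zeta : measurable_fun D zeta ->
  slob j (fun x => a * zeta x) = (`|a|%:E * slob j zeta)%E.
Proof.
move=> mz; rewrite /slob -(Lnorm_scale _ mDD _ r0 (mslob j mz)).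
by apply: eq_LnormD => z _; rewrite /difference_quotient; congr (`|_|); ring.
Qed.

Lemma slobD j zeta eta : measurable_fun D zeta -> measurable_fun D eta ->
  (slob j (fun x => (zeta x + eta x)%R) <= slob j zeta + slob j eta)%E.
Proof.
move=> mz me; apply: le_trans (Lnorm_add_le _ mDD r1 (mslob j mz) (mslob j me)).
rewrite le_eqVlt; apply/orP; left; apply/eqP.
by apply: eq_LnormD => z _; rewrite /difference_quotient; congr (`|_|) => /=; ring.
Qed.

Lemma Lnorm_fst zeta : measurable_fun D zeta ->
  'LL[fun z => zeta z.1]%E = ('L_r[zeta] * mu D `^ r^-1)%E.
Proof.
move=> mz; rewrite [LHS](LnormE _ _ _ rn0) [X in _ = (X * _)%E](LnormE _ _ _ rn0) -poweRM//; last first.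
  by apply: integral_ge0 => x _; rewrite lee_fin powR_ge0.
apply: (congr1 (poweR ^~ r^-1)).
rewrite integral_setX; last 2 first.
- by apply: (measurable_powR_norm r (f := fun z : T * T => zeta z.1)); exact: measurable_fun_fst.
- by move=> z _; rewrite lee_fin powR_ge0.
rewrite -ge0_integralZr//; [|exact: measurable_powR_norm].
by apply: eq_integral => x _; exact: (integral_cst mu mD (`|zeta x| `^ r)%:E).
Qed.

Lemma Lnorm_snd zeta : measurable_fun D zeta ->
  'LL[fun z => zeta z.2]%E = ('L_r[zeta] * mu D `^ r^-1)%E.
Proof.
move=> mz; rewrite [LHS](LnormE _ _ _ rn0) [X in _ = (X * _)%E](LnormE _ _ _ rn0) -poweRM//; last first.
  by apply: integral_ge0 => x _; rewrite lee_fin powR_ge0.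
apply: (congr1 (poweR ^~ r^-1)).
rewrite integral_setX; last 2 first.
- by apply: (measurable_powR_norm r (f := fun z : T * T => zeta z.2)); exact: measurable_fun_snd.
- by move=> z _; rewrite lee_fin powR_ge0.
exact: (integral_cst mu mD (\int[mu]_(y in D) (`|zeta y| `^ r)%:E)%E).
Qed.

(** The kernel is at most j and |zeta x - zeta y| <= |zeta x| + |zeta y|. Each summand depends on
    one variable, and integrating out the other contributes mu(D)^(1/r), which is finite. The growth
    of the constant with j is harmless for [uniform_boundedness]. *)
Lemma slob_le j zeta : measurable_fun D zeta ->
  (slob j zeta <= (j%:R * 2 * fine (mu D `^ r^-1))%:E * 'L_r[zeta])%E.
Proof.
move=> mz; have m1 := measurable_fun_fst mz; have m2 := measurable_fun_snd mz.
pose a (z : T * T) : R := `|zeta z.1|; pose b (z : T * T) : R := `|zeta z.2|.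
have ma : measurable_fun DD a by exact: measurableT_comp.
have mb : measurable_fun DD b by exact: measurableT_comp.
apply: (@le_trans _ _ 'LL[fun z => j%:R * (a \+ b) z]%E).
  apply: le_Lnorm => //; first exact: mslob.
    by apply: measurable_funM => //; exact: measurable_funD.
  apply: nearW => z _; rewrite /difference_quotient normrM (ger0_norm (trunc_inv_ge0 _ _)).
  rewrite [leRHS]ger0_norm ?mulr_ge0 ?addr_ge0 ?normr_ge0 ?ler0n//.
  apply: ler_pM; [exact: trunc_inv_ge0|exact: normr_ge0| |exact: ler_normB].
  by rewrite /trunc_inv ge_min lexx.
rewrite (Lnorm_scale _ mDD _ r0); last exact: measurable_funD.
rewrite ger0_norm// -mulrA EFinM -muleA; apply: lee_wpmul2l; first by rewrite lee_fin.
apply: le_trans (Lnorm_add_le _ mDD r1 ma mb) _.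
have -> : 'LL[a]%E = 'LL[fun z => zeta z.1]%E by apply: eq_LnormD => z _; rewrite normr_id.
have -> : 'LL[b]%E = 'LL[fun z => zeta z.2]%E by apply: eq_LnormD => z _; rewrite normr_id.
rewrite Lnorm_fst// Lnorm_snd//.
have mDf : (mu D `^ r^-1)%E \is a fin_num by rewrite fin_num_poweR// fin_num_measure.
by rewrite EFinM fineK// -[leRHS]muleA (muleC (mu D `^ _)%E) mule_natl mule2n.
Qed.

Let H zeta := difference_quotient (fun z => (delta z)^-1) zeta.

Let mH zeta : measurable_fun D zeta -> measurable_fun DD (H zeta).
Proof. by apply: measurable_difference_quotient; exact: measurable_delta_inv. Qed.

Lemma slobodeckij_integralE zeta : measurable_fun D zeta ->
  (\int[mu]_(x in D) \int[mu]_(y in D)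
     (`|zeta x - zeta y| `^ r / delta (x, y) `^ r)%:E = 'LL[H zeta] `^ r)%E.
Proof.
move=> mz; rewrite (poweR_LnormE _ _ _ rn0) integral_setX.
- apply: eq_integral => x _; apply: eq_integral => y _ /=.
  rewrite /H /difference_quotient/= normrM powRM// mulrC; congr (_ * _)%:E.
  by rewrite ger0_norm ?invr_ge0// -(powR_inv1 (delta_ge0 _)) -powRrM mulN1r powRN.
- by apply: measurable_powR_norm; exact: mH.
by move=> z _; rewrite lee_fin powR_ge0.
Qed.

Lemma slobodeckij_scale a zeta : measurable_fun D zeta ->
  (\int[mu]_(x in D) \int[mu]_(y in D)
     (`|a * zeta x - a * zeta y| `^ r / delta (x, y) `^ r)%:E =
   (`|a| `^ r)%:E * \int[mu]_(x in D) \int[mu]_(y in D)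
     (`|zeta x - zeta y| `^ r / delta (x, y) `^ r)%:E)%E.
Proof.
move=> mz; have maz : measurable_fun D (fun x => a * zeta x) by exact: measurable_funM.
rewrite (slobodeckij_integralE maz) (slobodeckij_integralE mz).
rewrite -poweR_EFin -poweRM ?lee_fin ?Lnorm_ge0//; apply: (congr1 (poweR ^~ r)).
rewrite -(Lnorm_scale _ mDD _ r0 (mH mz)); apply: eq_LnormD => z _.
by rewrite /H /difference_quotient; congr (`|_|); ring.
Qed.

(** At each point the truncation is inactive for large j, so the truncated quotients converge to the
    full one and Fatou's lemma transfers their common bound. *)
Lemma slob_bound zeta (M : R) : measurable_fun D zeta ->
  (forall x y, delta (x, y) = 0 -> zeta x = zeta y) -> 0 <= M ->
  (forall j, (slob j zeta <= M%:E)%E) ->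
  (\int[mu]_(x in D) \int[mu]_(y in D)
     (`|zeta x - zeta y| `^ r / delta (x, y) `^ r)%:E <= (M `^ r)%:E)%E.
Proof.
move=> mz dz M0 sM; have HM : ('LL[H zeta] <= M%:E)%E.
  apply: (@Lnorm_fatou _ _ _ _ _ mDD
    (fun j => difference_quotient (trunc_inv j) zeta)) => //.
    by move=> j; exact: mslob.
    exact: mH.
  apply: nearW => z _.
  (* On the zero set of delta the difference of values is 0, so every quotient, truncated or not, is
     0 there. *)
  have [d0|dn0] := eqVneq (delta z) 0.
    rewrite (_ : (fun j => _) = cst 0).
      rewrite /H /difference_quotient (dz z.1 z.2) -?surjective_pairing// subrr mulr0.
      exact: cvg_cst.
    apply/funext => j; rewrite /difference_quotient (dz z.1 z.2) -?surjective_pairing//.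
    by rewrite subrr mulr0.
  apply: (@cvg_near_cst); exists (Num.bound (delta z)^-1) => // j /= bj.
  rewrite /H /difference_quotient /trunc_inv min_r//.
  apply: le_trans (ltW (archi_boundP _)) _; first by rewrite invr_ge0.
  by rewrite ler_nat.
rewrite slobodeckij_integralE// -poweR_EFin; apply: gt0_ler_poweR HM; first exact: ltW.
- by rewrite in_itv/= leey Lnorm_ge0.
- by rewrite in_itv/= leey lee_fin M0.
Qed.

Lemma slob_le_seminorm j zeta : measurable_fun D zeta ->
  (slob j zeta `^ r <= \int[mu]_(x in D) \int[mu]_(y in D)
     (`|zeta x - zeta y| `^ r / delta (x, y) `^ r)%:E)%E.
Proof.
move=> mz; rewrite slobodeckij_integralE//.
apply: gt0_ler_poweR; first exact: ltW.
- by rewrite in_itv/= leey Lnorm_ge0.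
- by rewrite in_itv/= leey Lnorm_ge0.
apply: le_Lnorm => //; [exact: mslob|exact: mH|].
apply: nearW => z _; rewrite /H /difference_quotient !normrM ler_wpM2r//.
rewrite (ger0_norm (trunc_inv_ge0 _ _)) ger0_norm ?invr_ge0//.
by rewrite /trunc_inv ge_min lexx orbT.
Qed.

End Slobodeckij.

Lemma half_powers_small (R : realType) (C e : R) : 0 <= C -> 0 < e ->
  exists K, forall k, (K <= k)%N -> C * 2^-1 ^+ k <= e.
Proof.
move=> C0 e0; exists (Num.bound (C / e)) => k Kk.
have k2 : C / e <= 2 ^+ k.
  apply: le_trans (ltW (archi_boundP _)) _; first by rewrite divr_ge0// ltW.
  by rewrite -natrX ler_nat (leq_trans Kk)// ltnW// ltn_expl.
by rewrite exprVn ler_pdivrMr ?exprn_gt0// [leRHS]mulrC -ler_pdivrMr.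
Qed.

(** * Completeness of the Sobolev space *)

Section SobolevComplete.
Context {R : realType} (G : geometry R) (r : R).
Hypothesis r1 : 1 < r.
Hypothesis HG : polygonal_domain G.
Local Notation Omega := (dom G).
Local Notation r' := (conj_exp r).

Let mO : @measurable _ (mplane R) Omega. Proof. exact: measurable_dom. Qed.
Let r1' : 1 <= r. Proof. exact: ltW. Qed.
Let r0 : 0 < r. Proof. exact: lt_trans ltr01 r1. Qed.
Let q0 : 0 < r'. Proof. exact: conj_exp_gt0. Qed.
Let bO : bounded_set Omega. Proof. by case: HG => -[]. Qed.

Lemma area_dom_lty : (@area R Omega < +oo)%E.
Proof. exact: area_bounded_lty. Qed.

Lemma bounded_LnormO_lty (f : plane R -> R) : continuous f ->
  (Lpnorm area Omega r'%:E f < +oo)%E.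
Proof.
move=> cf; have [M M0 fM] := continuous_bounded_on bO cf.
have mf := measurable_funTS (continuous_measurable_plane cf).
exact: (bounded_Lnorm_lty mO q0 area_dom_lty (mf _) fM).
Qed.

Definition Lp_pair (u : vfield R) : Prop :=
  Lp_mx area Omega r%:E u.1 /\ Lp_mx area Omega r%:E u.2.

(* Equivalent to [sobolev_norm], and a sum of two seminorms on the nose. *)
Definition gradseminorm (u : vfield R) : R :=
  fine (Lpnorm_mx area Omega r%:E u.1) + fine (Lpnorm_mx area Omega r%:E u.2).

Lemma Lp_mx_lin {m n} (a : R) (A B : plane R -> 'M[R]_(m, n)) :
  Lp_mx area Omega r%:E A -> Lp_mx area Omega r%:E B ->
  Lp_mx area Omega r%:E (fun x => a *: A x + B x).
Proof.
move=> [mA Aoo] [mB Boo].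
have mZ : @measurable_mx R _ (mplane R) Omega m n (fun x => a *: A x).
  exact: (measurable_mxZ (f := cst a)).
split; first exact: (@measurable_mxD R _ (mplane R) Omega m n _ _ mZ mB).
apply: le_lt_trans (mxLnorm_add_le area mO r1' mZ mB) _.
by rewrite lte_add_pinfty// (mxLnorm_scale area mO a r0 mA) lte_mul_pinfty.
Qed.

Lemma Lpnorm_mx_fin {m n} (A : plane R -> 'M[R]_(m, n)) :
  Lp_mx area Omega r%:E A -> Lpnorm_mx area Omega r%:E A \is a fin_num.
Proof. by move=> [_ Aoo]; exact: (@Lnorm_fin _ (mplane R)). Qed.

Lemma fine_Lpnorm_mx_add {m n} (A B : plane R -> 'M[R]_(m, n)) :
  Lp_mx area Omega r%:E A -> Lp_mx area Omega r%:E B ->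
  fine (Lpnorm_mx area Omega r%:E (fun x => A x + B x)) <=
  fine (Lpnorm_mx area Omega r%:E A) + fine (Lpnorm_mx area Omega r%:E B).
Proof.
move=> LA LB; have := Lp_mx_lin 1 LA LB.
rewrite (_ : (fun x => 1 *: A x + B x) = (fun x => A x + B x)); last first.
  by apply/funext => x; rewrite scale1r.
move=> LAB; rewrite -lee_fin EFinD !fineK ?Lpnorm_mx_fin//.
by case: LA LB => mA _ [mB _]; exact: (mxLnorm_add_le area mO r1' mA mB).
Qed.

Lemma fine_Lpnorm_mx_scale {m n} a (A : plane R -> 'M[R]_(m, n)) :
  Lp_mx area Omega r%:E A ->
  fine (Lpnorm_mx area Omega r%:E (fun x => a *: A x)) =
  `|a| * fine (Lpnorm_mx area Omega r%:E A).
Proof.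
move=> LA; have fA := Lpnorm_mx_fin LA; case: LA => mA _.
rewrite (_ : Lpnorm_mx area Omega r%:E (fun x => a *: A x) =
  (`|a|%:E * Lpnorm_mx area Omega r%:E A)%E); first by rewrite fineM.
exact: (mxLnorm_scale area mO a r0 mA).
Qed.

Lemma Lp_pair_lin a u v : Lp_pair u -> Lp_pair v -> Lp_pair (a *: u + v).
Proof. by move=> [u1 u2] [v1 v2]; split; exact: Lp_mx_lin. Qed.

Lemma Lp_pairB u v : Lp_pair u -> Lp_pair v -> Lp_pair (u - v).
Proof. by move=> Lu Lv; rewrite addrC -scaleN1r; exact: Lp_pair_lin. Qed.

Lemma gradseminorm_ge0 u : 0 <= gradseminorm u.
Proof. by rewrite addr_ge0// fine_ge0// Lnorm_ge0. Qed.

Lemma gradseminormZ a u : Lp_pair u -> gradseminorm (a *: u) = `|a| * gradseminorm u.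
Proof.
move=> [u1 u2]; rewrite /gradseminorm mulrDr.
by rewrite -(fine_Lpnorm_mx_scale a u1) -(fine_Lpnorm_mx_scale a u2).
Qed.

Lemma gradseminormD u v : Lp_pair u -> Lp_pair v ->
  gradseminorm (u + v) <= gradseminorm u + gradseminorm v.
Proof.
move=> [u1 u2] [v1 v2]; rewrite /gradseminorm addrACA lerD//;
  exact: fine_Lpnorm_mx_add.
Qed.

Section WeakDefect.
Variables (i j : 'I_2) (phi : plane R -> R).
Hypothesis tphi : test_function Omega phi.

Let cphi : continuous phi.
Proof. by case: tphi => /(_ [::])[]. Qed.
Let cdphi : continuous (partial j phi).
Proof. by case: tphi => /(_ [:: j])[]. Qed.

(** The defect in the integration by parts formula, seen as a linear functional of the pair (u.1,
    u.2), so that being a weak gradient is a closed linear condition. *)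
Definition weak_defect (u : vfield R) : R :=
  \int[area]_(x in Omega) (u.1 x i ord0 * partial j phi x) +
  \int[area]_(x in Omega) (u.2 x i j * phi x).

Let mc (f : plane R -> R) : continuous f -> @measurable_fun _ _ (mplane R) R Omega f.
Proof. by move=> cf; apply: measurable_funTS; exact: continuous_measurable_plane. Qed.

Let ent {m n} (A : plane R -> 'M[R]_(m, n)) k l : Lp_mx area Omega r%:E A ->
  (Lpnorm area Omega r%:E (fun x => A x k l) < +oo)%E.
Proof.
by move=> [mA Aoo]; apply: le_lt_trans Aoo; exact: (mxLnorm_entry_le area mO k l r0 mA).
Qed.

Lemma weak_defect_lin a u v : Lp_pair u -> Lp_pair v ->
  weak_defect (a *: u + v) = a * weak_defect u + weak_defect v.
Proof.
move=> [u1 u2] [v1 v2]; rewrite /weak_defect mulrDr addrACA.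
have L m n (A B : plane R -> 'M[R]_(m, n)) k l g : continuous g ->
    Lp_mx area Omega r%:E A -> Lp_mx area Omega r%:E B ->
    \int[area]_(x in Omega) ((a *: A x + B x) k l * g x) =
    a * \int[area]_(x in Omega) (A x k l * g x) + \int[area]_(x in Omega) (B x k l * g x).
  move=> cg LA LB.
  have := Rintegral_pairing_lin a mO r0 q0 (conj_exp_sum r1) (LA.1 k l) (LB.1 k l)
    (mc cg) (ent k l LA) (ent k l LB) (bounded_LnormO_lty cg).
  move=> <-; apply: eq_Rintegral => x _.
  by rewrite !mxE.
by rewrite -(L _ _ _ _ i ord0 _ cdphi u1 v1) -(L _ _ _ _ i j _ cphi u2 v2).
Qed.

(** The test function and its derivative are continuous, hence bounded on the bounded set Omega and
    in L^r' there; Hoelder's inequality does the rest. *)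
Lemma weak_defect_bound : exists2 C : R, 0 <= C & forall u, Lp_pair u ->
  `|weak_defect u| <= C * gradseminorm u.
Proof.
pose a := fine (Lpnorm area Omega r'%:E (partial j phi)).
pose b := fine (Lpnorm area Omega r'%:E phi).
have a0 : 0 <= a by rewrite fine_ge0// Lnorm_ge0.
have b0 : 0 <= b by rewrite fine_ge0// Lnorm_ge0.
exists (a + b) => [|u [u1 u2]]; first exact: addr_ge0.
have L m n (A : plane R -> 'M[R]_(m, n)) k l g : continuous g ->
    Lp_mx area Omega r%:E A ->
    `|\int[area]_(x in Omega) (A x k l * g x)| <=
    fine (Lpnorm_mx area Omega r%:E A) * fine (Lpnorm area Omega r'%:E g).
  move=> cg LA.
  have [_] := hoelder_integrable mO r0 q0 (conj_exp_sum r1) (LA.1 k l) (mc cg)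
    (ent k l LA) (bounded_LnormO_lty cg).
  move=> h; apply: le_trans h _; apply: ler_wpM2r; first by rewrite fine_ge0// Lnorm_ge0.
  apply: fine_le; [exact: (@Lnorm_fin _ (mplane R) _ _ _ _ _ (ent k l LA))|
    exact: Lpnorm_mx_fin|].
  exact: (mxLnorm_entry_le area mO k l r0 LA.1).
have := L _ _ _ i ord0 _ cdphi u1; have := L _ _ _ i j _ cphi u2.
have n1 : 0 <= fine (Lpnorm_mx area Omega r%:E u.1) by rewrite fine_ge0// Lnorm_ge0.
have n2 : 0 <= fine (Lpnorm_mx area Omega r%:E u.2) by rewrite fine_ge0// Lnorm_ge0.
rewrite -/a -/b /weak_defect /gradseminorm => h2 h1.
apply: le_trans (ler_normD _ _) _; apply: le_trans (lerD h1 h2) _.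
by nra.
Qed.

End WeakDefect.

Lemma sobolevP u : sobolev Omega r u <->
  Lp_pair u /\ forall i j phi, test_function Omega phi -> weak_defect i j phi u = 0.
Proof.
split=> [[u1 u2 w]|[[u1 u2] w]]; split => //.
  by move=> i j phi tphi; rewrite /weak_defect (w i j phi tphi) addNr.
by move=> i j phi tphi; apply/eqP; rewrite -addr_eq0; apply/eqP; exact: w.
Qed.

Lemma sobolev_pair u : sobolev Omega r u -> Lp_pair u.
Proof. by move=> /sobolevP[]. Qed.

Lemma sobolev_lin a u v : sobolev Omega r u -> sobolev Omega r v ->
  sobolev Omega r (a *: u + v).
Proof.
move=> /sobolevP[u1 u2] /sobolevP[v1 v2]; apply/sobolevP; split.
  exact: Lp_pair_lin.
by move=> i j phi tphi; rewrite weak_defect_lin// u2// v2// mulr0 addr0.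
Qed.

Lemma sobolev0 : sobolev Omega r 0.
Proof.
have L0 m n : Lp_mx area Omega r%:E (fun=> 0 : 'M[R]_(m, n)).
  split; first by move=> i j; exact: measurable_cst.
  rewrite /Lpnorm_mx /Lpnorm (_ : EFin \o _ = cst 0%E).
    by rewrite Lnorm0// eqe gt_eqF.
  by apply/funext => x /=; rewrite patchE mxnorm0; case: ifP.
split; [exact: L0|exact: L0|] => i j phi _.
rewrite /Rintegral !integral0_eq ?fine0 ?oppr0// => x _.
  by rewrite mxE mul0r.
by rewrite mxE mul0r.
Qed.

(** Field and gradient converge separately in L^r; the limits stay linked because every weak defect
    is continuous for [gradseminorm]. *)
Lemma gradseminorm_complete (u : nat -> vfield R) :
  (forall k, sobolev Omega r (u k)) ->
  (forall k, gradseminorm (u k.+1 - u k) <= 2^-1 ^+ k) ->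
  exists2 v, sobolev Omega r v & exists2 C : R, 0 <= C &
    forall k, gradseminorm (v - u k) <= C * 2^-1 ^+ k.
Proof.
move=> Su du; have Lu k := sobolev_pair (Su k).
have C (m n : nat) (A : nat -> plane R -> 'M[R]_(m, n)) :
    (forall k, Lp_mx area Omega r%:E (A k)) ->
    (forall k, fine (Lpnorm_mx area Omega r%:E (fun x => A k.+1 x - A k x)) <= 2^-1 ^+ k) ->
    exists2 B, Lp_mx area Omega r%:E B & forall k,
      fine (Lpnorm_mx area Omega r%:E (fun x => B x - A k x)) <= (m * n)%:R * (2 * 2^-1 ^+ k).
  move=> LA dA.
  have LB (B B' : plane R -> 'M[R]_(m, n)) : Lp_mx area Omega r%:E B -> Lp_mx area Omega r%:E B' ->
      Lp_mx area Omega r%:E (fun x => B x - B' x).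
    move=> LB LB'; have := Lp_mx_lin (-1) LB' LB.
    rewrite (_ : (fun x => -1 *: B' x + B x) = (fun x => B x - B' x))//.
    by apply/funext => x; rewrite scaleN1r addrC.
  have [|k|B [mB Boo BA]] := mxLnorm_complete (mu := area) mO r1' (fun k => (LA k).1).
  - exact: (LA 0%N).2.
  - by have := dA k; rewrite -lee_fin fineK// Lpnorm_mx_fin//; exact: LB.
  exists B => [//|k]; rewrite -lee_fin fineK; first exact: BA.
  by apply: Lpnorm_mx_fin; exact: LB.
have h1 k : fine (Lpnorm_mx area Omega r%:E (fun x => (u k.+1).1 x - (u k).1 x)) <= 2^-1 ^+ k.
  apply: le_trans (du k); rewrite /gradseminorm lerDl.
  by rewrite fine_ge0// Lnorm_ge0.
have h2 k : fine (Lpnorm_mx area Omega r%:E (fun x => (u k.+1).2 x - (u k).2 x)) <= 2^-1 ^+ k.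
  apply: le_trans (du k); rewrite /gradseminorm lerDr.
  by rewrite fine_ge0// Lnorm_ge0.
have [v1 Lv1 e1] := C _ _ (fun k => (u k).1) (fun k => (Lu k).1) h1.
have [v2 Lv2 e2] := C _ _ (fun k => (u k).2) (fun k => (Lu k).2) h2.
pose v : vfield R := (v1, v2); have Lv : Lp_pair v by [].
(* 12 = 2 (2 + 4), for the two entries of the field and the four of its gradient. *)
have vu k : gradseminorm (v - u k) <= 12 * 2^-1 ^+ k.
  apply: le_trans (lerD (e1 k) (e2 k)) _.
  have : 0 <= 2^-1 ^+ k :> R by rewrite exprn_ge0// invr_ge0.
  by rewrite /=; lra.
exists v; last by exists 12.
apply/sobolevP; split => // i j phi tphi; apply/eqP; rewrite -normr_le0.
have [D D0 Dbound] := weak_defect_bound i j tphi.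
apply/ler_addgt0Pr => e e0; rewrite add0r.
have [k /(_ k (leqnn k)) ke] := half_powers_small (mulr_ge0 D0 (ler0n R 12)) e0.
(* The defect of u k vanishes, so it can be subtracted at will, and what remains is the defect of a
   pair of arbitrarily small seminorm. *)
have -> : weak_defect i j phi v = weak_defect i j phi (v - u k).
  rewrite addrC -scaleN1r weak_defect_lin//.
  by have /sobolevP[_ ->//] := Su k; rewrite mulr0 add0r.
apply: le_trans (Dbound _ (Lp_pairB Lv (Lu k))) _.
by apply: le_trans (ler_wpM2l D0 (vu k)) _; rewrite mulrA.
Qed.

End SobolevComplete.

(** * Traces *)

Section PowerSums.
Context {R : realType}.

Lemma powRK_inv (r x : R) : 0 < r -> 0 <= x -> (x `^ r) `^ r^-1 = x.
Proof. by move=> r0 x0; rewrite -powRrM mulfV ?gt_eqF// powRr1. Qed.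

Lemma powR_sum_le (r a b : R) : 1 <= r -> 0 <= a -> 0 <= b ->
  (a `^ r + b `^ r) `^ r^-1 <= 2 * (a + b).
Proof.
move=> r1 a0 b0; have r0 : 0 < r by exact: lt_le_trans ltr01 r1.
have ab0 : 0 <= 2 * (a + b) by rewrite mulr_ge0// addr_ge0.
rewrite -[leRHS](powRK_inv r0 ab0).
apply: ge0_ler_powR; rewrite ?nnegrE ?addr_ge0 ?powR_ge0 ?invr_ge0 ?(ltW r0)//.
rewrite powRM ?addr_ge0//.
have two : 2 <= 2 `^ r :> R.
  by rewrite -[leLHS](@powRr1 R 2)//; apply: ler_powR => //; rewrite ler1n.
have ha : a `^ r <= (a + b) `^ r.
  by apply: ge0_ler_powR; rewrite ?nnegrE ?addr_ge0 ?(ltW r0)// lerDl.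
have hb : b `^ r <= (a + b) `^ r.
  by apply: ge0_ler_powR; rewrite ?nnegrE ?addr_ge0 ?(ltW r0)// lerDr.
apply: le_trans (lerD ha hb) _; rewrite -mulr2n -[leLHS]mulr_natl.
by apply: ler_wpM2r => //; exact: powR_ge0.
Qed.

Lemma le_powR_suml (r a b : R) : 0 < r -> 0 <= a ->
  a <= (a `^ r + b `^ r) `^ r^-1.
Proof.
move=> r0 a0; rewrite -[leLHS](powRK_inv r0 a0).
apply: ge0_ler_powR; rewrite ?nnegrE ?addr_ge0 ?powR_ge0 ?invr_ge0 ?(ltW r0)//.
by rewrite lerDl powR_ge0.
Qed.

End PowerSums.

Section PlaneDistance.
Context {R : realType}.

Lemma measurable_dist : @measurable_fun _ _ (mplane R * mplane R)%type R setT
  (fun z => dist z.1 z.2).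
Proof.
apply: measurable_mxnorm => i j.
have -> : (fun z : (plane R * plane R)%type => (vec z.1 - vec z.2) i j) =
    (fun z => (if i == ord0 then z.1.1 else z.1.2) - (if i == ord0 then z.2.1 else z.2.2)).
  by apply/funext => z; rewrite !mxE.
have m11 : @measurable_fun _ _ (mplane R * mplane R)%type (measurableTypeR R) setT (fun z => z.1.1).
  by apply: (measurableT_comp (f := fst)) => //; exact: measurable_fst.
have m12 : @measurable_fun _ _ (mplane R * mplane R)%type (measurableTypeR R) setT (fun z => z.1.2).
  by apply: (measurableT_comp (f := snd)) => //; exact: measurable_fst.
have m21 : @measurable_fun _ _ (mplane R * mplane R)%type (measurableTypeR R) setT (fun z => z.2.1).
  by apply: (measurableT_comp (f := fst)) => //; exact: measurable_snd.
have m22 : @measurable_fun _ _ (mplane R * mplane R)%type (measurableTypeR R) setT (fun z => z.2.2).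
  by apply: (measurableT_comp (f := snd)) => //; exact: measurable_snd.
by case: (i == ord0); apply: measurable_funB.
Qed.

Lemma dist_eq0 (x y : plane R) : dist x y = 0 -> x = y.
Proof.
move=> /mxnorm_eq0 /eqP; rewrite subr_eq0 => /eqP xy.
have := congr1 (fun A : 'cV[R]_2 => A ord0 ord0) xy.
have := congr1 (fun A : 'cV[R]_2 => A (lift ord0 ord0) ord0) xy.
by rewrite !vecE /=; case: x {xy} => a b; case: y => c e /= -> ->.
Qed.

End PlaneDistance.

Section AlmostEverywhere.
Context {R : realType} (mu : {measure set (mplane R) -> \bar R}).
Implicit Types P Q : set (plane R).

(* [filterS] and [filterI] at the type [mplane R], whose measurable structure is
   the one of mu; unification would infer another one from [plane R]. *)
Lemma ae_mono P Q : (forall x, P x -> Q x) ->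
  (\forall x \ae mu, P x) -> \forall x \ae mu, Q x.
Proof. by move=> PQ; apply: (@filterS (mplane R)). Qed.

Lemma ae_conj P Q : (\forall x \ae mu, P x) -> (\forall x \ae mu, Q x) ->
  \forall x \ae mu, P x /\ Q x.
Proof. by move=> aP aQ; apply: (@filterI (mplane R)). Qed.

End AlmostEverywhere.

Section Trace.
Context {R : realType} (G : geometry R) (r : R).
Context (tr : (plane R -> 'cV[R]_2) -> plane R -> 'cV[R]_2).
Hypothesis r1 : 1 < r.
Hypotheses (HG : polygonal_domain G) (HP : boundary_partition G).
Hypothesis HT : trace_operator G r tr.
Local Notation Omega := (dom G).
Local Notation dO := (boundary (dom G)).
Local Notation Gb := (Gamma_b G).
Local Notation Gd := (Gamma_d G).
Local Notation gN := (gradseminorm G r).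
Local Notation nt := (normal_trace G tr).
Local Notation tg := (tangential G tr).

Let r1' : 1 <= r. Proof. exact: ltW. Qed.
Let r0 : 0 < r. Proof. exact: lt_trans ltr01 r1. Qed.
Let mdO : @measurable _ (mplane R) dO. Proof. exact: measurable_boundary. Qed.

Lemma Gamma_b_part : boundary_part G Gb. Proof. by case: HP => -[]. Qed.
Lemma Gamma_d_part : boundary_part G Gd. Proof. by case: HP => -[]. Qed.

Lemma measurable_Gamma_b : @measurable _ (mplane R) Gb.
Proof. exact: measurable_boundary_part Gamma_b_part. Qed.

Lemma sobolev_normE u : Lp_pair G r u -> sobolev_norm Omega r u =
  ((fine (Lpnorm_mx area Omega r%:E u.1) `^ r +
    fine (Lpnorm_mx area Omega r%:E u.2) `^ r) `^ r^-1)%:E.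
Proof.
move=> [L1 L2]; rewrite /sobolev_norm -{1}(fineK (Lpnorm_mx_fin L1)).
by rewrite -{1}(fineK (Lpnorm_mx_fin L2)).
Qed.

Lemma sobolev_norm_le u : Lp_pair G r u -> fine (sobolev_norm Omega r u) <= 2 * gN u.
Proof.
by move=> Lu; rewrite sobolev_normE//= powR_sum_le// fine_ge0// Lnorm_ge0.
Qed.

Lemma gradseminorm_le u : Lp_pair G r u -> gN u <= 2 * fine (sobolev_norm Omega r u).
Proof.
move=> Lu; rewrite sobolev_normE//= /gradseminorm.
set a := fine _; set b := fine _.
have a0 : 0 <= a by rewrite fine_ge0// Lnorm_ge0.
have b0 : 0 <= b by rewrite fine_ge0// Lnorm_ge0.
have := le_powR_suml b r0 a0; have := le_powR_suml a r0 b0.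
by rewrite (addrC (b `^ r)); lra.
Qed.

Lemma sobolev_norm_fin u : Lp_pair G r u -> sobolev_norm Omega r u \is a fin_num.
Proof. by move=> Lu; rewrite sobolev_normE. Qed.

Section BoundaryFields.
Variable u : vfield R.
Hypothesis Su : sobolev Omega r u.

Lemma measurable_trace : @measurable_mx R _ (mplane R) dO _ _ (tr u.1).
Proof. by case: HT => /(_ u Su)[]. Qed.

Lemma trace_lty : (Lpnorm_mx (ds G) dO r%:E (tr u.1) < +oo)%E.
Proof. by case: HT => /(_ u Su)[]. Qed.

Lemma measurable_mx_normal : @measurable_mx R _ (mplane R) dO _ _ (normal Omega).
Proof. by move=> i j; rewrite (ord1 j); exact: measurable_normal. Qed.

Lemma measurable_normal_trace : @measurable_fun _ _ (mplane R) R dO (nt u).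
Proof.
exact: (@measurable_mxdot R _ (mplane R) dO _ _ _ _ measurable_trace measurable_mx_normal).
Qed.

Lemma normal_trace_le x : `|nt u x| <= mxnorm (tr u.1 x).
Proof.
apply: le_trans (cauchy_schwarz _ _) _; rewrite -[leRHS]mulr1.
by apply: ler_wpM2l; [exact: mxnorm_ge0|exact: mxnorm_normal_le1].
Qed.

Lemma tangentialE x : tg u x = tr u.1 x - nt u x *: normal Omega x.
Proof.
rewrite /tangential mulmxBl mul1mx -mulmxA; congr (_ - _).
apply/matrixP => i j; rewrite !mxE big_ord1 mulrC; congr (_ * _); last first.
  by rewrite (ord1 j).
rewrite mxE /normal_trace /mxdot; apply: eq_bigr => k _.
by rewrite big_ord1 (ord1 j) mxE mulrC.
Qed.

Lemma measurable_tangential : @measurable_mx R _ (mplane R) dO _ _ (tg u).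
Proof.
rewrite (_ : tg u = (fun x => tr u.1 x + - (nt u x *: normal Omega x))).
  apply: measurable_mxD; first exact: measurable_trace.
  apply: measurable_mxN; apply: measurable_mxZ; last exact: measurable_mx_normal.
  exact: measurable_normal_trace.
by apply/funext => x; rewrite tangentialE.
Qed.

Lemma mxnorm_tangential_le x : mxnorm (tg u x) <= 2 * mxnorm (tr u.1 x).
Proof.
rewrite tangentialE; apply: le_trans (mxnormB _ _) _; rewrite mxnormZ.
have h1 := normal_trace_le x; have h2 := mxnorm_normal_le1 Omega x.
have h3 := mxnorm_ge0 (normal Omega x).
have : `|nt u x| * mxnorm (normal Omega x) <= mxnorm (tr u.1 x) * 1.
  by apply: ler_pM.
lra.
Qed.

Lemma Lnorm_normal_trace_le Gam : @measurable _ (mplane R) Gam -> Gam `<=` dO ->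
  (Lpnorm (ds G) Gam r%:E (nt u) <= Lpnorm_mx (ds G) dO r%:E (tr u.1))%E.
Proof.
move=> mGam sub; have mnt := measurable_normal_trace.
apply: le_trans (Lnorm_subset (ds G) r0 mGam mdO sub mnt) _.
apply: (le_Lnorm mdO) => //; first exact: (measurable_mxnorm measurable_trace).
by apply: nearW => x _; rewrite [leRHS]ger0_norm ?mxnorm_ge0// normal_trace_le.
Qed.

Lemma Lnorm_tangential_le Gam : @measurable _ (mplane R) Gam -> Gam `<=` dO ->
  (Lpnorm_mx (ds G) Gam r%:E (tg u) <= 2%:E * Lpnorm_mx (ds G) dO r%:E (tr u.1))%E.
Proof.
move=> mGam sub; have mtg := measurable_mxnorm measurable_tangential.
have mtr := measurable_mxnorm measurable_trace.
apply: le_trans (Lnorm_subset (ds G) r0 mGam mdO sub mtg) _.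
rewrite -[2]ger0_norm// -(Lnorm_scale (ds G) mdO 2 r0 mtr).
apply: (le_Lnorm mdO) => //; first exact: measurable_funM.
apply: nearW => x _; rewrite [leRHS]ger0_norm ?mulr_ge0 ?mxnorm_ge0//.
by rewrite ger0_norm ?mxnorm_ge0// mxnorm_tangential_le.
Qed.

End BoundaryFields.

Lemma trace_bound : exists2 C : R, 0 <= C & forall u, sobolev Omega r u ->
  fine (Lpnorm_mx (ds G) dO r%:E (tr u.1)) <= C * gN u.
Proof.
(* The sign of the constant in [trace_operator] is not prescribed, hence |C|; the 2 compares the
   W^{1,r} norm with [gN]. *)
case: HT => _ _ [C HC] _; exists (`|C| * 2) => [|u Su]; first by rewrite mulr_ge0.
have Lu := sobolev_pair Su.
rewrite -lee_fin fineK; last first.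
  by rewrite ge0_fin_numE ?Lnorm_ge0//; exact: trace_lty.
apply: le_trans (HC u Su) _; rewrite -(fineK (sobolev_norm_fin Lu)) -EFinM lee_fin.
apply: (@le_trans _ _ (`|C| * fine (sobolev_norm Omega r u))).
  apply: ler_wpM2r; last exact: ler_norm.
  by rewrite fine_ge0// poweR_ge0.
by rewrite -mulrA ler_wpM2l// sobolev_norm_le.
Qed.

Lemma normal_trace_lin a u v : sobolev Omega r u -> sobolev Omega r v ->
  \forall x \ae ds G, dO x -> nt (a *: u + v) x = a * nt u x + nt v x.
Proof.
move=> Su Sv; case: HT => _ /(_ a u v Su Sv) + _ _.
by apply: ae_mono => x + dx => /(_ dx) e; rewrite /normal_trace e mxdotDl mxdotZl.
Qed.

Lemma V_sobolev v : V G r tr v -> sobolev Omega r v. Proof. by case. Qed.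

Lemma V_lin a u v : V G r tr u -> V G r tr v -> V G r tr (a *: u + v).
Proof.
move=> [Su nu] [Sv nv]; split; first exact: sobolev_lin.
apply: ae_mono (ae_conj (normal_trace_lin a Su Sv) (ae_conj nu nv)) => x [e1 [e2 e3]] dx.
rewrite e1; last exact: (boundary_part_sub Gamma_d_part).
by rewrite e2// e3// mulr0 addr0.
Qed.

Lemma V0 : V G r tr 0.
Proof.
have S0 : sobolev Omega r 0 by exact: sobolev0.
(* The trace is linear only almost everywhere, so nt 0 = 0 is derived from nt 0 = nt 0 + nt 0. *)
split => //; apply: ae_mono (normal_trace_lin 1 S0 S0) => x e dx.
have := e (boundary_part_sub Gamma_d_part dx); rewrite scale1r addr0 mul1r.
by move=> /eqP; rewrite -subr_eq0 opprD addNKr oppr_eq0 => /eqP.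
Qed.

(** The condition on Gamma_d survives in the limit: there nt v = nt (v - u k) almost everywhere, and
    the L^r norm of the latter is at most a constant times [gN (v - u k)]. *)
Lemma V_complete (u : nat -> vfield R) : (forall k, V G r tr (u k)) ->
  (forall k, gN (u k.+1 - u k) <= 2^-1 ^+ k) ->
  exists2 v, V G r tr v & forall e : R, 0 < e -> exists K, forall k, (K <= k)%N ->
    gN (v - u k) <= e.
Proof.
move=> Vu du.
have [v Sv [C C0 vC]] := gradseminorm_complete r1 HG (fun k => V_sobolev (Vu k)) du.
have sm (e : R) : 0 < e -> exists K, forall k, (K <= k)%N -> gN (v - u k) <= e.
  move=> e0; have [K Ke] := half_powers_small C0 e0.
  by exists K => k Kk; apply: le_trans (vC k) (Ke k Kk).
exists v => //; split => //.
have mGd := measurable_boundary_part Gamma_d_part.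
have sGd := boundary_part_sub Gamma_d_part.
have mv := measurable_funS mdO sGd (measurable_normal_trace Sv).
apply: (Lnorm_eq0_ae (p := r) mGd r0 mv).
have foo : (Lpnorm (ds G) Gd r%:E (nt v) < +oo)%E.
  apply: le_lt_trans (trace_lty Sv); exact: Lnorm_normal_trace_le.
have fin := Lnorm_fin foo.
apply/eqP; rewrite eq_le Lnorm_ge0 andbT.
rewrite -(fineK fin) lee_fin; apply/ler_addgt0Pr => e e0; rewrite add0r.
have [Ct Ct0 HCt] := trace_bound.
(* Dividing by Ct + 1 instead of Ct keeps the denominator positive. *)
have e0' : 0 < e / (Ct + 1) by rewrite divr_gt0// ltr_wpDl.
have [K /(_ K (leqnn K)) vK] := sm _ e0'.
have Sd : sobolev Omega r (v - u K).
  by rewrite addrC -scaleN1r; apply: sobolev_lin => //; exact: V_sobolev.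
have md := measurable_funS mdO sGd (measurable_normal_trace Sd).
have -> : 'N[ds G]_r%:E[EFin \o ((nt v) \_ Gd)]%E = Lpnorm (ds G) Gd r%:E (nt (v - u K)).
  apply: (eq_Lnorm_ae mGd r0 mv md).
  apply: ae_mono (ae_conj (normal_trace_lin (-1) (V_sobolev (Vu K)) Sv) (Vu K).2) => x [e1 e2] dx.
  have -> : v - u K = -1 *: u K + v by rewrite addrC scaleN1r.
  by rewrite e1 ?e2 ?mulr0 ?add0r//; exact: sGd.
apply: (@le_trans _ _ (fine (Lpnorm_mx (ds G) dO r%:E (tr (v - u K).1)))).
  apply: fine_le; last exact: Lnorm_normal_trace_le.
    apply: Lnorm_fin; apply: le_lt_trans (trace_lty Sd); exact: Lnorm_normal_trace_le.
  by apply: Lnorm_fin; exact: trace_lty.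
apply: le_trans (HCt _ Sd) _; apply: le_trans (ler_wpM2l Ct0 vK) _.
rewrite mulrCA ler_piMr ?(ltW e0)//.
by rewrite ler_pdivrMr ?ltr_wpDl// mul1r lerDl.
Qed.

End Trace.

(* [arclength es] is a packed measure; the alias gives finiteness a carrier on which
   it can be declared. *)
Definition arclength_fun {R : realType} (es : seq (plane R * plane R)) :
  set (mplane R) -> \bar R := arclength es.
HB.instance Definition _ (R : realType) (es : seq (plane R * plane R)) :=
  Measure.copy (arclength_fun es) (arclength es).
HB.instance Definition _ (R : realType) (es : seq (plane R * plane R)) :=
  Measure_isFinite.Build _ _ _ (arclength_fun es) (arclength_fin_num_fun es).
Definition finite_ds {R : realType} (G : geometry R) : {finite_measure set (mplane R) -> \bar R} :=
  arclength_fun (edges G).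

(** * Boundedness of the normal trace into Sigma, and the dual norm *)

Section TraceSigma.
Context {R : realType} (G : geometry R) (r : R).
Context (tr : (plane R -> 'cV[R]_2) -> plane R -> 'cV[R]_2).
Hypothesis r1 : 1 < r.
Hypotheses (HG : polygonal_domain G) (HP : boundary_partition G).
Hypothesis HT : trace_operator G r tr.
Hypothesis HBan : banach (Sigma G r tr) (normSigma G r).
Local Notation Omega := (dom G).
Local Notation dO := (boundary (dom G)).
Local Notation Gb := (Gamma_b G).
Local Notation gN := (gradseminorm G r).
Local Notation nt := (normal_trace G tr).

Let r1' : 1 <= r. Proof. exact: ltW. Qed.
Let r0 : 0 < r. Proof. exact: lt_trans ltr01 r1. Qed.
Let rn0 : r != 0. Proof. by rewrite gt_eqF. Qed.
Let mdO : @measurable _ (mplane R) dO. Proof. exact: measurable_boundary. Qed.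
Let mGb : @measurable _ (mplane R) Gb. Proof. exact: measurable_Gamma_b HP. Qed.
Let sGb : Gb `<=` dO. Proof. exact: boundary_part_sub (Gamma_b_part HP). Qed.

Local Notation delta := (fun z : mplane R * mplane R => dist z.1 z.2).
Let delta_ge0 (z : mplane R * mplane R) : 0 <= delta z. Proof. exact: mxnorm_ge0. Qed.
Local Notation slobj := (@slob R _ (mplane R) (finite_ds G) Gb delta r).

Definition slob_integral (zeta : plane R -> R) : \bar R :=
  (\int[ds G]_(x in Gb) \int[ds G]_(y in Gb)
     (`|zeta x - zeta y| `^ r / dist x y `^ r)%:E)%E.

(** With s = 1 - 1/r the kernel exponent 1 + s r is r itself, so the double integral is the r-th
    power of an L^r norm with delta the Euclidean distance. *)
Lemma normSigmaE zeta : normSigma G r zeta =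
  ((Lpnorm (ds G) Gb r%:E zeta `^ r + slob_integral zeta) `^ r^-1)%E.
Proof.
rewrite /normSigma /slob_integral; have -> // : 1 + (1 - r^-1) * r = r.
by field.
Qed.

Lemma slob_integral_ge0 zeta : (0 <= slob_integral zeta)%E.
Proof.
apply: integral_ge0 => x _; apply: integral_ge0 => y _.
by rewrite lee_fin divr_ge0// powR_ge0.
Qed.

Lemma normSigma_ge0 zeta : (0 <= normSigma G r zeta)%E.
Proof. exact: poweR_ge0. Qed.

Lemma normSigmaZ a zeta : @measurable_fun _ _ (mplane R) R Gb zeta ->
  normSigma G r (a *: zeta) = (`|a|%:E * normSigma G r zeta)%E.
Proof.
move=> mz; rewrite !normSigmaE.
have -> : Lpnorm (ds G) Gb r%:E (a *: zeta) = (`|a|%:E * Lpnorm (ds G) Gb r%:E zeta)%E.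
  exact: (Lnorm_scale (ds G) mGb a r0 mz).
have -> : slob_integral (a *: zeta) = ((`|a| `^ r)%:E * slob_integral zeta)%E.
  exact: (slobodeckij_scale (finite_ds G) mGb measurable_dist delta_ge0 r1' a mz).
have i0 := slob_integral_ge0 zeta.
have l0 : (0 <= Lpnorm (ds G) Gb r%:E zeta `^ r)%E by exact: poweR_ge0.
rewrite poweRM ?lee_fin ?Lnorm_ge0// poweR_EFin -(ge0_muleDr _ l0 i0).
rewrite poweRM ?lee_fin ?powR_ge0 ?(adde_ge0 l0 i0)//.
by rewrite poweR_EFin powRK_inv.
Qed.

Lemma measurable_nt_Gb v : sobolev Omega r v ->
  @measurable_fun _ _ (mplane R) R Gb (nt v).
Proof. by move=> Sv; exact: (measurable_funS mdO sGb (measurable_normal_trace HG HT Sv)). Qed.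

Lemma Lnorm_nt_Gb_lty v : sobolev Omega r v -> (Lpnorm (ds G) Gb r%:E (nt v) < +oo)%E.
Proof.
move=> Sv; apply: le_lt_trans (trace_lty HT Sv).
exact: (Lnorm_normal_trace_le r1 HG HT Sv mGb sGb).
Qed.

Lemma Sigma_normal_trace v : V G r tr v -> Sigma G r tr (nt v).
Proof.
move=> Vv; have Sv := V_sobolev Vv; split; last first.
  by exists v => //; apply: aeW.
by split; [exact: measurable_nt_Gb|exact: Lnorm_nt_Gb_lty].
Qed.

Lemma Sigma_lin a x y : Sigma G r tr x -> Sigma G r tr y -> Sigma G r tr (a *: x + y).
Proof.
move=> [[mx Lx] [u Vu xu]] [[my Ly] [v Vv yv]]; split.
  have maxx : @measurable_fun _ _ (mplane R) R Gb (fun t => a * x t) by exact: measurable_funM.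
  split; first exact: measurable_funD.
  apply: le_lt_trans (Lnorm_add_le (ds G) mGb r1' maxx my) _.
  by rewrite lte_add_pinfty// (Lnorm_scale (ds G) mGb a r0 mx) lte_mul_pinfty.
exists (a *: u + v); first exact: V_lin.
have nl := normal_trace_lin HT a (V_sobolev Vu) (V_sobolev Vv).
apply: ae_mono (ae_conj nl (ae_conj xu yv)) => t [e1 [e2 e3]] Gt.
by rewrite (e1 (sGb Gt)) -(e2 Gt) -(e3 Gt).
Qed.

Lemma Sigma0 : Sigma G r tr 0.
Proof.
have S0 := Sigma_normal_trace (V0 r1 HP HT).
by have := Sigma_lin (-1) S0 S0; rewrite scaleN1r addNr.
Qed.

Lemma SigmaZ a x : Sigma G r tr x -> Sigma G r tr (a *: x).
Proof. by move=> Sx; rewrite -[_ *: _]addr0; exact: Sigma_lin Sx Sigma0. Qed.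

Lemma Sigma_fin x : Sigma G r tr x -> normSigma G r x \is a fin_num.
Proof. by move=> Sx; rewrite ge0_fin_numE ?normSigma_ge0//; case: HBan => /(_ x Sx). Qed.

Lemma slob_fin j (zeta : plane R -> R) : @measurable_fun _ _ (mplane R) R Gb zeta ->
  (Lpnorm (ds G) Gb r%:E zeta < +oo)%E -> slobj j zeta \is a fin_num.
Proof.
move=> mz zoo; rewrite ge0_fin_numE ?Lnorm_ge0//.
apply: le_lt_trans (slob_le (finite_ds G) mGb measurable_dist delta_ge0 r1' j mz) _.
by rewrite lte_mul_pinfty// lee_fin !mulr_ge0// fine_ge0// poweR_ge0.
Qed.

Lemma fine_slobZ j a v : sobolev Omega r v ->
  fine (slobj j (fun x => a * nt v x)) = `|a| * fine (slobj j (nt v)).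
Proof.
move=> Sv; have mv := measurable_nt_Gb Sv.
rewrite (slobZ (finite_ds G) mGb measurable_dist delta_ge0 r1' j a mv).
by rewrite fineM// slob_fin// Lnorm_nt_Gb_lty.
Qed.

(** Needed because linearity of the trace holds almost everywhere only. The difference has zero L^r
    norm, hence zero truncated seminorm by [slob_le], and the triangle inequality concludes. *)
Lemma slob_ae_le j (zeta eta : plane R -> R) :
  @measurable_fun _ _ (mplane R) R Gb zeta -> @measurable_fun _ _ (mplane R) R Gb eta ->
  (\forall x \ae ds G, Gb x -> zeta x = eta x) -> (slobj j zeta <= slobj j eta)%E.
Proof.
move=> mz me ze.
have md : @measurable_fun _ _ (mplane R) R Gb (fun x => zeta x - eta x).
  exact: measurable_funB.
have d0 : slobj j (fun x => zeta x - eta x) = 0%E.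
  apply/eqP; rewrite eq_le Lnorm_ge0 andbT.
  apply: le_trans (slob_le (finite_ds G) mGb measurable_dist delta_ge0 r1' j md) _.
  rewrite (ae_Lnorm_eq0 mGb r0 _ md) ?mule0//.
  by apply: ae_mono ze => x e Gx; rewrite e// subrr.
have -> : zeta = (fun x => eta x + (zeta x - eta x)).
  by apply/funext => x; rewrite addrC subrK.
apply: le_trans (slobD (finite_ds G) mGb measurable_dist delta_ge0 r1' j me md) _.
by rewrite d0 adde0.
Qed.

Lemma slob_nt_lin j a u v : V G r tr u -> V G r tr v ->
  slobj j (nt (a *: u + v)) = slobj j (fun x => a * nt u x + nt v x).
Proof.
move=> Vu Vv; have Su := V_sobolev Vu; have Sv := V_sobolev Vv.
have ml : @measurable_fun _ _ (mplane R) R Gb (fun x => a * nt u x + nt v x).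
  by apply: measurable_funD; [apply: measurable_funM => //|]; exact: measurable_nt_Gb.
have mw := measurable_nt_Gb (V_sobolev (V_lin r1 HG HP HT a Vu Vv)).
have e := normal_trace_lin HT a Su Sv.
apply/eqP; rewrite eq_le; apply/andP; split; apply: slob_ae_le => //.
  by apply: ae_mono e => x ex Gx; exact: ex (sGb Gx).
by apply: ae_mono e => x ex Gx; rewrite ex//; exact: sGb.
Qed.

Lemma slob_nt_fin j v : V G r tr v -> slobj j (nt v) \is a fin_num.
Proof.
move=> /V_sobolev Sv; apply: slob_fin; [exact: measurable_nt_Gb|exact: Lnorm_nt_Gb_lty].
Qed.

Lemma slob_integral_nt_lty v : V G r tr v -> (slob_integral (nt v) < +oo)%E.
Proof.
move=> Vv; have := Sigma_fin (Sigma_normal_trace Vv).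
rewrite ge0_fin_numE ?normSigma_ge0// normSigmaE => h.
have : (Lpnorm (ds G) Gb r%:E (nt v) `^ r + slob_integral (nt v) < +oo)%E.
  by apply: (lty_poweRy _ h); rewrite invr_eq0.
by apply: le_lt_trans; rewrite leeDr// poweR_ge0.
Qed.

Lemma normal_trace_Sigma_bound : exists2 K : R, 0 <= K &
  forall v, V G r tr v -> (normSigma G r (nt v) <= (K * gN v)%:E)%E.
Proof.
have [Ct Ct0 HCt] := trace_bound r1 HT.
have L v : V G r tr v -> (Lpnorm (ds G) Gb r%:E (nt v) <= (Ct * gN v)%:E)%E.
  move=> /V_sobolev Sv.
  apply: le_trans (Lnorm_normal_trace_le r1 HG HT Sv mGb sGb) _.
  rewrite -[leLHS]fineK ?lee_fin; first exact: HCt.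
  by apply: Lnorm_fin; exact: (trace_lty HT Sv).
(* The constant of [slob_le]; multiplied by Ct it bounds the j-th truncated seminorm of the trace by
   [gN]. *)
pose c (j : nat) : R := j%:R * 2 * fine (ds G Gb `^ r^-1)%E.
have c0 j : 0 <= c j by rewrite !mulr_ge0// fine_ge0// poweR_ge0.
have [|||||||||K K0 HK] := @uniform_boundedness R (vfield R) (V G r tr) gN
  (fun j v => fine (slobj j (nt v))) (fun j => c j * Ct).
- exact: V0.
- by move=> a x y; exact: V_lin.
- by move=> a x /V_sobolev/sobolev_pair; exact: gradseminormZ.
- by move=> x y /V_sobolev/sobolev_pair Lx /V_sobolev/sobolev_pair; exact: gradseminormD.
(* Homogeneity: [a *: x] is read as [a *: x + 0], and the trace of 0 vanishes almost everywhere. *)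
- move=> j a x Vx; have V00 := V0 r1 HP HT.
  rewrite -(fine_slobZ _ _ (V_sobolev Vx)).
  have := slob_nt_lin j a Vx V00; rewrite addr0 => ->; congr fine.
  have Sx := V_sobolev Vx; have mx := measurable_nt_Gb Sx.
  have m0 := measurable_nt_Gb (V_sobolev V00).
  have max' : @measurable_fun _ _ (mplane R) R Gb (fun x0 => a * nt x x0).
    exact: measurable_funM.
  have e0 : \forall t \ae ds G, Gb t -> a * nt x t + nt 0 t = a * nt x t.
    have := normal_trace_lin HT 1 (V_sobolev V00) (V_sobolev V00).
    apply: ae_mono => t e Gt; have := e (sGb Gt); rewrite scale1r addr0 mul1r.
    by move=> /eqP; rewrite -subr_eq0 opprD addNKr oppr_eq0 => /eqP ->; rewrite addr0.
  apply/eqP; rewrite eq_le; apply/andP; split; apply: slob_ae_le => //.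
  - exact: measurable_funD.
  - exact: measurable_funD.
  - by apply: ae_mono e0 => t e Gt; rewrite e.
- move=> j x y Vx Vy.
  have := slob_nt_lin j 1 Vx Vy; rewrite scale1r => ->.
  rewrite (_ : (fun x0 => 1 * nt x x0 + nt y x0) = (fun x0 => nt x x0 + nt y x0)); last first.
    by apply/funext => t; rewrite mul1r.
  have mx := measurable_nt_Gb (V_sobolev Vx); have my := measurable_nt_Gb (V_sobolev Vy).
  have D := slobD (finite_ds G) mGb measurable_dist delta_ge0 r1' j mx my.
  have fx := slob_nt_fin j Vx; have fy := slob_nt_fin j Vy.
  rewrite -lee_fin EFinD (fineK fx) (fineK fy) fineK//.
  rewrite ge0_fin_numE ?Lnorm_ge0//; apply: le_lt_trans D _.
  by rewrite lte_add_pinfty// -ge0_fin_numE ?Lnorm_ge0.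
- move=> j x Vx; rewrite -lee_fin (fineK (slob_nt_fin j Vx)).
  have mx := measurable_nt_Gb (V_sobolev Vx).
  apply: le_trans (slob_le (finite_ds G) mGb measurable_dist delta_ge0 r1' j mx) _.
  rewrite -[c j * Ct * gN x]mulrA (EFinM (c j)).
  by apply: lee_wpmul2l; [rewrite lee_fin; exact: c0|exact: L].
- by move=> x Vx dx; exact: (V_complete r1 HG HP HT Vx dx).
(* Pointwise boundedness: the full seminorm dominates every truncated one, and it is finite because
   nt v lies in Sigma. *)
- move=> v Vv; have Ioo := slob_integral_nt_lty Vv.
  exists (fine (slob_integral (nt v)) `^ r^-1) => j.
  have mv := measurable_nt_Gb (V_sobolev Vv).
  have := slob_le_seminorm (finite_ds G) mGb measurable_dist delta_ge0 r1' j mv.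
  rewrite -(fineK (slob_nt_fin j Vv)) poweR_EFin.
  rewrite -[X in (_ <= X)%E -> _](@fineK _ (slob_integral (nt v))); last first.
    by rewrite ge0_fin_numE// slob_integral_ge0.
  rewrite lee_fin => h.
  have s0 : 0 <= fine (slobj j (nt v)) by rewrite fine_ge0// Lnorm_ge0.
  rewrite -[leLHS](powRK_inv r0 s0).
  by apply: ge0_ler_powR h; rewrite ?nnegrE ?powR_ge0 ?invr_ge0 ?(ltW r0) ?fine_ge0 ?slob_integral_ge0.
(* Ct bounds the L^r part and K the Slobodeckij part; the 2 is that of [powR_sum_le]. *)
exists (2 * (Ct + K)) => [|v Vv]; first by rewrite mulr_ge0// addr_ge0.
have g0 := gradseminorm_ge0 G r v.
have I : (slob_integral (nt v) <= ((K * gN v) `^ r)%:E)%E.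
  apply: (slob_bound (mu := finite_ds G) mGb measurable_dist delta_ge0 r1').
  - exact: measurable_nt_Gb (V_sobolev Vv).
  - by move=> x y /= /dist_eq0 ->.
  - by rewrite mulr_ge0.
  by move=> j; rewrite -(fineK (slob_nt_fin j Vv)) lee_fin; exact: HK.
rewrite normSigmaE.
apply: (@le_trans _ _ (((Ct * gN v) `^ r + (K * gN v) `^ r) `^ r^-1)%:E); last first.
  rewrite lee_fin -[leRHS]mulrA [X in _ <= 2 * X]mulrDl.
  by apply: powR_sum_le => //; exact: mulr_ge0.
rewrite -poweR_EFin; apply: gt0_ler_poweR.
- by rewrite invr_ge0 ltW.
- by rewrite in_itv/= leey andbT (adde_ge0 (poweR_ge0 _ _) (slob_integral_ge0 _)).
- by rewrite in_itv/= leey andbT lee_fin addr_ge0 ?powR_ge0.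
rewrite EFinD; apply: leeD => //; rewrite -poweR_EFin; apply: gt0_ler_poweR (L v Vv).
- exact: ltW.
- by rewrite in_itv/= leey andbT Lnorm_ge0.
by rewrite in_itv/= leey andbT lee_fin mulr_ge0.
Qed.

Lemma dual0 mu : dual (Sigma G r tr) (normSigma G r) mu -> mu 0 = 0.
Proof.
move=> [lin _]; have := lin 1 _ _ Sigma0 Sigma0; rewrite scale1r addr0 mul1r.
by move=> /eqP; rewrite -subr_eq0 opprD addNKr oppr_eq0 => /eqP.
Qed.

Lemma dualZ mu a x : dual (Sigma G r tr) (normSigma G r) mu -> Sigma G r tr x ->
  mu (a *: x) = a * mu x.
Proof.
move=> dmu Sx; have [lin _] := dmu.
by have := lin a _ _ Sx Sigma0; rewrite addr0 (dual0 dmu) addr0.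
Qed.

Lemma dualnorm_ge0 mu : dual (Sigma G r tr) (normSigma G r) mu ->
  (0 <= normSigma' G r tr mu)%E.
Proof.
move=> dmu; apply: ereal_sup_ubound; exists 0; last by rewrite (dual0 dmu) normr0.
split; first exact: Sigma0.
have := normSigmaZ 0 (Sigma0.1.1); rewrite scaler0 => ->.
by rewrite normr0 mul0e.
Qed.

Lemma dualnorm_bound mu x : dual (Sigma G r tr) (normSigma G r) mu -> Sigma G r tr x ->
  (`|mu x|%:E <= normSigma' G r tr mu * normSigma G r x)%E.
Proof.
move=> dmu Sx; have fx := Sigma_fin Sx.
(* A vector of norm zero cannot be rescaled to the unit sphere; there the continuity bound of mu
   gives mu x = 0 directly. *)
have [x0|x0] := eqVneq (normSigma G r x) 0%E.
  have [_ [C /(_ x Sx)]] := dmu; by rewrite x0 !mule0.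
have xp : 0 < fine (normSigma G r x).
  by rewrite fine_gt0// lt_neqAle eq_sym x0 normSigma_ge0 -ge0_fin_numE ?normSigma_ge0.
have : (`|mu ((fine (normSigma G r x))^-1 *: x)|%:E <= normSigma' G r tr mu)%E.
  apply: ereal_sup_ubound; exists ((fine (normSigma G r x))^-1 *: x) => //; split.
    exact: SigmaZ.
  rewrite (normSigmaZ _ Sx.1.1) -{2}(fineK fx) -EFinM lee_fin.
  by rewrite ger0_norm ?invr_ge0 ?(ltW xp)// mulVf// gt_eqF.
rewrite (dualZ _ dmu Sx) normrM normfV (ger0_norm (ltW xp)) => h.
rewrite -(fineK fx) -[leLHS](_ : (((fine (normSigma G r x))^-1 * `|mu x|)%:E *
    (fine (normSigma G r x))%:E = _)%E); last first.
  by rewrite -EFinM mulrAC mulVf ?mul1r// gt_eqF.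
by apply: lee_wpmul2r => //; rewrite lee_fin ltW.
Qed.

End TraceSigma.

(** * Error estimates *)

Section LebesgueSubspaces.
Context {R : realType} (mu : {measure set (mplane R) -> \bar R}).
Context (D : set (plane R)) (p : R).
Hypotheses (mD : @measurable _ (mplane R) D) (p1 : 1 <= p).
Local Notation N := (Lpnorm mu D p%:E).
Local Notation L := (Lp mu D p%:E).

Let p0 : 0 < p. Proof. exact: lt_le_trans ltr01 p1. Qed.

Lemma Lp_lin a x y : L x -> L y -> L (a *: x + y).
Proof.
move=> [mx Lx] [my Ly].
have mZ : @measurable_fun _ _ (mplane R) R D (fun t => a * x t) by exact: measurable_funM.
split; first exact: measurable_funD.
apply: le_lt_trans (Lnorm_add_le mu mD p1 mZ my) _.
by rewrite lte_add_pinfty// (Lnorm_scale mu mD a p0 mx) lte_mul_pinfty.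
Qed.

Lemma Lp0 : L 0.
Proof.
split; first exact: measurable_cst.
rewrite /Lpnorm (_ : EFin \o _ = cst 0%E); first by rewrite Lnorm0// eqe gt_eqF.
by apply/funext => x /=; rewrite patchE; case: ifP.
Qed.

Lemma LpD x y : L x -> L y -> L (x + y).
Proof. by move=> Lx Ly; rewrite -[x]scale1r; exact: Lp_lin. Qed.

Lemma LpB x y : L x -> L y -> L (x - y).
Proof. by move=> Lx Ly; rewrite addrC -scaleN1r; exact: Lp_lin. Qed.

Lemma LpnormD x y : L x -> L y -> (N (x + y)%R <= N x + N y)%E.
Proof. by move=> [mx _] [my _]; exact: (Lnorm_add_le mu mD p1 mx my). Qed.

Lemma LpnormB_sym x y : N (x - y)%R = N (y - x)%R.
Proof. by apply: (eq_LnormD (T := mplane R)) => t _; exact: distrC. Qed.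

Lemma Lpnorm_fin x : L x -> N x \is a fin_num.
Proof. by move=> [_ xoo]; exact: (@Lnorm_fin _ (mplane R)). Qed.

(** Elements of Y match combinations of the spanning family only up to distance zero; subtracting
    coefficients preserves this by the triangle inequality. *)
Lemma findim_subspaceB Y x y : findim_subspace L N Y -> Y x -> Y y -> Y (x - y).
Proof.
move=> [n [b [Lb ->]]] [Lx [c xc]] [Ly [c' yc']]; split; first exact: LpB.
have Ls (k : 'I_n -> R) : L (\sum_i k i *: b i).
  apply: big_ind => [|u v|i _]; [exact: Lp0|exact: LpD|].
  by rewrite -[_ *: _]addr0; apply: Lp_lin => //; exact: Lp0.
exists (fun i => c i - c' i).
have -> : \sum_i (c i - c' i) *: b i = \sum_i c i *: b i - \sum_i c' i *: b i.
  by rewrite -sumrB; apply: eq_bigr => i _; rewrite scalerBl.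
have -> : x - y - (\sum_i c i *: b i - \sum_i c' i *: b i) =
    (x - \sum_i c i *: b i) + (\sum_i c' i *: b i - y).
  by rewrite opprB [X in _ + X = _]addrC addrACA [- y + _]addrC.
apply/eqP; rewrite eq_le Lnorm_ge0 andbT.
apply: le_trans (LpnormD (LpB Lx (Ls c)) (LpB (Ls c') Ly)) _.
by rewrite xc LpnormB_sym yc' adde0.
Qed.

End LebesgueSubspaces.

Lemma essentially_bounded (R : realType) (mu : {measure set (mplane R) -> \bar R})
    (D : set (plane R)) (f : plane R -> R) : Lp mu D +oo%E f ->
  exists2 M : R, 0 <= M & \forall x \ae mu, D x -> `|f x| <= M.
Proof.
move=> [_]; rewrite /Lpnorm unlock; case: ifPn => [mu0 foo|mu0 _]; last first.
  (* Here the whole plane has measure 0, so any bound holds almost everywhere. *)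
  exists 0 => //; exists setT; split => //; apply/eqP.
  by rewrite eq_le measure_ge0 andbT leNgt.
have ge := ess_sup_ge mu (abse \o (EFin \o f \_ D)).
set s := ess_sup mu _ in foo ge.
have s0 : (0 <= s)%E by apply: ess_sup_gee => //; apply: aeW => x /=.
exists (fine s); first exact: fine_ge0.
apply: ae_mono ge => x /= + Dx; rewrite patchE mem_set// => h.
by rewrite -lee_fin fineK// ge0_fin_numE.
Qed.

Section Estimates.
Context {R : realType} (G : geometry R) (r : R).
Context (tr : (plane R -> 'cV[R]_2) -> plane R -> 'cV[R]_2).
Hypotheses (r1 : 1 < r) (r2 : r <= 2).
Hypotheses (HG : polygonal_domain G) (HP : boundary_partition G).
Hypothesis HT : trace_operator G r tr.
Local Notation Omega := (dom G).
Local Notation dO := (boundary (dom G)).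
Local Notation Gb := (Gamma_b G).
Local Notation gN := (gradseminorm G r).
Local Notation tg := (tangential G tr).
Local Notation r' := (conj_exp r).

Let r0 : 0 < r. Proof. exact: lt_trans ltr01 r1. Qed.
Let q0 : 0 < r'. Proof. exact: conj_exp_gt0. Qed.
Let mO : @measurable _ (mplane R) Omega. Proof. exact: measurable_dom. Qed.
Let mdO : @measurable _ (mplane R) dO. Proof. exact: measurable_boundary. Qed.
Let mGb : @measurable _ (mplane R) Gb. Proof. exact: measurable_Gamma_b HP. Qed.
Let sGb : Gb `<=` dO. Proof. exact: boundary_part_sub (Gamma_b_part HP). Qed.

Lemma mxnorm_symgrad_le (u : vfield R) x : mxnorm (symgrad u x) <= mxnorm (u.2 x).
Proof.
have tA : mxnorm (u.2 x)^T = mxnorm (u.2 x).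
  rewrite /mxnorm /mxdot exchange_big; congr Num.sqrt.
  by apply: eq_bigr => i _; apply: eq_bigr => j _; rewrite !mxE.
rewrite /symgrad mxnormZ ger0_norm ?invr_ge0//.
have := mxnormD (u.2 x) (u.2 x)^T; rewrite tA; lra.
Qed.

Lemma normr_div_le (v : vfield R) x : `|div v x| <= 2 * mxnorm (v.2 x).
Proof.
rewrite /div /mxtrace !big_ord_recr big_ord0/= add0r.
apply: le_trans (ler_normD _ _) _.
have := normr_entry_le (v.2 x) (widen_ord (leqnSn 1) ord_max) (widen_ord (leqnSn 1) ord_max).
have := normr_entry_le (v.2 x) ord_max ord_max; lra.
Qed.

Lemma measurable_symgrad u : sobolev Omega r u ->
  @measurable_mx R _ (mplane R) Omega _ _ (symgrad u).
Proof.
move=> /sobolev_pair[_ [m2 _]]; apply: (measurable_mxZ (f := cst 2^-1)) => //.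
by apply: measurable_mxD => // i j; under eq_fun do rewrite mxE; exact: m2.
Qed.

Lemma Lnorm_symgrad_le u : sobolev Omega r u ->
  (Lpnorm_mx area Omega r%:E (symgrad u) <= Lpnorm_mx area Omega r%:E u.2)%E.
Proof.
move=> Su; have [_ [m2 _]] := sobolev_pair Su.
apply: (le_Lnorm mO) => //.
- exact: (measurable_mxnorm (measurable_symgrad Su)).
- exact: (measurable_mxnorm m2).
by apply: aeW => x _; rewrite !ger0_norm ?mxnorm_ge0// mxnorm_symgrad_le.
Qed.

Lemma Lnorm_grad_le u : fine (Lpnorm_mx area Omega r%:E u.2) <= gN u.
Proof. by rewrite /gradseminorm lerDr fine_ge0// Lnorm_ge0. Qed.

Lemma Lnorm_symgrad_lty u : sobolev Omega r u ->
  (Lpnorm_mx area Omega r%:E (symgrad u) < +oo)%E.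
Proof.
move=> Su; apply: le_lt_trans (Lnorm_symgrad_le Su) _.
by have [_ []] := sobolev_pair Su.
Qed.

Lemma measurable_tangential_Gb u : sobolev Omega r u ->
  @measurable_mx R _ (mplane R) Gb _ _ (tg u).
Proof.
move=> Su i j; have mt := measurable_tangential HG HT Su.
exact: (measurable_funS mdO sGb (mt i j)).
Qed.

Lemma Lnorm_tangential_lty u : sobolev Omega r u ->
  (Lpnorm_mx (ds G) Gb r%:E (tg u) < +oo)%E.
Proof.
move=> Su; apply: le_lt_trans (Lnorm_tangential_le r1 HG HT Su mGb sGb) _.
by rewrite lte_mul_pinfty//; exact: (trace_lty HT Su).
Qed.

Lemma flux_difference_bound alpha tau : Lp area Omega +oo%E alpha ->
  exists2 K : R, 0 <= K & forall u w v, sobolev Omega r u -> sobolev Omega r w ->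
    sobolev Omega r v -> (E G r tr u w < +oo)%E ->
    `|(opA G r alpha u v + opG G r tr tau u v) -
      (opA G r alpha w v + opG G r tr tau w v)| <=
    K * fine (E G r tr u w `^ r'^-1)%E * gN v.
Proof.
move=> La; have [M M0 aM] := essentially_bounded La; have ma := La.1.
have [Ct Ct0 HCt] := trace_bound r1 HT.
(* 4 M comes from the volume term; 8 |tau| Ct is 4 |tau| from the boundary term times the bound 2 Ct
   of the tangential trace. *)
exists (4 * M + 8 * `|tau| * Ct) => [|u w v Su Sw Sv Eoo].
  by rewrite addr_ge0// !mulr_ge0.
set e := fine (E G r tr u w `^ r'^-1)%E.
have e0 : 0 <= e by rewrite fine_ge0// poweR_ge0.
have E1 : (Lpnorm_mx area Omega 2%:E
    (fun x => Fr r (symgrad u x) - Fr r (symgrad w x))%R ^+ 2 <= E G r tr u w)%E.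
  by rewrite /E leeDl// expe_ge0// Lnorm_ge0.
have E2 : (Lpnorm_mx (ds G) Gb 2%:E
    (fun x => Fr r (tg u x) - Fr r (tg w x))%R ^+ 2 <= E G r tr u w)%E.
  by rewrite /E leeDr// expe_ge0// Lnorm_ge0.
have A1 := stress_difference_le mO r1 r2 M0 ma aM (measurable_symgrad Su)
  (measurable_symgrad Sw) (measurable_symgrad Sv) (Lnorm_symgrad_lty Su)
  (Lnorm_symgrad_lty Sw) (Lnorm_symgrad_lty Sv) Eoo E1.
have tauM : \forall x \ae ds G, Gb x -> `|cst tau x| <= `|tau|.
  by apply: aeW => x _.
have A2 := stress_difference_le mGb r1 r2 (normr_ge0 tau) (measurable_cst tau) tauM
  (measurable_tangential_Gb Su)
  (measurable_tangential_Gb Sw) (measurable_tangential_Gb Sv) (Lnorm_tangential_lty Su)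
  (Lnorm_tangential_lty Sw) (Lnorm_tangential_lty Sv) Eoo E2.
have B1 : fine (Lpnorm_mx area Omega r%:E (symgrad v)) <= gN v.
  apply: le_trans (Lnorm_grad_le v); apply: fine_le; last exact: Lnorm_symgrad_le.
    by apply: Lnorm_fin; exact: Lnorm_symgrad_lty.
  by apply: Lpnorm_mx_fin; have [] := sobolev_pair Sv.
have B2 : fine (Lpnorm_mx (ds G) Gb r%:E (tg v)) <= 2 * (Ct * gN v).
  apply: (@le_trans _ _ (2 * fine (Lpnorm_mx (ds G) dO r%:E (tr v.1)))); last first.
    by rewrite ler_wpM2l// HCt.
  have ft : Lpnorm_mx (ds G) dO r%:E (tr v.1) \is a fin_num.
    by apply: Lnorm_fin; exact: (trace_lty HT Sv).
  rewrite -lee_fin EFinM (fineK ft) fineK; first exact: (Lnorm_tangential_le r1 HG HT Sv mGb sGb).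
  by apply: Lnorm_fin; exact: Lnorm_tangential_lty.
rewrite opprD addrACA; apply: le_trans (ler_normD _ _) _.
rewrite -/e (_ : (4 * M + 8 * `|tau| * Ct) * e * gN v =
  4 * M * e * gN v + 4 * `|tau| * e * (2 * (Ct * gN v))); last by ring.
apply: lerD.
  by apply: le_trans A1 _; apply: ler_wpM2l B1; rewrite !mulr_ge0.
by apply: le_trans A2 _; apply: ler_wpM2l B2; rewrite !mulr_ge0.
Qed.

Lemma measurable_div v : sobolev Omega r v ->
  @measurable_fun _ _ (mplane R) R Omega (div v).
Proof.
by move=> /sobolev_pair[_ [m2 _]]; apply: measurable_sum => i; exact: m2.
Qed.

Lemma Lnorm_div_le v : sobolev Omega r v ->
  (Lpnorm area Omega r%:E (div v) <= 2%:E * Lpnorm_mx area Omega r%:E v.2)%E.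
Proof.
move=> Sv; have [_ [m2 _]] := sobolev_pair Sv.
rewrite -[2]ger0_norm// -(Lnorm_scale area mO 2 r0 (measurable_mxnorm m2)).
apply: (le_Lnorm mO) => //; first exact: measurable_div.
  by apply: measurable_funM => //; exact: (measurable_mxnorm m2).
apply: aeW => x _; rewrite [leRHS]ger0_norm ?mulr_ge0 ?mxnorm_ge0//.
exact: normr_div_le.
Qed.

Lemma Lnorm_div_lty v : sobolev Omega r v -> (Lpnorm area Omega r%:E (div v) < +oo)%E.
Proof.
move=> Sv; apply: le_lt_trans (Lnorm_div_le Sv) _.
by rewrite lte_mul_pinfty//; have [_ []] := sobolev_pair Sv.
Qed.

Lemma opB_bound q v : Q G r q -> sobolev Omega r v ->
  `|opB G q v| <= 2 * fine (normQ G r q) * gN v.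
Proof.
move=> [mq qoo] Sv.
have [_] := hoelder_integrable mO r0 q0 (conj_exp_sum r1) (measurable_div Sv) mq
  (Lnorm_div_lty Sv) qoo.
move=> h; apply: le_trans h _; rewrite mulrAC; apply: ler_wpM2r.
  by rewrite fine_ge0// Lnorm_ge0.
have f2 : Lpnorm_mx area Omega r%:E v.2 \is a fin_num.
  by apply: Lpnorm_mx_fin; have [] := sobolev_pair Sv.
apply: (@le_trans _ _ (2 * fine (Lpnorm_mx area Omega r%:E v.2))); last first.
  by rewrite ler_wpM2l// Lnorm_grad_le.
rewrite -lee_fin EFinM (fineK f2) fineK; first exact: Lnorm_div_le.
by apply: Lnorm_fin; exact: Lnorm_div_lty.
Qed.

Lemma opB_sub q q' v : Q G r q -> Q G r q' -> sobolev Omega r v ->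
  opB G (q \- q') v = opB G q v - opB G q' v.
Proof.
move=> [mq qoo] [mq' qoo'] Sv.
have := Rintegral_pairing_lin (-1) mO q0 r0 (etrans (addrC _ _) (conj_exp_sum r1))
  mq' mq (measurable_div Sv) qoo' qoo (Lnorm_div_lty Sv).
have c (f : plane R -> R) : \int[area]_(x in Omega) (f x * div v x) = opB G f v.
  by apply: eq_Rintegral => x _; rewrite mulrC.
rewrite !c mulN1r addrC => <-; apply: eq_Rintegral => x _.
by rewrite mulN1r [- _ + _]addrC.
Qed.

End Estimates.

(** * Pressure and multiplier errors for a fixed discretisation *)

Section MixedErrors.
Context {R : realType} (G : geometry R) (r : R).
Context (tr : (plane R -> 'cV[R]_2) -> plane R -> 'cV[R]_2).
Context (alpha : plane R -> R) (tau c : R).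
Context (Vh : set (vfield R)) (Qh Sh : set (plane R -> R)).
Hypothesis r1 : 1 < r.
Hypotheses (HG : polygonal_domain G) (HP : boundary_partition G).
Hypothesis HT : trace_operator G r tr.
Hypothesis HBan : banach (Sigma G r tr) (normSigma G r).
Hypothesis HD : discrete_spaces G r tr Vh Qh Sh.
Local Notation Omega := (dom G).
Local Notation Gb := (Gamma_b G).
Local Notation gN := (gradseminorm G r).
Local Notation nt := (normal_trace G tr).
Local Notation r' := (conj_exp r).

Let mO : @measurable _ (mplane R) Omega. Proof. exact: measurable_dom. Qed.
Let mGb : @measurable _ (mplane R) Gb. Proof. exact: measurable_Gamma_b HP. Qed.

Lemma Vh_V v : Vh v -> V G r tr v.
Proof. by case: HD => -[k [b [_ ->]]] _ _ _ _ []. Qed.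

Lemma Qh_Q q : Qh q -> Q G r q.
Proof. by case: HD => _ _ [k [b [_ ->]]] _ _ []. Qed.

Lemma QhB x y : Qh x -> Qh y -> Qh (x \- y).
Proof.
by case: HD => _ _ hQ _ _; exact: (findim_subspaceB mO (conj_exp_ge1 r1) hQ).
Qed.

Lemma ShB x y : Sh x -> Sh y -> Sh (x \- y).
Proof.
by case: HD => _ _ _ hS _; apply: (findim_subspaceB mGb _ hS); rewrite ler1n.
Qed.

Lemma Sh_dual mu : Sh mu -> dualSigma G r tr (pairing G mu).
Proof. by move=> Smu; case: HD => _ _ _ _ /(_ mu Smu)[]. Qed.

Lemma Sh_integrable mu zeta : Sh mu -> Sigma G r tr zeta ->
  (ds G).-integrable Gb (EFin \o (mu \* zeta)).
Proof. by move=> Smu; case: HD => _ _ _ _ /(_ mu Smu)[_]; apply. Qed.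

Lemma pairingB mu mu' zeta : Sh mu -> Sh mu' -> Sigma G r tr zeta ->
  pairing G (mu \- mu') zeta = pairing G mu zeta - pairing G mu' zeta.
Proof.
move=> Smu Smu' Sz.
have := RintegralB mGb (Sh_integrable Smu Sz) (Sh_integrable Smu' Sz).
move=> <-; apply: eq_Rintegral => x _; exact: mulrBl.
Qed.

Lemma pairing_Vb mu v : Sh mu -> Vb G r tr v -> pairing G mu (nt v) = 0.
Proof.
move=> Smu [Vv v0].
have iv := Sh_integrable Smu (Sigma_normal_trace r1 HG HP HT Vv).
rewrite /pairing /Rintegral (ae_eq_integral (cst 0%E))//.
- by rewrite integral0.
- exact: (measurable_int _ iv).
by apply: ae_mono v0 => x e Gx; rewrite /= e// mulr0.
Qed.

Lemma Lambda_Vb lam v : Lambda G r tr lam -> Vb G r tr v -> lam (nt v) = 0.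
Proof.
move=> [dlam pos] [Vv v0]; have Sv := Sigma_normal_trace r1 HG HP HT Vv.
have h1 : 0 <= lam (nt v).
  by apply: pos => //; apply: ae_mono v0 => x e Gx; rewrite e.
have : 0 <= lam (-1 *: nt v).
  apply: pos; first exact: SigmaZ.
  apply: ae_mono v0 => x e Gx.
  by rewrite (_ : (-1 *: nt v) x = -1 * nt v x)// (e Gx) mulr0.
rewrite (dualZ r1 HG HP HT (-1) dlam Sv) mulN1r oppr_ge0 => h2.
by apply/eqP; rewrite eq_le h1 h2.
Qed.

Lemma dualB mu mu' : dualSigma G r tr mu -> dualSigma G r tr mu' ->
  dualSigma G r tr (mu \- mu').
Proof.
move=> [l [C hC]] [l' [C' hC']]; split.
  by move=> a x y Sx Sy; rewrite /= l// l'//; ring.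
exists (C + C') => x Sx.
have fx := Sigma_fin HBan Sx.
move: (hC x Sx) (hC' x Sx); rewrite -(fineK fx) -!EFinM !lee_fin => h h'.
by apply: le_trans (ler_normB _ _) _; rewrite mulrDl; exact: lerD.
Qed.

Lemma dualnormD mu mu' : dualSigma G r tr mu -> dualSigma G r tr mu' ->
  (normSigma' G r tr (mu \+ mu')%R <= normSigma' G r tr mu + normSigma' G r tr mu')%E.
Proof.
move=> dm dm'; apply: ge_ereal_sup => _ [x [Sx x1] <-].
apply: (@le_trans _ _ (`|mu x|%:E + `|mu' x|%:E)%E).
  by rewrite -EFinD lee_fin; exact: ler_normD.
by apply: leeD; apply: ereal_sup_ubound; exists x.
Qed.

(* The inf-sup conditions use the W^{1,r} norm, which is equivalent to gN up to
   the factor 2. *)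
Lemma infsup_le (P : set (vfield R)) (phi : vfield R -> R) (M : R) : 0 <= M ->
  (forall v, P v -> [/\ V G r tr v, normV G r v != 0%E & phi v <= M * gN v]) ->
  (ereal_sup [set (phi v / fine (normV G r v))%:E | v in P] <= (2 * M)%:E)%E.
Proof.
move=> M0 hP; apply: ge_ereal_sup => _ [v Pv <-]; have [Vv v0 hv] := hP v Pv.
have pv := sobolev_pair (V_sobolev Vv).
have fv : normV G r v \is a fin_num := sobolev_norm_fin pv.
have vp : 0 < fine (normV G r v).
  by rewrite lt_neqAle fine_ge0 ?poweR_ge0// andbT eq_sym fine_eq0.
rewrite lee_fin ler_pdivrMr//; apply: le_trans hv _.
by rewrite [2 * M]mulrC -mulrA; apply: (ler_wpM2l M0); exact: gradseminorm_le.
Qed.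

Context (f : plane R -> 'cV[R]_2) (ps pw : plane R -> R).
Context (u : vfield R) (p : plane R -> R) (lam : (plane R -> R) -> R).
Context (uh : vfield R) (ph lamh : plane R -> R).
Hypothesis Hu : mixed_solution G r tr alpha tau f ps pw u p lam.
Hypothesis Huh : discrete_solution G r tr alpha tau Vh Qh Sh f ps pw uh ph lamh.
Context (K : R).
Local Notation e := (fine (E G r tr u uh `^ r'^-1)%E).
Hypothesis K0 : 0 <= K.
Hypothesis flux_le : forall v, V G r tr v ->
  `|(opA G r alpha u v + opG G r tr tau u v) -
    (opA G r alpha uh v + opG G r tr tau uh v)| <= K * e * gN v.

Let Qp : Q G r p. Proof. by case: Hu => -[]. Qed.
Let Llam : Lambda G r tr lam. Proof. by case: Hu => -[]. Qed.
Let Qph : Q G r ph. Proof. by case: Huh => -[_ /Qh_Q]. Qed.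
Let Shlamh : Sh lamh. Proof. by case: Huh => -[_ _ []]. Qed.

Lemma momentum_error v : Vh v ->
  lam (nt v) - pairing G lamh (nt v) =
  (opA G r alpha u v + opG G r tr tau u v) -
  (opA G r alpha uh v + opG G r tr tau uh v) - opB G (p \- ph) v.
Proof.
move=> Vhv; have Vv := Vh_V Vhv; have [_ [/(_ v Vv) eu _ _]] := Hu.
have [_ [/(_ v Vhv) euh _ _]] := Huh.
rewrite (opB_sub r1 HG Qp Qph (V_sobolev Vv)).
by move: eu euh => /subr0_eq <- /subr0_eq <-; ring.
Qed.

Hypothesis c0 : 0 < c.
Hypothesis iB : infsup_B G r tr Vh Qh c.
Hypothesis iS : infsup_Sigma G r tr Vh Sh c.

Let e0 : 0 <= e. Proof. by rewrite fine_ge0// poweR_ge0. Qed.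
Let nQ0 q : (0 <= normQ G r q)%E. Proof. exact: Lnorm_ge0. Qed.
Let QB q q' : Q G r q -> Q G r q' -> Q G r (q \- q').
Proof. exact: (LpB mO (conj_exp_ge1 r1)). Qed.
Let fQ q : Q G r q -> normQ G r q \is a fin_num. Proof. exact: Lpnorm_fin. Qed.

(** The triangle inequality through qh contributes the 1. The inf-sup condition gives c |qh - ph| <=
    2 (K e + 2 a), where the outer 2 compares [gN] with the W^{1,r} norm and the inner 2 bounds the
    divergence by the gradient. *)
Lemma pressure_error qh : Qh qh ->
  fine (normQ G r (p \- ph)) <=
  (1 + 4 / c + 2 * K / c) * (e + fine (normQ G r (p \- qh))).
Proof.
move=> Qhqh; have Qqh := Qh_Q Qhqh; set a := fine (normQ G r (p \- qh)).
have Qhph : Qh ph by case: Huh => -[].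
have a0 : 0 <= a by rewrite fine_ge0.
have M0 : 0 <= K * e + 2 * a by rewrite addr_ge0 ?mulr_ge0.
have h : c * fine (normQ G r (qh \- ph)) <= 2 * (K * e + 2 * a).
  rewrite -lee_fin EFinM (fineK (fQ (QB Qqh Qph))).
  apply: le_trans (iB (QhB Qhqh Qhph)) _; apply: infsup_le => // v [Vhv Vbv nv].
  have Vv := Vh_V Vhv; have Sv := V_sobolev Vv; split => //.
  have := momentum_error Vhv.
  rewrite (pairing_Vb Shlamh Vbv) (Lambda_Vb Llam Vbv) subrr => /esym/subr0_eq.
  rewrite (opB_sub r1 HG Qp Qph Sv) (opB_sub r1 HG Qqh Qph Sv) => me.
  (* Replacing p by qh in the momentum error leaves only the flux difference and the approximation
     error p - qh on the right. *)
  have -> : opB G qh v - opB G ph v =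
      ((opA G r alpha u v + opG G r tr tau u v) -
       (opA G r alpha uh v + opG G r tr tau uh v)) - opB G (p \- qh) v.
    by rewrite me (opB_sub r1 HG Qp Qqh Sv); ring.
  apply: le_trans (ler_norm _) _; apply: le_trans (ler_normB _ _) _.
  rewrite mulrDl; apply: lerD; first exact: flux_le.
  exact: (opB_bound r1 HG (QB Qp Qqh) Sv).
have t : fine (normQ G r (p \- ph)) <= a + fine (normQ G r (qh \- ph)).
  rewrite -lee_fin EFinD !fineK ?fQ//; try exact: QB.
  have := LpnormD mO (conj_exp_ge1 r1) (QB Qp Qqh) (QB Qqh Qph).
  by rewrite (_ : (p \- qh) + (qh \- ph) = p \- ph)//; apply/funext => x;
    rewrite /= addrA subrK.
apply: le_trans t _; move: h; rewrite mulrC -ler_pdivlMr// => h.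
apply: le_trans (lerD (lexx a) h) _.
rewrite -subr_ge0.
have -> : (1 + 4 / c + 2 * K / c) * (e + a) - (a + 2 * (K * e + 2 * a) / c) =
   e + 4 * (e / c) + 2 * K * (a / c) by ring.
by rewrite !addr_ge0// !mulr_ge0// invr_ge0 ltW.
Qed.

Context (Ks : R).
Hypothesis Ks0 : 0 <= Ks.
Hypothesis trace_le : forall v, V G r tr v ->
  (normSigma G r (nt v) <= (Ks * gN v)%:E)%E.

(** Test fields now range over all of Vh, so the pressure error remains and is eliminated later by
    [pressure_error]. The term lam - muh is tested on nt v, and its dual norm is multiplied by the
    trace constant Ks; 2 and 4 arise as for the pressure. *)
Lemma multiplier_error muh : Sh muh ->
  normSigma' G r tr (lam \- pairing G muh)%R \is a fin_num ->
  (normSigma' G r tr (lam \- pairing G lamh)%R <=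
   ((1 + 2 * Ks / c) * fine (normSigma' G r tr (lam \- pairing G muh)%R) +
    2 * K / c * e + 4 / c * fine (normQ G r (p \- ph)%R))%:E)%E.
Proof.
move=> Shmuh fb; set b := fine _; set P := fine (normQ _ _ _).
have dl : dualSigma G r tr lam by case: Llam.
have dm := dualB dl (Sh_dual Shmuh).
have dd := Sh_dual (ShB Shmuh Shlamh).
have b0 : 0 <= b by rewrite fine_ge0// (dualnorm_ge0 r1 HG HP HT dm).
have P0 : 0 <= P by rewrite fine_ge0.
have M0 : 0 <= b * Ks + K * e + 2 * P by rewrite !addr_ge0 ?mulr_ge0.
have h : (c%:E * normSigma' G r tr (pairing G (muh \- lamh)%R) <=
    (2 * (b * Ks + K * e + 2 * P))%:E)%E.
  apply: le_trans (iS (ShB Shmuh Shlamh)) _; apply: infsup_le => // v [Vhv nv].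
  have Vv := Vh_V Vhv; have Sv := V_sobolev Vv; split => //.
  have Sn := Sigma_normal_trace r1 HG HP HT Vv.
  rewrite (pairingB Shmuh Shlamh Sn).
  have -> : pairing G muh (nt v) - pairing G lamh (nt v) =
      (lam (nt v) - pairing G lamh (nt v)) - (lam \- pairing G muh) (nt v).
    by rewrite /=; ring.
  rewrite (momentum_error Vhv).
  apply: le_trans (ler_norm _) _; apply: le_trans (ler_normB _ _) _.
  have lb : `|(lam \- pairing G muh) (nt v)| <= b * Ks * gN v.
    rewrite -lee_fin; apply: le_trans (dualnorm_bound r1 HG HP HT HBan dm Sn) _.
    rewrite -mulrA (EFinM b) (fineK fb).
    by apply: lee_wpmul2l (trace_le Vv); exact: (dualnorm_ge0 r1 HG HP HT dm).
  rewrite -(addrA (b * Ks)) (addrC (b * Ks)) mulrDl; apply: (lerD _ lb).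
  apply: le_trans (ler_normB _ _) _; rewrite mulrDl; apply: lerD.
    exact: flux_le.
  exact: (opB_bound r1 HG (QB Qp Qph) Sv).
have h' : (normSigma' G r tr (pairing G (muh \- lamh)%R) <=
    (2 * (b * Ks + K * e + 2 * P) / c)%:E)%E.
  by rewrite mulrC EFinM lee_pdivlMl.
have t : (normSigma' G r tr (lam \- pairing G lamh)%R <=
    normSigma' G r tr (lam \- pairing G muh)%R +
    normSigma' G r tr (pairing G (muh \- lamh)%R))%E.
  (* The two functionals are compared on Sigma only, where products with elements of Sh are
     integrable and [pairingB] applies. *)
  apply: le_trans (dualnormD dm dd).
  apply: ereal_sup_le => _ [x [Sx x1] <-]; exists x => //.
  by rewrite /= (pairingB Shmuh Shlamh Sx) addrA subrK.
apply: le_trans t _; rewrite -(fineK fb) -/b.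
apply: le_trans (leeD (lexx _) h') _.
rewrite -EFinD lee_fin le_eqVlt; apply/orP; left; apply/eqP; ring.
Qed.

End MixedErrors.

Theorem lemma3p6 (R : realType) (G : geometry R) (r : R)
    (tr : (plane R -> 'cV[R]_2) -> plane R -> 'cV[R]_2)
    (alpha : plane R -> R) (alpha0 tau c : R)
    (Vh : R -> set (vfield R)) (Qh Sh : R -> set (plane R -> R)) :
  1 < r -> r <= 2 ->
  polygonal_domain G -> boundary_partition G -> trace_operator G r tr ->
  Lp area (dom G) +oo%E alpha -> 0 < alpha0 ->
  (\forall x \ae @area R, dom G x -> alpha0 <= alpha x) ->
  0 < tau ->
  banach (Sigma G r tr) (normSigma G r) ->
  (forall h, 0 < h -> discrete_spaces G r tr (Vh h) (Qh h) (Sh h)) ->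
  0 < c ->
  (forall h, 0 < h -> infsup_B G r tr (Vh h) (Qh h) c) ->
  (forall h, 0 < h -> infsup_Sigma G r tr (Vh h) (Sh h) c) ->
  exists C : R, 0 < C /\
    forall (f : plane R -> 'cV[R]_2) (ps pw : plane R -> R),
      Lp_mx area (dom G) (conj_exp r)%:E f ->
      Lp (ds G) (Gamma_s G) (conj_exp r)%:E ps ->
      Lp (ds G) (Gamma_b G) (conj_exp r)%:E pw ->
    forall (u : vfield R) (p : plane R -> R) (lam : (plane R -> R) -> R),
      mixed_solution G r tr alpha tau f ps pw u p lam ->
    forall h (uh : vfield R) (ph lamh : plane R -> R), 0 < h ->
      discrete_solution G r tr alpha tau (Vh h) (Qh h) (Sh h) f ps pw
        uh ph lamh ->
    forall qh muh : plane R -> R, Qh h qh -> Sh h muh ->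
      (normQ G r (p \- ph)%R <=
         C%:E * (E G r tr u uh `^ (conj_exp r)^-1 + normQ G r (p \- qh)%R))%E /\
      (normSigma' G r tr (lam \- pairing G lamh)%R <=
         C%:E * (E G r tr u uh `^ (conj_exp r)^-1 + normQ G r (p \- qh)%R +
                 normSigma' G r tr (lam \- pairing G muh)%R))%E.
Proof.
move=> r1 r2 HG HP HT La _ _ _ HBan HD c0 iB iS.
(* K and Ks are fixed before the data, h and the solutions are introduced, which makes C independent
   of them. *)
have [K K0 HK] := flux_difference_bound r1 r2 HG HP HT tau La.
have [Ks Ks0 HKs] := normal_trace_Sigma_bound r1 HG HP HT HBan.
have ci : 0 <= c^-1 by rewrite invr_ge0 ltW.
(* C1 is the constant of [pressure_error]; C2 adds up the coefficients of [multiplier_error], with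
   the pressure error replaced by its own bound. *)
pose C1 := 1 + 4 / c + 2 * K / c.
pose C2 := 1 + 2 * Ks / c + 2 * K / c + 4 / c * C1.
have C1p : 0 < C1 by rewrite /C1 -addrA ltr_wpDr// addr_ge0// !mulr_ge0.
have C2p : 0 < C2.
  by rewrite /C2 -!addrA ltr_wpDr// !addr_ge0// !mulr_ge0// ltW.
exists (C1 + C2); split; first exact: addr_gt0.
move=> f ps pw _ _ _ u p lam Hu h uh ph lamh h0 Huh qh muh Qqh Smuh.
have [[Vu Qp Llam] _] := Hu.
set EE := E G r tr u uh; set b := normSigma' G r tr (lam \- pairing G muh)%R.
have E0 : (0 <= EE `^ (conj_exp r)^-1)%E by exact: poweR_ge0.
have Q0 : (0 <= normQ G r (p \- qh)%R)%E by exact: Lnorm_ge0.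
have b0 : (0 <= b)%E.
  apply: (dualnorm_ge0 r1 HG HP HT); apply: dualB HBan _ _ _ _; first by case: Llam.
  exact: Sh_dual (HD h h0) _ Smuh.
have Cp : (0 < (C1 + C2)%:E)%E by rewrite lte_fin addr_gt0.
(* An infinite E has to be treated apart because [fine] would send it to 0; both right-hand sides
   are then +oo. *)
have [Eoo|Eoo] := eqVneq EE +oo%E.
  have -> : (EE `^ (conj_exp r)^-1 = +oo)%E.
    by rewrite Eoo poweRyr// invr_eq0 gt_eqF// conj_exp_gt0.
  have neqNy (x : \bar R) : (0 <= x)%E -> x != -oo%E by case: x.
  by rewrite !addye ?neqNy// gt0_muley// !leey.
have e0 : (0 <= EE)%E by rewrite /EE /E adde_ge0// expe_ge0// Lnorm_ge0.
have Elt : (EE < +oo)%E by rewrite lt_neqAle Eoo leey.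
have fe : (EE `^ (conj_exp r)^-1)%E \is a fin_num.
  have fEE : EE \is a fin_num by rewrite ge0_fin_numE.
  by rewrite -(fineK fEE) poweR_EFin.
have Qqh' := Qh_Q (HD h h0) Qqh.
have Qph : Q G r ph by case: Huh => -[_ /(Qh_Q (HD h h0))].
have QB q q' : Q G r q -> Q G r q' -> normQ G r (q \- q')%R \is a fin_num.
  move=> Qq Qq'; apply: Lpnorm_fin.
  exact: (LpB (measurable_dom HG) (conj_exp_ge1 r1)).
have Vhuh : Vh h uh by case: Huh => -[].
have flux v (Vv : V G r tr v) :=
  HK u uh v (V_sobolev Vu) (V_sobolev (Vh_V (HD h h0) Vhuh)) (V_sobolev Vv) Elt.
have P1 := pressure_error r1 HG HP HT (HD h h0) Hu Huh K0 flux c0 (iB h h0) Qqh.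
set e := fine (EE `^ (conj_exp r)^-1)%E in P1 *.
set a := fine (normQ G r (p \- qh)%R) in P1.
have a0 : 0 <= a by rewrite fine_ge0.
have e0' : 0 <= e by rewrite fine_ge0.
split.
  rewrite -(fineK fe) -(fineK (QB _ _ Qp Qqh')) -(fineK (QB _ _ Qp Qph)).
  rewrite -EFinD -EFinM lee_fin; apply: le_trans P1 _.
  by rewrite ler_wpM2r ?addr_ge0// lerDl ltW.
have [boo|boo] := eqVneq b +oo%E.
  by rewrite boo addey ?gt0_muley ?leey// -(fineK fe) -(fineK (QB _ _ Qp Qqh')).
have fb : b \is a fin_num by rewrite ge0_fin_numE// lt_neqAle boo leey.
have M1 := multiplier_error r1 HG HP HT HBan (HD h h0) Hu Huh K0 flux c0 (iS h h0) Ks0 HKs Smuh fb.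
apply: le_trans M1 _.
rewrite -(fineK fe) -(fineK (QB _ _ Qp Qqh')) -/b -(fineK fb) -/e -/a.
set be := fine b; have be0 : 0 <= be by rewrite fine_ge0.
rewrite -!EFinD -EFinM lee_fin.
have D0 : 0 <= 4 / c by rewrite mulr_ge0.
apply: le_trans (lerD (lexx _) (ler_wpM2l D0 P1)) _.
rewrite -subr_ge0 -/C1.
(* The slack between the two sides, written as a sum of products of nonnegative quantities. *)
have -> : (C1 + C2) * (e + a + be) -
    ((1 + 2 * Ks / c) * be + 2 * K / c * e + 4 / c * (C1 * (e + a))) =
    C1 * (e + a + be) + (1 + 2 * Ks / c) * (e + a) + 2 * K / c * (a + be) +
    4 / c * C1 * be.
  by rewrite /C2; ring.
by rewrite !addr_ge0// !mulr_ge0// ?addr_ge0// ?mulr_ge0// ltW.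
Qed.
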